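(* Let $d\ge2$, $\rho\in[0,1)$, $Q=(q_{ij})\in O(d)$, and let $(U_j,V_j)$, $j=1,\dots,n$, be i.i.d. random vectors on $S^{d-1}\times S^{d-1}$ each with density $$c(u,v)=\frac{1}{A_{d-1}^2}\,\frac{1-\rho^2}{(1-2\rho\,u'Qv+\rho^2)^{d/2}}.$$ Define the estimator $\widehat{\rho Q}=\frac{d}{n}\sum_{j=1}^n U_jV_j'$. Then: (i) $\widehat{\rho Q}$ is an unbiased and consistent estimator of $\rho Q$; (ii) letting $g$ map a $d\times d$ matrix $A=(a_1,\dots,a_d)$ (columns $a_k$) to the vector $g(A)=(a_1',\dots,a_d')'\in\mathbb{R}^{d^2}$, we have $\sqrt n\{g(\widehat{\rho Q})-g(\rho Q)\}\xrightarrow{d} N(0,\Sigma)$ as $n\to\infty$, where $\Sigma=(\sigma_{mn})$ is given, for $m=d(j-1)+i$ and $n=d(l-1)+k$ with $1\le i,j,k,l\le d$, by $$\sigma_{mn}=\begin{cases}1+\dfrac{\rho^2}{d+2}\{(d-2)q_{ij}^2-2\}, & m=n,\\[2mm] \dfrac{\rho^2}{d+2}(d\,q_{kj}q_{il}-2q_{ij}q_{kl}), & \text{otherwise.}\end{cases}$$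
   Context: $S^{d-1}=\{x\in\mathbb{R}^d:\|x\|=1\}$, $x'$ denotes transpose, $O(d)$ is the group of $d\times d$ orthogonal matrices, and $A_{d-1}=2\pi^{d/2}/\Gamma(d/2)$. The paper writes the estimator as $\hat\rho\hat Q$. *)

(* Defs.v *)
From HB Require Import structures.
From mathcomp Require Import all_boot all_order all_algebra.
From mathcomp Require Import all_classical all_reals all_analysis.
Set Implicit Arguments. Unset Strict Implicit. Unset Printing Implicit Defensive.
Import Order.TTheory GRing.Theory Num.Theory.
Import numFieldNormedType.Exports.
Local Open Scope classical_set_scope.
Local Open Scope ring_scope.

Section Defs.
Variable R : realType.

(* Iterated Lebesgue integral over R^n of F (only the first n coordinates of
   the argument x : nat -> R are used); by Fubini this is the integral with
   respect to n-dimensional Lebesgue measure for the (continuous, integrable)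
   integrands used below. *)
Fixpoint iint (n : nat) (F : (nat -> R) -> R) : R :=
  match n with
  | 0 => F (fun _ => 0)
  | n'.+1 => \int[@lebesgue_measure R]_(t in setT)
               iint n' (fun x => F (fun k => if k == n' then t else x k))
  end.

Definition row_of (d : nat) (x : nat -> R) : 'rV[R]_d := \row_(i < d) x i.

Definition leb_int (d : nat) (f : 'rV[R]_d -> R) : R :=
  iint d (fun x => f (row_of d x)).

Definition enorm (d : nat) (x : 'rV[R]_d) : R :=
  Num.sqrt (\sum_(i < d) x ord0 i ^+ 2).

(* Integral over S^{d-1} w.r.t. the surface (Hausdorff) measure sigma,
   defined as the cone measure: sigma(A) = d * Leb{ t x : x in A, 0 < t <= 1 },
   i.e.  int_{S^{d-1}} phi dsigma = d * int_{|x| <= 1} phi(x/|x|) dx. *)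
Definition sphere_int (d : nat) (phi : 'rV[R]_d -> R) : R :=
  d%:R * leb_int (fun x : 'rV[R]_d =>
            if enorm x <= 1 then phi ((enorm x)^-1 *: x) else 0).

(* Gamma(k/2) for k >= 1: Gamma(1/2) = sqrt pi, Gamma(1) = 1,
   Gamma(x+1) = x Gamma(x). *)
Fixpoint gamma_half (k : nat) : R :=
  match k with
  | 0 => 0 (* unused: Gamma has a pole at 0 *)
  | 1 => Num.sqrt pi
  | 2 => 1
  | k'.+2 => (k'%:R / 2) * gamma_half k'
  end.

(* A_{d-1} = 2 pi^{d/2} / Gamma(d/2), the surface area of S^{d-1} *)
Definition Asurf (d : nat) : R := 2 * pi `^ (d%:R / 2) / gamma_half d.

Definition cdens (d : nat) (rho : R) (Q : 'M[R]_d) (u v : 'rV[R]_d) : R :=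
  (Asurf d ^+ 2)^-1 * ((1 - rho ^+ 2) /
     (1 - 2 * rho * (u *m Q *m v^T) ord0 ord0 + rho ^+ 2) `^ (d%:R / 2)).

(* the estimator  (d/n) sum_{j=1}^n U_j V_j'  (U_j, V_j as row vectors, so
   U_j V_j' is u^T *m v; the sample is indexed from 0) *)
Definition rhoQhat (T : Type) (d : nat) (U V : nat -> T -> 'rV[R]_d)
    (n : nat) (w : T) : 'M[R]_d :=
  (d%:R / n%:R) *: \sum_(j < n) ((U j w)^T *m V j w).

(* g : stacks the columns a_1, ..., a_d of A into a vector of R^{d^2};
   entry (i,j) of A goes to position d*j + i (0-based), i.e. m = d(j-1)+i. *)
Definition gvec (d : nat) (A : 'M[R]_d) : 'rV[R]_(d * d) := mxvec A^T.

(* decoding a position m of gvec into the entry (i, j) it comes from *)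
Definition gidx (d : nat) (m : 'I_(d * d)) : 'I_d * 'I_d :=
  let p := enum_val (cast_ord (esym (mxvec_cast d d)) m) : 'I_d * 'I_d in (p.2, p.1).

Definition Sigma (d : nat) (rho : R) (Q : 'M[R]_d) : 'M[R]_(d * d) :=
  \matrix_(m, n)
    (let i := (gidx m).1 in let j := (gidx m).2 in
     let k := (gidx n).1 in let l := (gidx n).2 in
     if m == n then 1 + rho ^+ 2 / (d%:R + 2) *
                       ((d%:R - 2) * Q i j ^+ 2 - 2)
     else rho ^+ 2 / (d%:R + 2) * (d%:R * Q k j * Q i l - 2 * Q i j * Q k l)).

Definition gauss1 (t : R) : R := expR (- (t ^+ 2) / 2) / Num.sqrt (2 * pi).

Definition std_normal_E (k : nat) (f : 'rV[R]_k -> R) : R :=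
  iint k (fun x => f (row_of k x) * \prod_(i < k) gauss1 (x i)).

(* expectation of f under N(0, Sigma) where Sigma = A A^T : the law of Z A^T
   with Z ~ N(0, I_k) (row vectors) *)
Definition normal_E (k : nat) (A : 'M[R]_k) (f : 'rV[R]_k -> R) : R :=
  std_normal_E (fun z => f (z *m A^T)).


Definition sigmaUV (d0 : measure_display) (T : measurableType d0) (d : nat)
    (U V : nat -> T -> 'rV[R]_d) (j : nat) : set (set T) :=
  <<s [set A | exists (i : 'I_d) (B : set R), measurable B /\
          (A = (fun w => U j w ord0 i) @^-1` B \/
           A = (fun w => V j w ord0 i) @^-1` B)] >>.

Definition mutually_independent (d0 : measure_display) (T : measurableType d0)
    (P : probability T R) (d : nat) (U V : nat -> T -> 'rV[R]_d) : Prop :=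
  forall (J : seq nat) (E : nat -> set T), uniq J ->
    (forall j, j \in J -> sigmaUV U V j (E j)) ->
    fine (P (\big[setI/setT]_(j <- J) E j)) = \prod_(j <- J) fine (P (E j)).

End Defs.

(* Main.v *)
Require Import Defs.
From HB Require Import structures.
From mathcomp Require Import all_boot all_order all_algebra.
From mathcomp Require Import all_classical all_reals all_analysis.
From mathcomp Require Import measurable_realfun.
From mathcomp Require Import ring lra.
Set Implicit Arguments. Unset Strict Implicit. Unset Printing Implicit Defensive.
Import Order.TTheory GRing.Theory Num.Theory.
Import numFieldNormedType.Exports.
Local Open Scope classical_set_scope.
Local Open Scope ring_scope.

(* Rotation invariance of the surface integral, obtained from translation
   invariance and Fubini by writing a plane rotation as three shears, makes the
   integrals of v_i d_j f - v_j d_i f vanish. These integrations by parts give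
   the moments of the uniform law up to order four and show that the integral of
   the Poisson kernel P(y, v) = (1 - |y|^2) |y - v|^(-d) and its moments against
   v_i and v_i v_k are the expected polynomials in y. Conditioning on u, with
   y = rho Q'u, turns this into the means E[u_i v_j] = rho q_ij / d and the fourth
   moments behind Sigma.

   The summands are bounded, so unbiasedness and, by Chebyshev, consistency
   follow from the moments. For the normal limit the expectations of
   cos (t.S_n + c) are compared with those of the Gaussian by a Taylor expansion
   and independence. Bounded continuous functions are approximated by
   trigonometric polynomials up to e (1 + |x|^2), and second moments are bounded,
   so the convergence extends to them. Sigma is a covariance matrix, hence
   positive semidefinite and of the form A A'. *)

(** * Iterated integrals *)

(** [sphere_int] is an iterated one-dimensional integral of a cone, so its rotation invariance is
    not visible: the symmetries at hand are translations of one variable and exchanges of two. A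
    shear is a translation once the other variables are frozen, and the rational parameter u =
    tan(theta/2) keeps the factorization of a rotation algebraic. Sphere integrals are then only
    related linearly to one another and to the total mass. The radial system for the Poisson kernel
    is singular at r = 0, where its values are known, so continuity at 0 fixes the constants.
    Independence is given for events only; expectations of products are recovered from superlevel
    sets. The phase c in cos (t.x + c) lets real cosines carry the whole characteristic function and
    closes them under addition formulas. Trigonometric polynomials are in general not uniformly
    close to a bounded continuous function on the whole space; this forces the weight 1 + |x|^2, and
    bounded second moments then play the part of tightness. *)

Section IteratedIntegral.
Variable R : realType.
Local Notation mu := (@lebesgue_measure R).
Local Notation GR := (measurableTypeR R).
Implicit Types (F G : (nat -> R) -> R) (y : nat -> R).

Definition upd (y : nat -> R) (k : nat) (t : R) : nat -> R :=
  fun i => if i == k then t else y i.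

(** No sigma-algebra is placed on [nat -> R]: measurability is tested along every family with
    measurable coordinates. The class is then stable under substitution of coordinates and under
    integrating one of them out. *)
Definition cyl_measurable (F : (nat -> R) -> R) : Prop :=
  forall d (S : measurableType d) (p : S -> nat -> R),
    (forall k, measurable_fun setT (fun s => p s k)) ->
    measurable_fun setT (fun s => F (p s)).

Definition Int1 (k : nat) (F : (nat -> R) -> R) (y : nat -> R) : R :=
  \int[mu]_(t in setT) F (upd y k t).

Definition Ints (s : seq nat) (F : (nat -> R) -> R) : (nat -> R) -> R :=
  foldr Int1 F s.

Lemma upd_same y k t : upd y k t k = t.
Proof. by rewrite /upd eqxx. Qed.

Lemma upd_diff y k t i : i != k -> upd y k t i = y i.
Proof. by rewrite /upd => /negbTE->. Qed.

Lemma updC y i j s t : i != j -> upd (upd y i s) j t = upd (upd y j t) i s.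
Proof.
move=> ij; apply/funext => k; rewrite /upd.
by have [->|//] := eqVneq k j; rewrite eq_sym (negbTE ij).
Qed.

Lemma Int1_upd k n F y t : k != n ->
  Int1 k (fun x => F (upd x n t)) y = Int1 k F (upd y n t).
Proof. by move=> kn; apply: eq_Rintegral => s _; rewrite updC. Qed.

Lemma Ints_upd s n F y t : n \notin s ->
  Ints s (fun x => F (upd x n t)) y = Ints s F (upd y n t).
Proof.
elim: s y => [//|k s IH] y; rewrite inE negb_or => /andP[nk ns] /=.
rewrite -Int1_upd 1?eq_sym//; congr (Int1 _ _ _); apply/funext => x; exact: IH.
Qed.

(** The list starts with the outermost variable, and [iint] has its largest index outermost, hence
    the reversal. *)
Lemma iintE n F : iint n F = Ints (rev (iota 0 n)) F (fun=> 0).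
Proof.
elim: n F => [//|n IH] F.
rewrite -addn1 iotaD add0n rev_cat /= addn1 /=.
apply: eq_Rintegral => t _; rewrite IH -Ints_upd //.
by rewrite mem_rev mem_iota add0n ltnn andbF.
Qed.

Lemma measurable_upd d (S : measurableType d) (p : S -> nat -> R) k :
  (forall i, measurable_fun setT (fun s => p s i)) ->
  forall i, measurable_fun setT (fun st : S * GR => upd (p st.1) k st.2 i).
Proof.
move=> mp i; rewrite /upd; case: eqP => _; first exact: measurable_snd.
exact: (measurableT_comp (mp i)).
Qed.

(** The integral is the difference of those of the positive and negative parts, each measurable in
    the parameter by Tonelli; [fine] takes care of infinite values. *)
Lemma cyl_measurable_Int1 k F : cyl_measurable F -> cyl_measurable (Int1 k F).
Proof.
move=> mF d S p mp.
pose H (st : S * GR) := F (upd (p st.1) k st.2).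
have mH : measurable_fun setT (EFin \o H).
  apply/measurable_EFinP.
  exact: (mF _ _ (fun st : S * GR => upd (p st.1) k st.2) (measurable_upd k mp)).
have mE : measurable_fun setT (fun s => (\int[mu]_t (EFin \o H)^\+ (s, t)
    - \int[mu]_t (EFin \o H)^\- (s, t))%E).
  apply: emeasurable_funB.
  - apply: (measurable_fun_fubini_tonelli_F (m2 := mu) (EFin \o H)^\+%E).
      exact: measurable_funepos mH.
    by move=> x; exact: funepos_ge0.
  - apply: (measurable_fun_fubini_tonelli_F (m2 := mu) (EFin \o H)^\-%E).
      exact: measurable_funeneg mH.
    by move=> x; exact: funeneg_ge0.
apply: eq_measurable_fun (measurableT_comp (fine_measurable measurableT) mE).
move=> s _ /=; congr fine; rewrite [RHS]integralE; congr (_ - _)%E.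
  by apply: eq_integral => t _; rewrite !funeposE.
by apply: eq_integral => t _; rewrite !funenegE.
Qed.

Variable b : R -> R.
Hypothesis b0 : forall t, 0 <= b t.
Hypothesis ib : mu.-integrable setT (EFin \o b).

(** A product majorant survives integration of any one variable, so a single hypothesis makes all
    partial integrals converge in any order. It is used with b = [box 1] for the sphere and with b =
    [gweight] for the normal law. *)
Definition dominated (s : seq nat) (F : (nat -> R) -> R) : Prop :=
  cyl_measurable F /\
  exists2 C, 0 <= C & forall y, `|F y| <= C * \prod_(k <- s) b (y k).

Let mb : measurable_fun setT b.
Proof. by apply/measurable_EFinP; exact: measurable_int ib. Qed.

Lemma bprod_ge0 s y : 0 <= \prod_(k <- s) b (y k).
Proof. by apply: prodr_ge0 => i _; exact: b0. Qed.

Lemma bprod_upd s y k t : k \notin s ->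
  \prod_(i <- s) b (upd y k t i) = \prod_(i <- s) b (y i).
Proof.
move=> ks; apply: eq_big_seq => i si; rewrite upd_diff//.
by apply: contraNneq ks => <-.
Qed.

Lemma cyl_measurable_section F y k : cyl_measurable F ->
  measurable_fun setT (fun t => F (upd y k t)).
Proof.
move=> mF; apply: (mF _ _ (fun t => upd y k t)) => i; rewrite /upd.
by case: eqP => _; [exact: measurable_id|exact: measurable_cst].
Qed.

Lemma dominated_integrable F y k s : k \notin s -> dominated (k :: s) F ->
  mu.-integrable setT (fun t => (F (upd y k t))%:E).
Proof.
move=> ks [mF [C C0 HF]].
apply: (@le_integrable _ _ _ mu setT measurableT _
  (fun t => ((C * \prod_(i <- s) b (y i)) * b t)%:E)) => //.
- by apply/measurable_EFinP; exact: cyl_measurable_section.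
- move=> t _; rewrite lee_fin (le_trans (HF _))//.
  rewrite big_cons upd_same bprod_upd// [b t * _]mulrC mulrA ler_norm//.
- by have := integrableZl measurableT (C * \prod_(i <- s) b (y i)) ib.
Qed.

Lemma dominated_Int1 k s F : k \notin s -> dominated (k :: s) F ->
  dominated s (Int1 k F).
Proof.
move=> ks HF; have [mF [C C0 HC]] := HF.
split; first exact: cyl_measurable_Int1.
exists (C * \int[mu]_(t in setT) b t).
  by rewrite mulr_ge0//; exact: Rintegral_ge0.
move=> y; apply: le_trans (le_normr_Rintegral measurableT _) _.
  exact: dominated_integrable HF.
rewrite mulrAC -RintegralZl//; apply: le_Rintegral => //.
- by have := dominated_integrable y ks HF => /integrable_norm.
- by have := integrableZl measurableT (C * \prod_(i <- s) b (y i)) ib.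
- move=> t _; rewrite (le_trans (HC _))//.
  by rewrite big_cons upd_same bprod_upd// [b t * _]mulrC mulrA.
Qed.

Lemma dominated_perm s s' F : perm_eq s s' -> dominated s F -> dominated s' F.
Proof.
move=> ss' [mF [C C0 HC]]; split => //; exists C => // y.
by rewrite -(perm_big _ ss').
Qed.

Let uniq_mid (k : nat) s s' : uniq (k :: s ++ s') -> uniq (s ++ k :: s').
Proof. by rewrite -[k :: s']cat1s uniq_catCA. Qed.

Let dom_mid k s s' F : dominated (k :: s ++ s') F -> dominated (s ++ k :: s') F.
Proof.
by apply: dominated_perm; rewrite -(cat1s k s') perm_sym perm_catCA.
Qed.

(** Peeling off the outermost variable moves it from s to the list s' of variables still free, so
    the induction is generalized over s'. *)
Lemma dominated_Ints s s' F : uniq (s ++ s') -> dominated (s ++ s') F ->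
  dominated s' (Ints s F).
Proof.
elim: s s' => [//|k s IH] s' /= us HF.
apply: dominated_Int1.
  by move: us; rewrite mem_cat negb_or => /andP[/andP[]].
by apply: IH; [exact: uniq_mid|exact: dom_mid].
Qed.

Lemma Int1D k s F G y : k \notin s -> dominated (k :: s) F ->
  dominated (k :: s) G ->
  Int1 k (fun y => F y + G y) y = Int1 k F y + Int1 k G y.
Proof.
by move=> ks HF HG; apply: RintegralD => //;
  [exact: dominated_integrable HF|exact: dominated_integrable HG].
Qed.

Lemma Int1Z k s F a y : k \notin s -> dominated (k :: s) F ->
  Int1 k (fun y => a * F y) y = a * Int1 k F y.
Proof.
by move=> ks HF; apply: RintegralZl => //; exact: dominated_integrable HF.
Qed.

Lemma le_Int1 k s F G y : k \notin s -> dominated (k :: s) F ->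
  dominated (k :: s) G -> (forall y, F y <= G y) -> Int1 k F y <= Int1 k G y.
Proof.
by move=> ks HF HG FG; apply: le_Rintegral => //;
  [exact: dominated_integrable HF|exact: dominated_integrable HG].
Qed.

Lemma IntsD s s' F G y : uniq (s ++ s') -> dominated (s ++ s') F ->
  dominated (s ++ s') G ->
  Ints s (fun y => F y + G y) y = Ints s F y + Ints s G y.
Proof.
elim: s s' y => [//|k s IH] s' y /= us HF HG.
have us' := uniq_mid us; have HF' := dom_mid HF; have HG' := dom_mid HG.
rewrite -(@Int1D k s' (Ints s F) (Ints s G)).
- by congr (Int1 _ _ _); apply/funext => x; exact: (IH (k :: s')).
- by move: us; rewrite mem_cat negb_or => /andP[/andP[]].
- exact: dominated_Ints HF'.
- exact: dominated_Ints HG'.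
Qed.

Lemma IntsZ s s' F a y : uniq (s ++ s') -> dominated (s ++ s') F ->
  Ints s (fun y => a * F y) y = a * Ints s F y.
Proof.
elim: s s' y => [//|k s IH] s' y /= us HF.
have us' := uniq_mid us; have HF' := dom_mid HF.
rewrite -(@Int1Z k s' (Ints s F)).
- by congr (Int1 _ _ _); apply/funext => x; exact: (IH (k :: s')).
- by move: us; rewrite mem_cat negb_or => /andP[/andP[]].
- exact: dominated_Ints HF'.
Qed.

Lemma le_Ints s s' F G y : uniq (s ++ s') -> dominated (s ++ s') F ->
  dominated (s ++ s') G -> (forall y, F y <= G y) -> Ints s F y <= Ints s G y.
Proof.
elim: s s' y => [//|k s IH] s' y /= us HF HG FG.
have us' := uniq_mid us; have HF' := dom_mid HF; have HG' := dom_mid HG.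
apply: (@le_Int1 k s').
- by move: us; rewrite mem_cat negb_or => /andP[/andP[]].
- exact: dominated_Ints HF'.
- exact: dominated_Ints HG'.
- by move=> x; exact: (IH (k :: s')).
Qed.

Lemma Int1C i j s F y : uniq (i :: j :: s) -> dominated (i :: j :: s) F ->
  Int1 i (Int1 j F) y = Int1 j (Int1 i F) y.
Proof.
move=> us HF; have [mF [C C0 HC]] := HF.
have ij : i != j by move: us => /= /andP[]; rewrite inE negb_or => /andP[].
pose f (st : GR * GR) := (F (upd (upd y i st.1) j st.2))%:E.
have mf : measurable_fun setT f.
  apply/measurable_EFinP; apply: (mF _ _ (fun st : GR * GR => upd (upd y i st.1) j st.2)) => k.
  rewrite /upd; case: eqP => _; first exact: measurable_snd.
  by case: eqP => _; [exact: measurable_fst|exact: measurable_cst].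
have usj : uniq (j :: i :: s).
  by move: us => /=; rewrite !inE !negb_or [j == i]eq_sym => /andP[/andP[-> ->] /andP[-> ->]].
have HF' : dominated (j :: i :: s) F.
  apply: dominated_perm HF.
  by rewrite -(cat1s i) -(cat1s j s) perm_catCA.
have [is_ js] : i \notin j :: s /\ j \notin i :: s.
  by move: us usj => /= /andP[-> _] /andP[-> _].
have E1 z : ((Int1 j F) z)%:E = (\int[mu]_t (F (upd z j t))%:E)%E.
  by rewrite fineK//; apply: integrable_fin_num => //; exact: dominated_integrable HF'.
have E2 z : ((Int1 i F) z)%:E = (\int[mu]_t (F (upd z i t))%:E)%E.
  by rewrite fineK//; apply: integrable_fin_num => //; exact: dominated_integrable HF.
have -> : Int1 i (Int1 j F) y = fine (\int[mu]_x \int[mu]_z f (x, z))%E.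
  by congr fine; apply: eq_integral => t _; rewrite E1.
have -> : Int1 j (Int1 i F) y = fine (\int[mu]_z \int[mu]_x f (x, z))%E.
  congr fine; apply: eq_integral => t _; rewrite E2.
  by apply: eq_integral => x _; rewrite /f/= (updC _ _ _ ij).
congr fine; apply: (@Fubini _ _ _ _ _ mu mu f).
(* Fubini asks for a finite double integral of |f|; the product bound gives a constant times the
   square of the integral of b. *)
apply/integrable12ltyP => //.
pose c := C * \prod_(k <- s) b (y k).
have B0 : (0 <= \int[mu]_t b t) by exact: Rintegral_ge0.
have intb : (\int[mu]_t (b t)%:E = (\int[mu]_t b t)%:E)%E.
  by rewrite fineK//; exact: integrable_fin_num.
apply: (@le_lt_trans _ _ (\int[mu]_s (((c * \int[mu]_t b t) * b s)%:E)))%E.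
  apply: ge0_le_integral => //.
  - by move=> t _; exact: integral_ge0.
  - apply: (measurable_fun_fubini_tonelli_F (m2 := mu) (abse \o f)) => //.
    exact: measurableT_comp.
    by move=> x; exact: (@abse_ge0 R (f x)).
  - exact: (measurable_int _ (integrableZl measurableT (c * \int[mu]_t b t) ib)).
  move=> x _; rewrite mulrAC EFinM -intb.
  rewrite -ge0_integralZl//; last 3 first.
  - exact/measurable_EFinP.
  - by move=> t _; rewrite lee_fin.
  - by rewrite lee_fin !mulr_ge0// bprod_ge0.
  apply: ge0_le_integral => //.
  - by apply: measurableT_comp => //; exact: (measurableT_comp mf (measurable_pair1 x)).
  - by apply/measurable_EFinP; apply: measurable_funM => //; exact: measurable_cst.
  move=> t _; rewrite lee_fin (le_trans (HC _))// !big_cons.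
  rewrite upd_same upd_diff// upd_same.
  rewrite bprod_upd; last by case: js; rewrite inE negb_or => /andP[].
  rewrite bprod_upd; last by case: is_; rewrite inE negb_or => /andP[].
  by rewrite /c le_eqVlt; apply/orP; left; apply/eqP; ring.
have := integrableZl measurableT (c * \int[mu]_t b t) ib.
move=> /(integrable_fin_num measurableT) H.
by rewrite ltey_eq H.
Qed.

End IteratedIntegral.

(** * Invariance of iterated integrals under rotations *)

Section Invariance.
Variable R : realType.
Local Notation mu := (@lebesgue_measure R).
Local Notation GR := (measurableTypeR R).
Implicit Types (F G : (nat -> R) -> R) (y : nat -> R).

Lemma lebesgue_measureD (a : R) (A : set R) : measurable A ->
  pushforward mu (fun x : GR => x + a : GR) A = mu A.
Proof.
move=> mA; apply/esym.
have ma : measurable_fun setT (fun x : GR => x + a : GR).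
  by apply: (@measurable_funD _ _ R) => //; exact: measurable_cst.
apply: (lebesgue_measure_unique (mu := pushforward mu (fun x : GR => x + a : GR))) => //= _ [[u v]] _ <-.
rewrite /pushforward.
rewrite [X in _ = mu X](_ : _ = `]u - a, v - a]%classic); last first.
  by apply/seteqP; split => x /=; rewrite !in_itv/= ltrBlDr lerBrDr.
rewrite !lebesgue_measure_itv/= !lte_fin ltrD2r.
by case: ifP => // _; rewrite -!EFinB; congr EFin; ring.
Qed.

Lemma Rintegral_translation (a : R) (g : R -> R) :
  measurable_fun setT g ->
  \int[mu]_(t in setT) g (t + a) = \int[mu]_(t in setT) g t.
Proof.
move=> mg.
have ma : measurable_fun setT (fun x : GR => x + a : GR).
  by apply: (@measurable_funD _ _ R) => //; exact: measurable_cst.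
have mgE : measurable_fun setT (EFin \o g) by apply/measurable_EFinP.
have ge0 (h : GR -> \bar R) : measurable_fun setT h -> (forall x, (0 <= h x)%E) ->
    (\int[mu]_t h (t + a)%R = \int[mu]_t h t)%E.
  move=> mh h0.
  have := @ge0_integral_pushforward _ _ GR GR R _ ma mu setT h measurableT mh (fun x _ => h0 x).
  rewrite preimage_setT => <-.
  by apply: eq_measure_integral => A mA _; exact: lebesgue_measureD.
rewrite /Rintegral; congr fine; rewrite [LHS]integralE [RHS]integralE.
congr (_ - _)%E.
- rewrite -(ge0 (EFin \o g)^\+%E) //.
  + by apply: eq_integral => t _; rewrite !funeposE.
  + exact: measurable_funepos.
- rewrite -(ge0 (EFin \o g)^\-%E) //.
  + by apply: eq_integral => t _; rewrite !funenegE.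
  + exact: measurable_funeneg.
Qed.


Definition box (K t : R) : R := \1_(`[- K, K]%classic) t.

Lemma box_ge0 K t : 0 <= box K t.
Proof. by rewrite /box indicE. Qed.

Lemma integrable_box K : mu.-integrable setT (EFin \o box K).
Proof. exact: (integrable_indic_itv (- K) K true false). Qed.

Lemma boxE K t : `|t| <= K -> box K t = 1.
Proof.
by move=> tK; rewrite /box indicE mem_set//= in_itv/= -ler_norml.
Qed.

(** Bounded with support in a cube. Domination by [box K] is not kept by shears, but this property
    is, at the price of a larger K. *)
Definition box_supported (K : R) (s : seq nat) F : Prop :=
  [/\ cyl_measurable F, exists C, forall y, `|F y| <= C &
      forall y k, k \in s -> F y != 0 -> `|y k| <= K].

Lemma box_supported_dominated K s F : box_supported K s F ->
  dominated (box K) s F.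
Proof.
move=> [mF [C HC] HK]; split => //; exists C.
  exact: le_trans (HC (fun=> 0)).
move=> y; have [->|Fy0] := eqVneq (F y) 0.
  rewrite normr0 mulr_ge0// ?(le_trans _ (HC (fun=> 0)))//.
  by apply: bprod_ge0; exact: box_ge0.
rewrite big_seq big1 ?mulr1// => k ks.
by rewrite boxE// HK.
Qed.

Lemma box_supported_le K K' s F : K <= K' -> box_supported K s F ->
  box_supported K' s F.
Proof.
move=> KK' [mF bF HK]; split => // y k ks Fy.
exact: le_trans (HK _ _ ks Fy) KK'.
Qed.

Definition shear (i j : nat) (a : R) (y : nat -> R) : nat -> R :=
  upd y i (y i + a * y j).

Lemma cyl_measurable_shear i j a F :
  cyl_measurable F -> cyl_measurable (F \o shear i j a).
Proof.
move=> mF d S p mp; apply: (mF _ _ (fun s => shear i j a (p s))) => k.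
rewrite /shear /upd; case: eqP => _ //.
by apply: measurable_funD => //; apply: measurable_funM => //; exact: measurable_cst.
Qed.

(** The new radius comes from |y_i| <= |y_i + a y_j| + |a| |y_j|. *)
Lemma box_supported_shear K i j a s F : 0 <= K -> i != j -> j \in s ->
  box_supported K s F -> box_supported (K * (1 + `|a|)) s (F \o shear i j a).
Proof.
move=> K0 ij js [mF [C HC] HK]; split.
- exact: cyl_measurable_shear.
- by exists C => y; exact: HC.
have KK : K <= K * (1 + `|a|) by rewrite ler_peMr// lerDl.
move=> y k ks /= Fy; have := HK _ _ ks Fy; have := HK _ _ js Fy.
rewrite /shear [upd _ _ _ j]upd_diff 1?eq_sym// => yj.
have [->|ki] := eqVneq k i; last by rewrite upd_diff// => /le_trans; exact.
rewrite upd_same => yi.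
rewrite (_ : y i = (y i + a * y j) - a * y j); last by rewrite addrK.
rewrite (le_trans (ler_normB _ _))// mulrDr mulr1 lerD// normrM mulrC.
by rewrite ler_pM.
Qed.

Variable b : R -> R.
Hypothesis b0 : forall t, 0 <= b t.
Hypothesis ib : mu.-integrable setT (EFin \o b).

Lemma Ints_innermost k s s' F y : uniq (k :: s ++ s') ->
  dominated b (k :: s ++ s') F ->
  Ints (k :: s) F y = Ints s (Int1 k F) y.
Proof.
elim: s s' y => [//|j s IH] s' y us HF /=.
have us' : uniq (k :: s ++ j :: s').
  have : uniq (k :: s ++ j :: s') = uniq (k :: (j :: s) ++ s').
    apply: perm_uniq; rewrite perm_cons -(cat1s j s') -(cat1s j s) -catA.
    by rewrite perm_catCA.
  by rewrite us.
have HF' : dominated b (k :: s ++ j :: s') F.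
  apply: dominated_perm HF.
  by rewrite perm_cons -(cat1s j s') -(cat1s j s) -catA perm_catCA.
have D1 : dominated b [:: k, j & s'] (Ints s F).
  apply: (dominated_Ints b0 ib (s := s)).
    by rewrite -(cat1s k) uniq_catCA.
  by apply: dominated_perm HF'; rewrite -(cat1s k (_ :: s')) -cat1s perm_catCA.
rewrite (Int1C b0 ib _ _ D1); last first.
  by move: us' => /=; rewrite mem_cat negb_or cat_uniq /= => /and3P[/andP[_ ->] _ /and3P[_ -> ->]].
congr (Int1 _ _ _); apply/funext => x.
exact: (IH (j :: s')).
Qed.

(** Fubini brings variable i to the innermost place; there y_j is frozen and the shear is a
    translation of y_i. *)
Lemma Ints_shear i j a s s1 s2 F y : s = s1 ++ i :: s2 -> uniq s -> i != j ->
  dominated b s F -> dominated b s (F \o shear i j a) ->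
  Ints s (F \o shear i j a) y = Ints s F y.
Proof.
move=> -> us ij HF HG.
have us' : uniq (i :: s2 ++ s1).
  by rewrite -cat_cons uniq_catC.
have inner G : dominated b (s1 ++ i :: s2) G ->
    Ints (s1 ++ i :: s2) G y = Ints s1 (Ints s2 (Int1 i G)) y.
  move=> HG'; rewrite /Ints foldr_cat -/(Ints (i :: s2) G) -/(Ints s2 _).
  congr (Ints s1 _ _); apply/funext => x.
  apply: (Ints_innermost _ us'); apply: dominated_perm HG'.
  by rewrite -cat_cons perm_catC.
rewrite !inner//; congr (Ints s1 (Ints s2 _) _); apply/funext => x.
rewrite /Int1.
under eq_Rintegral => t _.
  rewrite /= /shear upd_same upd_diff 1?eq_sym//.
  rewrite [upd (upd _ _ _) _ _](_ : _ = upd x i (t + a * x j)); last first.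
    by apply/funext => k; rewrite /upd; case: eqP.
  over.
apply: (Rintegral_translation (a * x j) (g := fun t => F (upd x i t))).
by case: HF => mF _; exact: cyl_measurable_section.
Qed.

End Invariance.

(** * Rotations of a coordinate plane as products of shears *)

Section Rotation.
Variable R : realType.
Implicit Types (F G : (nat -> R) -> R) (y : nat -> R).

Lemma Ints_shear_supported K i j a s F y : 0 <= K -> uniq s -> i \in s ->
  j \in s -> i != j -> box_supported K s F ->
  Ints s (F \o shear i j a) y = Ints s F y.
Proof.
move=> K0 us is_ js ij HF.
have HG := box_supported_shear a K0 ij js HF.
have KK : K <= K * (1 + `|a|) by rewrite ler_peMr// lerDl.
have [s1 [s2 Es]] : exists s1 s2, s = s1 ++ i :: s2.
  by move: is_; clear; case/splitPr => s1 s2; exists s1, s2.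
apply: (Ints_shear (box_ge0 (K * (1 + `|a|))) (integrable_box _) _ Es) => //.
- exact/box_supported_dominated/(box_supported_le KK).
- exact: box_supported_dominated.
Qed.

(** Cosine and sine of 2 atan u in rational form, so that identities are settled by [field] and
    expansions at u = 0 are elementary. *)
Definition cosq (u : R) : R := (1 - u ^+ 2) / (1 + u ^+ 2).
Definition sinq (u : R) : R := 2 * u / (1 + u ^+ 2).

(* Rotation of angle 2 atan u in the (i, j) plane. *)
Definition rotq (i j : nat) (u : R) (y : nat -> R) : nat -> R :=
  fun k => if k == i then cosq u * y i - sinq u * y j
           else if k == j then sinq u * y i + cosq u * y j else y k.

(** A rotation by theta is the product of shears with parameters -tan(theta/2), sin(theta) and
    -tan(theta/2); here tan(theta/2) = u. *)
Lemma rotq_shear i j u y : i != j ->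
  rotq i j u y = shear i j (- u) (shear j i (sinq u) (shear i j (- u) y)).
Proof.
move=> ij; have u1 : 1 + u ^+ 2 != 0.
  by rewrite gt_eqF// ltr_wpDr// sqr_ge0.
have [ijF jiF] : (i == j) = false /\ (j == i) = false.
  by rewrite [j == i]eq_sym (negbTE ij).
apply/funext => k; rewrite /rotq /shear /upd /cosq /sinq /= !eqxx /= ?ijF ?jiF.
case: eqP => [_|_]; first by field.
by case: eqP => // _; field.
Qed.

Lemma Ints_rotq K i j u s F y : 0 <= K -> uniq s -> i \in s ->
  j \in s -> i != j -> box_supported K s F ->
  Ints s (F \o rotq i j u) y = Ints s F y.
Proof.
move=> K0 us is_ js ij HF.
have ji : j != i by rewrite eq_sym.
have H1 := box_supported_shear (- u) K0 ij js HF.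
have K1 : 0 <= K * (1 + `|- u|) by rewrite mulr_ge0// addr_ge0.
have H2 := box_supported_shear (sinq u) K1 ji is_ H1.
have K2 : 0 <= K * (1 + `|- u|) * (1 + `|sinq u|) by rewrite mulr_ge0// addr_ge0.
rewrite (_ : F \o rotq i j u = ((F \o shear i j (- u)) \o shear j i (sinq u)) \o shear i j (- u)).
  rewrite (Ints_shear_supported _ _ K2)// (Ints_shear_supported _ _ K1)//.
  by rewrite (Ints_shear_supported _ _ K0).
by apply/funext => x; rewrite /= rotq_shear.
Qed.

End Rotation.

(** * Integration over the sphere *)

Section Sphere.
Variables (R : realType) (d : nat).
Local Notation mu := (@lebesgue_measure R).
Implicit Types (f g : 'rV[R]_d -> R) (v : 'rV[R]_d).

Definition row_measurable f : Prop := cyl_measurable (f \o row_of d).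

Lemma row_measurable_fun f d' (S : measurableType d') (p : S -> 'rV[R]_d) :
  row_measurable f ->
  (forall k, measurable_fun setT (fun s => p s ord0 k)) ->
  measurable_fun setT (fun s => f (p s)).
Proof.
move=> mf mp.
pose q s (k : nat) := if insub k is Some i then p s ord0 i else 0.
have -> : (fun s => f (p s)) = (fun s => (f \o row_of d) (q s)).
  apply/funext => s /=; congr f; apply/rowP => i; rewrite mxE /q.
  by rewrite valK.
apply: (mf _ _ q) => k; rewrite /q.
case: insubP => [i _ _|_]; [exact: mp|exact: measurable_cst].
Qed.

Lemma row_measurable_cst c : row_measurable (fun=> c).
Proof. by move=> d' S p mp; exact: measurable_cst. Qed.

Lemma row_measurable_coord k : row_measurable (fun v => v ord0 k).
Proof.
move=> d' S p mp; rewrite [X in measurable_fun _ X](_ : _ = (fun s => p s k)) //.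
by apply/funext => s /=; rewrite mxE.
Qed.

Lemma row_measurableD f g : row_measurable f -> row_measurable g ->
  row_measurable (fun v => f v + g v).
Proof. by move=> mf mg d' S p mp; apply: measurable_funD; [exact: mf|exact: mg]. Qed.

Lemma row_measurableM f g : row_measurable f -> row_measurable g ->
  row_measurable (fun v => f v * g v).
Proof. by move=> mf mg d' S p mp; apply: measurable_funM; [exact: mf|exact: mg]. Qed.

Lemma row_measurable_sum (I : Type) (s : seq I) (F : I -> 'rV[R]_d -> R) :
  (forall i, row_measurable (F i)) ->
  row_measurable (fun v => \sum_(i <- s) F i v).
Proof.
move=> mF d' S p mp.
by apply: (@measurable_sum _ _ _ _ _ s (fun i x => F i (row_of d (p x)))) => i; exact: mF.
Qed.

Lemma row_measurable_comp (h : R -> R) f : measurable_fun setT h ->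
  row_measurable f -> row_measurable (fun v => h (f v)).
Proof.
move=> mh mf d' S p mp.
exact: (measurableT_comp mh (mf _ _ p mp)).
Qed.

Lemma row_measurable_if_le f g (h k : 'rV[R]_d -> R) :
  row_measurable f -> row_measurable g -> row_measurable h -> row_measurable k ->
  row_measurable (fun v => if f v <= g v then h v else k v).
Proof.
move=> mf mg mh mk d' S p mp; apply: measurable_fun_ifT.
- by apply: measurable_fun_ler; [exact: mf|exact: mg].
- exact: mh.
- exact: mk.
Qed.

Lemma row_measurable_lin f (G : 'rV[R]_d -> 'rV[R]_d) : row_measurable f ->
  (forall k, row_measurable (fun v => G v ord0 k)) ->
  row_measurable (fun v => f (G v)).
Proof.
move=> mf mG d' S p mp.
by apply: (@row_measurable_fun f _ _ (fun s => G (row_of d (p s)))) => // k; exact: mG.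
Qed.

Lemma enorm_ge0 v : 0 <= enorm v.
Proof. exact: sqrtr_ge0. Qed.

Lemma enorm_sqr v : enorm v ^+ 2 = \sum_(i < d) v ord0 i ^+ 2.
Proof. by rewrite sqr_sqrtr// sumr_ge0// => i _; exact: sqr_ge0. Qed.

Lemma row_measurable_enorm : row_measurable (@enorm R d).
Proof.
apply: (@row_measurable_comp (@Num.sqrt R)).
  by apply: continuous_measurable_fun; exact: sqrt_continuous.
apply: row_measurable_sum => i.
by apply: row_measurableM; exact: row_measurable_coord.
Qed.

Lemma le_coord_enorm v k : `|v ord0 k| <= enorm v.
Proof.
rewrite -sqrtr_sqr ler_sqrt ?sumr_ge0// => [|i _]; last exact: sqr_ge0.
by rewrite (bigD1 k)//= lerDl sumr_ge0// => i _; exact: sqr_ge0.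
Qed.

Lemma enorm0 v : (enorm v == 0) = (v == 0).
Proof.
apply/eqP/eqP => [v0|->]; last first.
  by rewrite /enorm big1 ?sqrtr0// => i _; rewrite mxE expr0n.
apply/rowP => k; rewrite mxE; apply/eqP; rewrite -normr_eq0 eq_le normr_ge0.
by rewrite andbT -v0 le_coord_enorm.
Qed.

Lemma enormZ a v : enorm (a *: v) = `|a| * enorm v.
Proof.
rewrite /enorm -sqrtr_sqr -sqrtrM ?sqr_ge0// mulr_sumr.
by congr Num.sqrt; apply: eq_bigr => i _; rewrite mxE exprMn.
Qed.

Lemma enorm_unit v : v != 0 -> enorm ((enorm v)^-1 *: v) = 1.
Proof.
by move=> v0; rewrite enormZ normfV (ger0_norm (enorm_ge0 v)) mulVf// enorm0.
Qed.

(** The bound is asked on the closed ball, which contains the origin: there x / |x| evaluates to 0,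
    and [cone] reads the value f 0. *)
Definition sphere_fun f : Prop :=
  row_measurable f /\ exists C, forall v, enorm v <= 1 -> `|f v| <= C.

Definition cone f (x : nat -> R) : R :=
  let v := row_of d x in if enorm v <= 1 then f ((enorm v)^-1 *: v) else 0.

Definition coords := rev (iota 0 d).

Lemma uniq_coords : uniq coords.
Proof. by rewrite rev_uniq iota_uniq. Qed.

Lemma mem_coords k : (k \in coords) = (k < d)%N.
Proof. by rewrite mem_rev mem_iota. Qed.

Lemma sphere_intE f : sphere_int f = d%:R * Ints coords (cone f) (fun=> 0).
Proof. by rewrite /sphere_int /leb_int iintE. Qed.

Lemma enorm_scale_le1 v : enorm ((enorm v)^-1 *: v) <= 1.
Proof.
have [->|v0] := eqVneq v 0; last by rewrite enorm_unit.
by rewrite scaler0 (eqP (_ : enorm 0 == 0)) ?enorm0.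
Qed.

Lemma cone_supported f : sphere_fun f -> box_supported 1 coords (cone f).
Proof.
move=> [mf [C HC]]; split.
- apply: (@row_measurable_if_le (@enorm R d) (fun=> 1)
    (fun v => f ((enorm v)^-1 *: v)) (fun=> 0)).
  + exact: row_measurable_enorm.
  + exact: row_measurable_cst.
  + apply: row_measurable_lin => // k.
    rewrite (_ : (fun v => _) = (fun v => enorm v `^ (-1) * v ord0 k)); last first.
      by apply/funext => v; rewrite mxE powR_inv1// enorm_ge0.
    apply: row_measurableM; last exact: row_measurable_coord.
    apply: (@row_measurable_comp (fun x => x `^ (-1))).
      exact: measurable_powR.
    exact: row_measurable_enorm.
  + exact: row_measurable_cst.
- exists (Num.max C 0) => x; rewrite /cone; case: ifP => _; last first.
    by rewrite normr0 le_max lexx orbT.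
  by rewrite le_max HC// enorm_scale_le1.
- move=> x k; rewrite mem_coords => kd; rewrite /cone.
  case: ifP => [v1 _|_]; last by rewrite eqxx.
  apply: le_trans v1; apply: le_trans (le_coord_enorm _ (Ordinal kd)).
  by rewrite mxE.
Qed.

Lemma cone_dominated f : sphere_fun f -> dominated (box 1) coords (cone f).
Proof. by move=> /cone_supported/box_supported_dominated. Qed.

Lemma sphere_funD f g : sphere_fun f -> sphere_fun g ->
  sphere_fun (fun v => f v + g v).
Proof.
move=> [mf [C HC]] [mg [D HD]]; split; first exact: row_measurableD.
exists (C + D) => v v1; apply: le_trans (ler_normD _ _) _.
by rewrite lerD// ?HC ?HD.
Qed.

Lemma sphere_funM f g : sphere_fun f -> sphere_fun g ->
  sphere_fun (fun v => f v * g v).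
Proof.
move=> [mf [C HC]] [mg [D HD]]; split; first exact: row_measurableM.
by exists (C * D) => v v1; rewrite normrM ler_pM// ?HC ?HD.
Qed.

Lemma sphere_fun_cst c : sphere_fun (fun=> c).
Proof. by split; [exact: row_measurable_cst|exists `|c|]. Qed.

Lemma sphere_fun_coord k : sphere_fun (fun v => v ord0 k).
Proof.
split; [exact: row_measurable_coord|exists 1 => v v1].
by rewrite (le_trans (le_coord_enorm _ _)).
Qed.

Lemma sphere_fun_sum (I : Type) (s : seq I) (F : I -> 'rV[R]_d -> R) :
  (forall i, sphere_fun (F i)) -> sphere_fun (fun v => \sum_(i <- s) F i v).
Proof.
move=> mF; elim: s => [|i s IH].
  by under eq_fun do rewrite big_nil; exact: sphere_fun_cst.
by under eq_fun do rewrite big_cons; exact: sphere_funD.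
Qed.

Lemma sphere_intD f g : sphere_fun f -> sphere_fun g ->
  sphere_int (fun v => f v + g v) = sphere_int f + sphere_int g.
Proof.
move=> Hf Hg; rewrite !sphere_intE -mulrDr; congr (_ * _).
rewrite -(IntsD (@box_ge0 _ 1) (integrable_box 1) (s' := [::])) ?cats0//.
- by congr (Ints _ _ _); apply/funext => x; rewrite /cone; case: ifP; rewrite ?addr0.
- exact: uniq_coords.
- exact: cone_dominated.
- exact: cone_dominated.
Qed.

Lemma sphere_intZ a f : sphere_fun f ->
  sphere_int (fun v => a * f v) = a * sphere_int f.
Proof.
move=> Hf; rewrite !sphere_intE mulrCA; congr (_ * _).
rewrite -(IntsZ (@box_ge0 _ 1) (integrable_box 1) (s' := [::])) ?cats0//.
- by congr (Ints _ _ _); apply/funext => x; rewrite /cone; case: ifP; rewrite ?mulr0.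
- exact: uniq_coords.
- exact: cone_dominated.
Qed.

Lemma sphere_int_sum (I : Type) (s : seq I) (F : I -> 'rV[R]_d -> R) :
  (forall i, sphere_fun (F i)) ->
  sphere_int (fun v => \sum_(i <- s) F i v) = \sum_(i <- s) sphere_int (F i).
Proof.
move=> mF; elim: s => [|i s IH].
  transitivity (sphere_int (fun _ : 'rV[R]_d => 0 * 0 : R)); last first.
    by rewrite (sphere_intZ 0 (sphere_fun_cst 0)) mul0r big_nil.
  by congr sphere_int; apply/funext => v; rewrite big_nil mul0r.
rewrite big_cons -IH -sphere_intD//; last exact: sphere_fun_sum.
by congr sphere_int; apply/funext => v; rewrite big_cons.
Qed.

Hypothesis d_gt0 : (0 < d)%N.

Lemma Int1_off_origin k F G y : cyl_measurable F -> cyl_measurable G ->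
  (forall y, y k != 0 -> F y = G y) -> Int1 k F y = @Int1 R k G y.
Proof.
move=> mF mG FG; rewrite /Int1 /Rintegral; congr fine.
apply: ae_eq_integral => //.
- by apply/measurable_EFinP; exact: cyl_measurable_section.
- by apply/measurable_EFinP; exact: cyl_measurable_section.
- exists [set 0]; split; [exact: measurable_set1|exact: lebesgue_measure_set1|].
  move=> t /= /not_implyP[_ Ht]; apply: contrapT => /eqP t0; apply: Ht.
  by rewrite FG// upd_same.
Qed.

(* The cone over a function on the sphere also sees its value at the origin,
   a null set for the iterated integral. *)
Lemma sphere_int_ext f g : sphere_fun g ->
  (forall v, enorm v = 1 -> f v = g v) -> sphere_int f = sphere_int g.
Proof.
move=> Hg fg.
have half : (1 <= 2^-1 :> R) = false by apply/negbTE; rewrite -ltNge; lra.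
have e0 : enorm (0 : 'rV[R]_d) = 0 by apply/eqP; rewrite enorm0.
(* [z (f 0)] is as regular as g, agrees with g on the sphere, and takes the value f 0 at the origin;
   hence it has the same cone as f, about which only its values on the sphere are known. *)
pose z (c : R) v := if enorm v <= 2^-1 then c else g v.
have Hz : sphere_fun (z (f 0)).
  move: Hg => [mg [C HC]]; split.
    exact: (row_measurable_if_le row_measurable_enorm (row_measurable_cst 2^-1)
      (row_measurable_cst _) mg).
  exists (Num.max C `|f 0|) => v v1; rewrite /z; case: ifP => _.
    by rewrite le_max lexx orbT.
  by rewrite le_max HC.
rewrite !sphere_intE; congr (_ * _).
have -> : cone f = cone (z (f 0)).
  apply/funext => x; rewrite /cone; case: ifP => // _.
  have [->|v0] := eqVneq (row_of d x) 0.
    by rewrite scaler0 /z e0 invr_ge0 ler0n.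
  by rewrite /z enorm_unit// half fg// enorm_unit.
(* Coordinate 0 is the innermost variable. Where it is nonzero the vector is nonzero and both cones
   agree; the exception is a single point of the line. *)
have -> : coords = rev (iota 1 d.-1) ++ [:: 0%N].
  by rewrite /coords -{1}(prednK d_gt0) -add1n iotaD rev_cat.
rewrite /Ints !foldr_cat /=; congr (foldr _ _ _ _); apply/funext => y.
have [mf _ _] := cone_supported Hz; have [mg _ _] := cone_supported Hg.
apply: Int1_off_origin => // x x0; rewrite /cone; case: ifP => // _.
rewrite /z enorm_unit ?half//.
apply: contraNneq x0 => /rowP /(_ (Ordinal d_gt0)).
by rewrite !mxE => ->.
Qed.

Lemma sphere_int_le f g : sphere_fun f -> sphere_fun g ->
  (forall v, enorm v = 1 -> f v <= g v) -> sphere_int f <= sphere_int g.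
Proof.
move=> Hf Hg fg.
(* Zeroing both functions on the half ball does not change the integrals and makes the inequality
   hold at the origin as well. *)
pose z (h : 'rV[R]_d -> R) v := if enorm v <= 2^-1 then 0 else h v.
have Hz h : sphere_fun h -> sphere_fun (z h).
  move=> [mh [C HC]]; split.
    exact: (row_measurable_if_le row_measurable_enorm (row_measurable_cst 2^-1)
      (row_measurable_cst 0) mh).
  exists (Num.max C 0) => v v1; rewrite /z; case: ifP => _.
    by rewrite normr0 le_max lexx orbT.
  by rewrite le_max HC.
have half : (1 <= 2^-1 :> R) = false by apply/negbTE; rewrite -ltNge; lra.
have zE h : sphere_fun h -> sphere_int h = sphere_int (z h).
  move=> Hh; apply: sphere_int_ext => [|v v1]; first exact: Hz.
  by rewrite /z v1 half.
rewrite (zE _ Hf) (zE _ Hg) !sphere_intE ler_wpM2l//.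
apply: (le_Ints (@box_ge0 _ 1) (integrable_box 1) (s' := [::])); rewrite ?cats0.
- exact: uniq_coords.
- exact/cone_dominated/Hz.
- exact/cone_dominated/Hz.
move=> y; rewrite /cone; case: ifP => // _.
have [->|v0] := eqVneq (row_of d y) 0.
  have e0 : enorm (0 : 'rV[R]_d) = 0 by apply/eqP; rewrite enorm0.
  by rewrite scaler0 /z e0 invr_ge0 ler0n.
by rewrite /z enorm_unit// half fg// enorm_unit.
Qed.

Lemma sphere_int_norm_le f C : sphere_fun f ->
  (forall v, enorm v = 1 -> `|f v| <= C) ->
  `|sphere_int f| <= C * @sphere_int R d (fun=> 1).
Proof.
move=> Hf HC.
have H1 := sphere_fun_cst 1.
rewrite ler_norml -mulNr -!sphere_intZ//; apply/andP; split; apply: sphere_int_le => //.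
- exact: sphere_fun_cst.
- by move=> v /HC; rewrite mulr1 ler_norml => /andP[].
- exact: sphere_fun_cst.
- by move=> v /HC; rewrite mulr1 ler_norml => /andP[].
Qed.

End Sphere.

(** * Rotation invariance on the sphere and infinitesimal rotations *)

Section SphereRotation.
Variables (R : realType) (d : nat).
Hypothesis d_gt0 : (0 < d)%N.
Implicit Types (f g : 'rV[R]_d -> R) (v y : 'rV[R]_d) (i j k : 'I_d).

Definition rotr i j (u : R) v : 'rV[R]_d :=
  \row_k (if k == i then cosq u * v ord0 i - sinq u * v ord0 j
          else if k == j then sinq u * v ord0 i + cosq u * v ord0 j
          else v ord0 k).

Lemma row_of_rotq i j u (x : nat -> R) :
  row_of d (rotq i j u x) = rotr i j u (row_of d x).
Proof. by apply/rowP => k; rewrite !mxE /rotq !val_eqE. Qed.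

Lemma oneDsqr_neq0 (u : R) : 1 + u ^+ 2 != 0.
Proof. by rewrite gt_eqF// ltr_wpDr// sqr_ge0. Qed.

Lemma enorm_rotr i j u v : i != j -> enorm (rotr i j u v) = enorm v.
Proof.
move=> ij; rewrite /enorm; congr Num.sqrt.
have ji : j != i by rewrite eq_sym.
rewrite (bigD1 i)//= (bigD1 j)//= [in RHS](bigD1 i)//= [in RHS](bigD1 j)//=.
rewrite !addrA; congr (_ + _); last first.
  by apply: eq_bigr => k /andP[ki kj]; rewrite mxE (negbTE ki) (negbTE kj).
rewrite !mxE !eqxx (negbTE ji) /cosq /sinq.
by have := oneDsqr_neq0 u => u1; field.
Qed.

Lemma rotrZ i j u a v : rotr i j u (a *: v) = a *: rotr i j u v.
Proof.
apply/rowP => k; rewrite !mxE; case: eqP => _; first by ring.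
by case: eqP => _ //; ring.
Qed.

Lemma sphere_fun_rotr i j u f : i != j -> sphere_fun f ->
  sphere_fun (fun v => f (rotr i j u v)).
Proof.
move=> ij [mf [C HC]]; split; last first.
  by exists C => v v1; apply: HC; rewrite enorm_rotr.
apply: row_measurable_lin => // k.
have mc l := @row_measurable_coord R d l.
have mcst c := @row_measurable_cst R d c.
under eq_fun do rewrite mxE.
case: eqP => _; [|case: eqP => _ //].
- under eq_fun do rewrite -mulNr.
  by apply: row_measurableD; apply: row_measurableM.
- by apply: row_measurableD; apply: row_measurableM.
- exact: mc.
Qed.

Lemma sphere_int_rotr i j u f : i != j -> sphere_fun f ->
  sphere_int (fun v => f (rotr i j u v)) = sphere_int f.
Proof.
move=> ij Hf; rewrite !sphere_intE; congr (_ * _).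
have mem k : (k : nat) \in coords d by rewrite mem_coords.
rewrite -(@Ints_rotq R 1 i j u (coords d) (cone f) (fun=> 0) ler01 (uniq_coords d)
  (mem i) (mem j) ij (cone_supported Hf)).
congr (Ints _ _ _); apply/funext => x; rewrite /cone /=.
by rewrite row_of_rotq enorm_rotr// rotrZ.
Qed.

(* [g] is the image of [f] under the infinitesimal rotation v_i d_j - v_j d_i,
   with a remainder that is quadratic in the rotation parameter, uniformly on
   the sphere. *)
Definition rot_deriv i j f g : Prop :=
  [/\ sphere_fun f, sphere_fun g &
   exists2 C, 0 <= C & forall u v, `|u| <= 1 -> enorm v = 1 ->
     `|f (rotr i j u v) - f v - 2 * u * g v| <= C * u ^+ 2].

(** By invariance the integrals of f after and before rotation cancel, so 2u times the integral of g
    is O(u^2); dividing by u and letting u tend to 0 leaves zero. *)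
Lemma sphere_int_rot_deriv i j f g : i != j -> rot_deriv i j f g ->
  sphere_int g = 0.
Proof.
move=> ij [Hf Hg [C C0 HC]].
pose A := @sphere_int R d (fun=> 1).
have key u : 0 < u -> u <= 1 -> `|sphere_int g| <= C * A * u.
  move=> u0 u1.
  have Hr := sphere_fun_rotr u ij Hf.
  have Hz : sphere_fun (fun v => f (rotr i j u v) + (- 1) * f v + (- (2 * u)) * g v).
    by apply: sphere_funD; [apply: sphere_funD => //|];
      apply: sphere_funM => //; exact: sphere_fun_cst.
  have := @sphere_int_norm_le R d d_gt0 _ (C * u ^+ 2) Hz.
  rewrite sphere_intD; last 2 first.
  - by apply: sphere_funD => //; apply: sphere_funM => //; exact: sphere_fun_cst.
  - by apply: sphere_funM => //; exact: sphere_fun_cst.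
  rewrite sphere_intD//; last by apply: sphere_funM => //; exact: sphere_fun_cst.
  rewrite !sphere_intZ// sphere_int_rotr// mulN1r subrr add0r -/A.
  rewrite mulNr normrN normrM (ger0_norm (_ : 0 <= 2 * u)); last by rewrite mulr_ge0// ltW.
  move=> H; have {}H : 2 * u * `|sphere_int g| <= C * u ^+ 2 * A.
    apply: H => v v1; rewrite mulN1r mulNr; apply: HC => //.
    by rewrite gtr0_norm.
  have -> : `|sphere_int g| = (u * `|sphere_int g|) / u by rewrite mulrC mulKf ?gt_eqF.
  rewrite ler_pdivrMr//; have g0 : 0 <= u * `|sphere_int g| by rewrite mulr_ge0// ltW.
  nra.
apply/eqP; rewrite -normr_le0; apply/ler_addgt0Pr => e e0; rewrite add0r.
have A0 : 0 <= C * A.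
  by have := key 1 ltr01 (lexx 1); rewrite mulr1; exact: le_trans.
pose u := Num.min 1 (e / (C * A + 1)).
have CA1 : 0 < C * A + 1 by rewrite ltr_wpDl.
apply: le_trans (key u _ _) _.
- by rewrite lt_min ltr01 divr_gt0.
- by rewrite ge_min lexx.
apply: (@le_trans _ _ (C * A * (e / (C * A + 1)))).
  by rewrite ler_wpM2l// ge_min lexx orbT.
by rewrite mulrA ler_pdivrMr// mulrDr mulr1 mulrC lerDl ltW.
Qed.

Lemma rot_derivD i j f1 g1 f2 g2 : rot_deriv i j f1 g1 -> rot_deriv i j f2 g2 ->
  rot_deriv i j (fun v => f1 v + f2 v) (fun v => g1 v + g2 v).
Proof.
move=> [Hf1 Hg1 [C1 C10 H1]] [Hf2 Hg2 [C2 C20 H2]]; split.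
- exact: sphere_funD.
- exact: sphere_funD.
exists (C1 + C2); first exact: addr_ge0.
move=> u v u1 v1; rewrite (_ : _ - _ - _ =
  (f1 (rotr i j u v) - f1 v - 2 * u * g1 v) + (f2 (rotr i j u v) - f2 v - 2 * u * g2 v)).
  apply: le_trans (ler_normD _ _) _; rewrite [leRHS]mulrDl.
  by apply: lerD; [exact: H1|exact: H2].
by ring.
Qed.

Lemma rot_deriv_cst i j c : rot_deriv i j (fun=> c) (fun=> 0).
Proof.
split; [exact: sphere_fun_cst|exact: sphere_fun_cst|exists 0 => //].
by move=> u v _ _; rewrite subrr mulr0 subr0 normr0 mul0r.
Qed.

Lemma rot_derivM i j f1 g1 f2 g2 : i != j ->
  rot_deriv i j f1 g1 -> rot_deriv i j f2 g2 ->
  rot_deriv i j (fun v => f1 v * f2 v) (fun v => g1 v * f2 v + f1 v * g2 v).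
Proof.
move=> ij [Hf1 Hg1 [C1 C10 H1]] [Hf2 Hg2 [C2 C20 H2]]; split.
- exact: sphere_funM.
- by apply: sphere_funD; exact: sphere_funM.
have [_ [F1 HF1]] := Hf1; have [_ [F2 HF2]] := Hf2.
have [_ [G1 HG1]] := Hg1; have [_ [G2 HG2]] := Hg2.
have F10 : 0 <= Num.max F1 0 by rewrite le_max lexx orbT.
have F20 : 0 <= Num.max F2 0 by rewrite le_max lexx orbT.
have G10 : 0 <= Num.max G1 0 by rewrite le_max lexx orbT.
have G20 : 0 <= Num.max G2 0 by rewrite le_max lexx orbT.
exists (4 * Num.max G1 0 * Num.max G2 0 + 2 * Num.max G1 0 * C2 + C1 * Num.max F2 0 + Num.max F1 0 * C2).
  by rewrite !addr_ge0// !mulr_ge0.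
move=> u v u1 v1.
have w1 : enorm (rotr i j u v) = 1 by rewrite enorm_rotr.
have B1 : `|f1 v| <= Num.max F1 0 by rewrite le_max HF1// v1.
have B2 : `|f2 (rotr i j u v)| <= Num.max F2 0 by rewrite le_max HF2// w1.
have D1 : `|g1 v| <= Num.max G1 0 by rewrite le_max HG1// v1.
have D2 : `|g2 v| <= Num.max G2 0 by rewrite le_max HG2// v1.
have P1 := H1 _ _ u1 v1; have P2 := H2 _ _ u1 v1.
set p := f1 (rotr i j u v) - _ - _ in P1; set q := f2 (rotr i j u v) - _ - _ in P2.
rewrite (_ : _ - _ - _ = 4 * g1 v * g2 v * u ^+ 2 + 2 * g1 v * (u * q) + p * f2 (rotr i j u v) + f1 v * q); last first.
  by rewrite /p /q; ring.
rewrite [leRHS](_ : _ = 4 * Num.max G1 0 * Num.max G2 0 * u ^+ 2 +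
  2 * Num.max G1 0 * (C2 * u ^+ 2) + C1 * u ^+ 2 * Num.max F2 0 +
  Num.max F1 0 * (C2 * u ^+ 2)); last by ring.
rewrite (le_trans (ler_normD _ _))// lerD//; last first.
  by rewrite normrM ler_pM.
rewrite (le_trans (ler_normD _ _))// lerD//; last first.
  by rewrite normrM ler_pM.
rewrite (le_trans (ler_normD _ _))// lerD//.
  rewrite normrM (ger0_norm (sqr_ge0 u)) ler_wpM2r ?sqr_ge0//.
  by rewrite !normrM (ger0_norm (_ : 0 <= 4))// !ler_pM ?mulr_ge0.
rewrite !normrM (ger0_norm (_ : 0 <= 2))// ler_pM ?mulr_ge0//.
  by rewrite ler_wpM2l.
by rewrite (le_trans _ P2)// ler_piMl.
Qed.

(** The angle 2 atan u is 2u to first order, whence the factor 2u in [rot_deriv]. Both [cosq u - 1]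
    and [sinq u - 2 * u] are at most 2 u^2 in size, and two such errors make 4. *)
Lemma rot_deriv_coord i j k : i != j ->
  rot_deriv i j (fun v => v ord0 k)
    (fun v => (k == j)%:R * v ord0 i - (k == i)%:R * v ord0 j).
Proof.
move=> ij; split.
- exact: sphere_fun_coord.
- under eq_fun do rewrite -mulNr.
  by apply: sphere_funD; apply: sphere_funM; (exact: sphere_fun_cst || exact: sphere_fun_coord).
exists 4 => // u v u1 v1.
have ci l : `|v ord0 l| <= 1 by rewrite -v1 le_coord_enorm.
have iu : 0 < 1 + u ^+ 2 by rewrite ltr_wpDr// sqr_ge0.
have iv : (1 + u ^+ 2)^-1 <= 1 by rewrite invf_le1// lerDl sqr_ge0.
have iv0 : 0 <= (1 + u ^+ 2)^-1 by rewrite invr_ge0 ltW.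
have ec : `|cosq u - 1| <= 2 * u ^+ 2.
  rewrite (_ : _ - 1 = - (2 * u ^+ 2 * (1 + u ^+ 2)^-1)); last first.
    by rewrite /cosq; field; exact: oneDsqr_neq0.
  have h : 0 <= 2 * u ^+ 2 by rewrite mulr_ge0// sqr_ge0.
  by rewrite normrN (ger0_norm (mulr_ge0 h iv0)) ler_piMr.
have es : `|sinq u - 2 * u| <= 2 * u ^+ 2.
  rewrite (_ : _ - _ = - (2 * u ^+ 2 * (u * (1 + u ^+ 2)^-1))); last first.
    by rewrite /sinq; field; exact: oneDsqr_neq0.
  have h : 0 <= 2 * u ^+ 2 by rewrite mulr_ge0// sqr_ge0.
  rewrite normrN normrM (ger0_norm h) ler_piMr// normrM (ger0_norm iv0).
  by rewrite -[leRHS]mulr1 ler_pM.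
have u2 := sqr_ge0 u.
have aux (a b x z : R) : `|a| <= 2 * u ^+ 2 -> `|b| <= 2 * u ^+ 2 -> `|x| <= 1 -> `|z| <= 1 ->
    `|a * x + b * z| <= 4 * u ^+ 2.
  move=> Ha Hb Hx Hy.
  rewrite (_ : 4 * u ^+ 2 = 2 * u ^+ 2 * 1 + 2 * u ^+ 2 * 1); last by ring.
  by rewrite (le_trans (ler_normD _ _))// !normrM lerD// ler_pM.
rewrite mxE; have [->|ki] := eqVneq k i.
  rewrite (negbTE ij) !mul0r sub0r mul1r.
  rewrite (_ : _ - _ - _ = (cosq u - 1) * v ord0 i + - (sinq u - 2 * u) * v ord0 j); last by ring.
  by apply: aux; rewrite ?normrN.
have [->|kj] := eqVneq k j.
  rewrite mul1r mul0r subr0.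
  rewrite (_ : _ - _ - _ = (sinq u - 2 * u) * v ord0 i + (cosq u - 1) * v ord0 j); last by ring.
  exact: aux.
by rewrite !(mul0r, subrr, mulr0) normr0 mulr_ge0.
Qed.

Lemma eq_rot_deriv i j f g f' g' : rot_deriv i j f g -> f =1 f' -> g =1 g' ->
  rot_deriv i j f' g'.
Proof. by move=> H /funext <- /funext <-. Qed.

Lemma rot_deriv_sum (I : Type) (s : seq I) i j (F G : I -> 'rV[R]_d -> R) :
  (forall l, rot_deriv i j (F l) (G l)) ->
  rot_deriv i j (fun v => \sum_(l <- s) F l v) (fun v => \sum_(l <- s) G l v).
Proof.
move=> H; elim: s => [|l s IH].
  by apply: eq_rot_deriv (rot_deriv_cst i j 0) _ _ => v; rewrite big_nil.
by apply: eq_rot_deriv (rot_derivD (H l) IH) _ _ => v; rewrite big_cons.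
Qed.

Definition dotr y v : R := \sum_k y ord0 k * v ord0 k.

(** Cauchy-Schwarz from the squared length of |v|^2 y - (y.v) v, which equals |v|^2 (|y|^2 |v|^2 -
    (y.v)^2). *)
Lemma dotr_le y v : `|dotr y v| <= enorm y * enorm v.
Proof.
have [->|v0] := eqVneq v 0.
  rewrite /dotr big1 ?normr0 ?mulr_ge0 ?enorm_ge0// => k _.
  by rewrite mxE mulr0.
rewrite -ler_sqr ?nnegrE ?mulr_ge0 ?enorm_ge0// real_normK ?num_real// exprMn.
have v0' : 0 < enorm v ^+ 2 by rewrite exprn_gt0// lt_def enorm0 v0 enorm_ge0.
have : 0 <= \sum_k (enorm v ^+ 2 * y ord0 k - dotr y v * v ord0 k) ^+ 2.
  by apply: sumr_ge0 => k _; exact: sqr_ge0.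
have -> : \sum_k (enorm v ^+ 2 * y ord0 k - dotr y v * v ord0 k) ^+ 2 =
    enorm v ^+ 2 * (enorm y ^+ 2 * enorm v ^+ 2 - dotr y v ^+ 2).
  set B := enorm v ^+ 2; set c := dotr y v.
  transitivity (\sum_k (B ^+ 2 * y ord0 k ^+ 2 + (- 2 * B * c) * (y ord0 k * v ord0 k)
      + c ^+ 2 * v ord0 k ^+ 2)).
    by apply: eq_bigr => k _; ring.
  rewrite !big_split/= -!mulr_sumr -!enorm_sqr -/(dotr y v) -/c -/B; ring.
by rewrite pmulr_rge0// subr_ge0.
Qed.

Lemma sphere_fun_dotr y : sphere_fun (dotr y).
Proof.
apply: sphere_fun_sum => k; apply: sphere_funM.
  exact: sphere_fun_cst.
exact: sphere_fun_coord.
Qed.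

Lemma rot_deriv_dotr y i j : i != j ->
  rot_deriv i j (dotr y) (fun v => y ord0 j * v ord0 i - y ord0 i * v ord0 j).
Proof.
move=> ij.
have H k := rot_derivM ij (rot_deriv_cst i j (y ord0 k)) (rot_deriv_coord k ij).
apply: eq_rot_deriv (rot_deriv_sum (index_enum _) H) _ _ => v //.
under eq_bigr do rewrite mul0r add0r mulrBr.
rewrite big_split/= sumrN; congr (_ - _).
- rewrite (bigD1 j)//= eqxx mul1r big1 ?addr0// => k /negbTE ->.
  by rewrite mul0r mulr0.
- rewrite (bigD1 i)//= eqxx mul1r big1 ?addr0// => k /negbTE ->.
  by rewrite mul0r mulr0.
Qed.

(** g is the derivative of G with a uniform quadratic remainder on [-r, r]; for r = |y| this
    interval contains all values of y.v on the sphere. *)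
Definition taylor2 (r : R) (G g : R -> R) : Prop :=
  [/\ measurable_fun setT G, measurable_fun setT g &
   exists2 M, 0 <= M & forall x, `|x| <= r ->
     [/\ `|G x| <= M, `|g x| <= M & forall x', `|x'| <= r ->
      `|G x' - G x - g x * (x' - x)| <= M * (x' - x) ^+ 2]].

Lemma sphere_fun_comp_dotr y (h : R -> R) M : measurable_fun setT h ->
  (forall x, `|x| <= enorm y -> `|h x| <= M) ->
  sphere_fun (fun v => h (dotr y v)).
Proof.
move=> mh hM; split.
  by apply: row_measurable_comp => //; case: (sphere_fun_dotr y).
exists M => v v1; apply: hM; apply: le_trans (dotr_le _ _) _.
by rewrite ler_piMr// enorm_ge0.
Qed.

Lemma rot_deriv_comp_dotr y (G g : R -> R) i j : i != j -> taylor2 (enorm y) G g ->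
  rot_deriv i j (fun v => G (dotr y v))
    (fun v => g (dotr y v) * (y ord0 j * v ord0 i - y ord0 i * v ord0 j)).
Proof.
move=> ij [mG mg [M M0 HM]].
have [_ Hk [C C0 HC]] := rot_deriv_dotr y ij.
have [_ [K HK]] := Hk.
have K0 : 0 <= Num.max K 0 by rewrite le_max lexx orbT.
have Hg : sphere_fun (fun v => g (dotr y v)).
  by apply: (sphere_fun_comp_dotr (M := M)) => // x /HM[].
split.
- by apply: (sphere_fun_comp_dotr (M := M)) => // x /HM[].
- exact: sphere_funM.
exists (M * (2 * Num.max K 0 + C) ^+ 2 + M * C).
  by rewrite addr_ge0// mulr_ge0// sqr_ge0.
move=> u v u1 v1.
have bx w : enorm w = 1 -> `|dotr y w| <= enorm y.
  by move=> w1; have := dotr_le y w; rewrite w1 mulr1.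
have [_ gM] := HM _ (bx v v1).
move=> /(_ (dotr y (rotr i j u v))); rewrite bx ?enorm_rotr// => /(_ isT) TM.
have := HC _ _ u1 v1; set k := (y ord0 j * _ - _).
have kK : `|k| <= Num.max K 0 by rewrite le_max HK// v1.
set x' := dotr y (rotr i j u v) in TM *; set x := dotr y v in TM gM * => Hx.
(* Chain rule: the Taylor remainder of G plus g times the first-order remainder of y.v. Since |x' -
   x| is at most (2K + C)|u|, both are O(u^2). *)
rewrite (_ : _ - _ - _ = (G x' - G x - g x * (x' - x)) + g x * (x' - x - 2 * u * k)); last first.
  by ring.
rewrite (le_trans (ler_normD _ _))//.
rewrite [leRHS](_ : _ = M * ((2 * Num.max K 0 + C) * u) ^+ 2 + M * (C * u ^+ 2)); last by ring.
rewrite lerD//; last by rewrite normrM ler_pM.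
apply: le_trans TM _; rewrite ler_wpM2l//.
rewrite -[(x' - x) ^+ 2]real_normK ?num_real// -[leRHS]real_normK ?num_real//.
rewrite ler_sqr ?nnegrE// normrM (ger0_norm (_ : 0 <= 2 * _ + C)); last first.
  by rewrite addr_ge0// mulr_ge0.
rewrite (_ : x' - x = (x' - x - 2 * u * k) + 2 * u * k); last by ring.
rewrite (le_trans (ler_normD _ _))//.
rewrite [leRHS](_ : _ = C * `|u| + 2 * Num.max K 0 * `|u|); last by ring.
rewrite lerD//; last first.
  by rewrite !normrM (ger0_norm (_ : 0 <= 2))// mulrAC ler_wpM2r// ler_wpM2l.
by rewrite (le_trans Hx)// ler_wpM2l// -real_normK ?num_real// expr2 ler_piMl.
Qed.

End SphereRotation.

(** * Derivatives of powers of affine functions *)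

Section Taylor.
Variable R : realType.
Implicit Types (F G g h : R -> R).

(** The bound |c - x| <= |x' - x| lets [is_derive_taylor] apply a second mean value estimate to g c
    - g x and still obtain a quadratic remainder. *)
Lemma is_derive_mvt G g (a b x x' : R) :
  (forall t, a <= t <= b -> is_derive t 1 G (g t)) ->
  a <= x <= b -> a <= x' <= b ->
  exists c, [/\ a <= c <= b, `|c - x| <= `|x' - x| & G x' - G x = g c * (x' - x)].
Proof.
move=> dG.
have main u w : a <= u <= b -> a <= w <= b -> u <= w ->
    exists c, [/\ u <= c <= w, a <= c <= b & G w - G u = g c * (w - u)].
  move=> /andP[au ub] /andP[aw wb] uw.
  have sub t : t \in `[u, w] -> a <= t <= b.
    by rewrite in_itv/= => /andP[ut tw]; rewrite (le_trans au ut) (le_trans tw wb).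
  have [||c cuw E] := @MVT_segment R G g u w uw.
  - by move=> t tuw; apply: dG; apply: sub; apply: subset_itv_oo_cc tuw.
  - apply: derivable_within_continuous => t /sub /dG dt.
    exact: ex_derive.
  exists c; split => //; last exact: sub.
move=> Hx Hx'; have [xx'|x'x] := leP x x'.
  have [c [/andP[xc cx'] cab E]] := main _ _ Hx Hx' xx'.
  exists c; split => //; rewrite !ger0_norm ?subr_ge0//.
  by rewrite lerD2r.
have [c [/andP[xc cx'] cab E]] := main _ _ Hx' Hx (ltW x'x).
exists c; split => //.
  rewrite !ler0_norm ?subr_le0//; last exact: ltW.
  by rewrite lerN2 lerD2r.
by rewrite -opprB E -mulrN opprB.
Qed.

Lemma is_derive_lip g h (a b B x x' : R) :
  (forall t, a <= t <= b -> is_derive t 1 g (h t)) ->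
  (forall t, a <= t <= b -> `|h t| <= B) ->
  a <= x <= b -> a <= x' <= b -> `|g x' - g x| <= B * `|x' - x|.
Proof.
move=> dg hB Hx Hx'; have [c [cab _ ->]] := is_derive_mvt dg Hx Hx'.
by rewrite normrM ler_wpM2r// hB.
Qed.

Lemma is_derive_taylor G g h (a b B x x' : R) :
  (forall t, a <= t <= b -> is_derive t 1 G (g t)) ->
  (forall t, a <= t <= b -> is_derive t 1 g (h t)) ->
  (forall t, a <= t <= b -> `|h t| <= B) ->
  a <= x <= b -> a <= x' <= b ->
  `|G x' - G x - g x * (x' - x)| <= B * (x' - x) ^+ 2.
Proof.
move=> dG dg hB Hx Hx'; have [c [cab cx ->]] := is_derive_mvt dG Hx Hx'.
rewrite -mulrBl normrM -[(x' - x) ^+ 2]real_normK ?num_real// expr2 mulrA.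
rewrite ler_wpM2r// (le_trans (is_derive_lip dg hB Hx cab))//.
by rewrite ler_wpM2l// (le_trans _ (hB x Hx)).
Qed.

(** The common entrance to derivatives, both of polynomials and of parameter integrals: a quadratic
    remainder uniform in the integration variable can be integrated, and differentiation under the
    integral follows. *)
Lemma is_derive_quad (f : R -> R) (x l C e : R) : 0 < e ->
  (forall u, `|u| < e -> `|f (x + u) - f x - u * l| <= C * u ^+ 2) ->
  is_derive x 1 f l.
Proof.
move=> e0 H.
have C0 : 0 <= C.
  have := H (e / 2); rewrite gtr0_norm ?divr_gt0// ltr_pdivrMr// mulr_natr mulr2n ltrDr.
  move=> /(_ e0) /(le_trans (normr_ge0 _)).
  by rewrite pmulr_lge0// exprn_gt0// divr_gt0.
have cv : u^-1 *: ((f \o shift x) (u *: (1 : R)) - f x) @[u --> 0^'] --> l.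
  apply/cvgrPdist_le => eps eps0; near=> u.
  have u0 : u != 0 by near: u; exact: nbhs_dnbhs_neq.
  have ue : `|u| < e.
    by near: u; apply: dnbhs0_lt.
  have uC : `|u| <= eps / (C + 1).
    by near: u; apply: dnbhs0_le; rewrite divr_gt0// ltr_wpDl.
  have -> : l - u^-1 *: ((f \o shift x) (u *: (1 : R)) - f x) =
      - (u^-1 * (f (x + u) - f x - u * l)).
    rewrite /= /shift/= [u *: 1]mulr1 [u + x]addrC /GRing.scale/=.
    by field.
  rewrite normrN normrM normfV mulrC ler_pdivrMr ?normr_gt0//.
  apply: le_trans (H _ ue) _.
  rewrite -real_normK ?num_real// expr2 mulrA ler_wpM2r//.
  apply: (@le_trans _ _ (C * (eps / (C + 1)))); first by rewrite ler_wpM2l.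
  by rewrite mulrA ler_pdivrMr ?ltr_wpDl// mulrDr mulr1 mulrC lerDl ltW.
have dv : derivable f x 1 by apply/cvg_ex; exists l.
by split => //; rewrite /derive; apply/cvg_lim.
Unshelve. all: by end_near. Qed.

(** The power is increasing or decreasing according to the sign of q; the sum of the end values
    bounds it in both cases. *)
Lemma powR_le_endpoints (a b x q : R) : 0 < a -> a <= x <= b ->
  x `^ q <= a `^ q + b `^ q.
Proof.
move=> a0 /andP[ax xb].
have x0 : 0 < x by exact: lt_le_trans ax.
have b0 : 0 < b by exact: lt_le_trans xb.
have [q0|q0] := leP 0 q.
  apply: ler_wpDl; first exact: powR_ge0.
  by apply: (ge0_ler_powR q0) => //; rewrite nnegrE ltW.
apply: ler_wpDr; first exact: powR_ge0.
have E z : z `^ q = (z `^ (- q))^-1 by rewrite powRN invrK.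
rewrite !E lef_pV2 ?posrE ?powR_gt0//.
have Nq0 : 0 <= - q by rewrite oppr_ge0 ltW.
by apply: (ge0_ler_powR Nq0) => //; rewrite nnegrE ltW.
Qed.

(** For c = 1 + |y|^2, x = y.v and |v| = 1 this is |y - v|^(2q). *)
Definition affpow (c q x : R) : R := (c - 2 * x) `^ q.

Lemma is_derive_aff (c x : R) : is_derive x 1 (fun x => c - 2 * x) (- 2).
Proof.
apply: (@is_derive_quad _ _ _ 0 1) => // u _.
by rewrite (_ : _ - _ - _ = 0) ?normr0 ?mul0r//; ring.
Qed.

Lemma is_derive_affpow (c q x : R) : 0 < c - 2 * x ->
  is_derive x 1 (affpow c q) (- 2 * q * affpow c (q - 1) x).
Proof.
move=> D0; have da := is_derive_aff c x.
have dp := @is_derive1_powR R q _ D0.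
have H := @is_derive1_comp R (fun z => z `^ q) (fun x => c - 2 * x) x _ _ dp da.
apply: (is_derive_eq H).
by rewrite /affpow; ring.
Qed.

Lemma measurable_aff (c : R) : measurable_fun setT (fun x : R => c - 2 * x).
Proof.
apply: measurable_funB; first exact: measurable_cst.
by apply: measurable_funM; [exact: measurable_cst|exact: measurable_id].
Qed.

Lemma measurable_affpow (c q : R) : measurable_fun setT (affpow c q).
Proof.
exact: (measurableT_comp (@measurable_powR R q) (measurable_aff c)).
Qed.

Lemma taylor2_intro (r : R) G g h (B : R) : 0 <= r ->
  measurable_fun setT G -> measurable_fun setT g ->
  (forall t, - r <= t <= r -> is_derive t 1 G (g t)) ->
  (forall t, - r <= t <= r -> is_derive t 1 g (h t)) ->
  (forall t, - r <= t <= r -> `|h t| <= B) ->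
  taylor2 r G g.
Proof.
move=> r0 mG mg dG dg hB; split => //.
have r_in : - r <= r <= r by rewrite lexx andbT ge0_cp.
have z_in : - r <= 0 <= r by rewrite r0 oppr_le0 r0.
have B0 : 0 <= B by exact: le_trans (normr_ge0 _) (hB _ z_in).
pose N := `|g 0| + B * r.
have N0 : 0 <= N by rewrite addr_ge0// mulr_ge0.
have bg t : - r <= t <= r -> `|g t| <= N.
  move=> Ht; rewrite -[g t](subrK (g 0)) addrC (le_trans (ler_normD _ _))// lerD2l.
  rewrite (le_trans (is_derive_lip dg hB z_in Ht))// subr0 ler_wpM2l//.
  by rewrite ler_norml.
have bG t : - r <= t <= r -> `|G t| <= `|G 0| + N * r.
  move=> Ht; rewrite -[G t](subrK (G 0)) addrC (le_trans (ler_normD _ _))// lerD2l.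
  rewrite (le_trans (is_derive_lip dG bg z_in Ht))// subr0 ler_wpM2l//.
  by rewrite ler_norml.
exists (B + N + (`|G 0| + N * r)); first by rewrite !addr_ge0// mulr_ge0.
have P0 : 0 <= `|G 0| + N * r by rewrite addr_ge0// mulr_ge0.
move=> x; rewrite ler_norml => Hx; split.
- by rewrite (le_trans (bG x Hx))// lerDr addr_ge0.
- by rewrite (le_trans (bg x Hx))// addrAC lerDr addr_ge0.
move=> x'; rewrite ler_norml => Hx'.
rewrite (le_trans (is_derive_taylor dG dg hB Hx Hx'))//.
by rewrite ler_wpM2r ?sqr_ge0// -addrA lerDl addr_ge0.
Qed.

Section Primitives.
Variables (c r : R).
Hypotheses (r0 : 0 <= r) (cr : 0 < c - 2 * r).

Let D_gt0 t : - r <= t <= r -> 0 < c - 2 * t.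
Proof. by move=> /andP[_ tr]; rewrite (lt_le_trans cr)// lerD2l lerN2 ler_wpM2l. Qed.

Let affpow_bound q : exists B, forall t, - r <= t <= r -> `|affpow c q t| <= B.
Proof.
exists ((c - 2 * r) `^ q + (c + 2 * r) `^ q) => t tr.
rewrite ger0_norm ?powR_ge0//; apply: powR_le_endpoints => //.
by move: tr => /andP[? ?]; apply/andP; split; lra.
Qed.

Lemma taylor2_affpow q :
  taylor2 r (affpow c q) (fun x => - 2 * q * affpow c (q - 1) x).
Proof.
have [B HB] := affpow_bound (q - 1 - 1).
refine (@taylor2_intro r _ _ (fun x => (- 2 * q) * (- 2 * (q - 1) * affpow c (q - 1 - 1) x))
  (`|- 2 * q * (- 2 * (q - 1))| * B) r0 _ _ _ _ _).
- exact: measurable_affpow.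
- by apply: measurable_funM; [exact: measurable_cst|exact: measurable_affpow].
- by move=> t /D_gt0; exact: is_derive_affpow.
- move=> t /D_gt0 D0.
  exact: (@is_deriveZ _ _ _ (affpow c (q - 1)) (- 2 * q) t 1 _ (is_derive_affpow _ D0)).
- by move=> t Ht; rewrite mulrA normrM ler_wpM2l// HB.
Qed.

Lemma taylor2Z G g a : taylor2 r G g -> taylor2 r (fun x => a * G x) (fun x => a * g x).
Proof.
move=> [mG mg [M M0 HM]]; split.
- by apply: measurable_funM => //; exact: measurable_cst.
- by apply: measurable_funM => //; exact: measurable_cst.
exists (`|a| * M); first exact: mulr_ge0.
move=> x /HM[HG Hg HT]; split; rewrite ?normrM ?ler_wpM2l//.
move=> x' /HT Hx'.
rewrite (_ : _ - _ - _ = a * (G x' - G x - g x * (x' - x))); last by ring.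
by rewrite normrM -mulrA ler_wpM2l.
Qed.

Lemma eq_taylor2 G g g' : taylor2 r G g -> g =1 g' -> taylor2 r G g'.
Proof. by move=> H /funext <-. Qed.

Lemma is_derive_lnaff t : - r <= t <= r ->
  is_derive t 1 (fun x => ln (c - 2 * x)) (- 2 * affpow c (- 1) t).
Proof.
move=> /D_gt0 D0.
have H := @is_derive1_comp R (@ln R) (fun x => c - 2 * x) t _ _
  (is_derive1_ln D0) (is_derive_aff c t).
apply: (is_derive_eq H).
by rewrite /affpow powR_inv1 ?ltW// mulrC.
Qed.

Lemma measurable_lnaff : measurable_fun setT (fun x : R => ln (c - 2 * x)).
Proof.
exact: (measurableT_comp (@measurable_ln R) (measurable_aff c)).
Qed.

Lemma taylor2_lnaff :
  taylor2 r (fun x => (- 2)^-1 * ln (c - 2 * x)) (affpow c (- 1)).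
Proof.
have [B HB] := affpow_bound (- 1 - 1).
refine (@taylor2_intro r _ _ (fun x => - 2 * (- 1) * affpow c (- 1 - 1) x) (`|- 2 * (- 1)| * B) r0 _ _ _ _ _).
- by apply: measurable_funM; [exact: measurable_cst|exact: measurable_lnaff].
- exact: measurable_affpow.
- move=> t Ht; have := is_deriveZ (- 2)^-1 (is_derive_lnaff Ht).
  by move=> H; apply: (is_derive_eq H); rewrite /GRing.scale/= mulrA mulVf ?mul1r// oppr_eq0.
- by move=> t /D_gt0; exact: is_derive_affpow.
- by move=> t Ht; rewrite normrM ler_wpM2l// HB.
Qed.

Lemma taylor2_affpow_primitive q : q != - 1 ->
  taylor2 r (fun x => (- 2 * (q + 1))^-1 * affpow c (q + 1) x) (affpow c q).
Proof.
move=> q1; have q1' : q + 1 != 0 by rewrite addr_eq0.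
apply: (eq_taylor2 (taylor2Z _ (taylor2_affpow (q + 1)))) => x.
by rewrite addrK mulrA mulVf ?mul1r// mulf_neq0// oppr_eq0.
Qed.

Lemma affpow_primitive q : exists G, taylor2 r G (affpow c q).
Proof.
have [->|q1] := eqVneq q (- 1); first by eexists; exact: taylor2_lnaff.
by eexists; exact: taylor2_affpow_primitive.
Qed.

Lemma lnaff_primitive : exists G, taylor2 r G (fun x => ln (c - 2 * x)).
Proof.
have [B HB] := affpow_bound (- 1).
(* The primitive z (ln z - 1) of ln z, at z = c - 2x; the inner derivative -2 is divided out
   afterwards. *)
pose G x := (c - 2 * x) * (ln (c - 2 * x) - 1).
suff H : taylor2 r G (fun x => - 2 * ln (c - 2 * x)).
  exists (fun x => (- 2)^-1 * G x).
  apply: (eq_taylor2 (taylor2Z _ H)) => x.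
  by rewrite mulrA mulVf ?mul1r// oppr_eq0.
have ml := measurable_lnaff.
refine (@taylor2_intro r _ _ (fun x => - 2 * (- 2 * affpow c (- 1) x)) (`|- 2 * (- 2)| * B) r0 _ _ _ _ _).
- apply: measurable_funM; first exact: measurable_aff.
  by apply: measurable_funB => //; exact: measurable_cst.
- by apply: measurable_funM => //; exact: measurable_cst.
- move=> t Ht.
  have dl : is_derive t 1 (fun x => ln (c - 2 * x) - 1) (- 2 * affpow c (- 1) t - 0).
    exact: (is_deriveB (is_derive_lnaff Ht) (is_derive_cst (1 : R) t 1)).
  have := is_deriveM (is_derive_aff c t) dl.
  move=> H; apply: (is_derive_eq H); rewrite /GRing.scale/= /affpow.
  have D0 := D_gt0 Ht; rewrite powR_inv1 ?ltW//.
  by field; rewrite gt_eqF.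
- by move=> t Ht; exact: is_deriveZ (is_derive_lnaff Ht).
- by move=> t Ht; rewrite mulrA normrM ler_wpM2l// HB.
Qed.

(** Each primitive lets one more moment of a zonal function be written as a rotational derivative;
    second moments use two. For the exponent -d/2 a logarithm appears in the first primitive when d
    = 2 and in the second when d = 4. *)
Lemma affpow_primitive2 q :
  exists G1 G2, taylor2 r G1 (affpow c q) /\ taylor2 r G2 G1.
Proof.
have [->|q1] := eqVneq q (- 1).
  have [G HG] := lnaff_primitive.
  by do 2 eexists; split; [exact: taylor2_lnaff|exact: taylor2Z HG].
have [G HG] := affpow_primitive (q + 1).
by do 2 eexists; split; [exact: taylor2_affpow_primitive|exact: taylor2Z HG].
Qed.

End Primitives.

End Taylor.

(** * Moments of the uniform distribution on the sphere *)

Section SphereFunSub.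
Variables (R : realType) (d : nat).
Implicit Types (f g : 'rV[R]_d -> R).

Lemma sphere_funN f : sphere_fun f -> sphere_fun (fun v => - f v).
Proof.
move=> Hf; rewrite (_ : (fun v => - f v) = (fun v => -1 * f v)).
  by apply: sphere_funM => //; exact: sphere_fun_cst.
by apply/funext => v; rewrite mulN1r.
Qed.

Lemma sphere_funB f g : sphere_fun f -> sphere_fun g ->
  sphere_fun (fun v => f v - g v).
Proof. by move=> Hf Hg; apply: sphere_funD => //; exact: sphere_funN. Qed.

Lemma sphere_intB f g : sphere_fun f -> sphere_fun g ->
  sphere_int (fun v => f v - g v) = sphere_int f - sphere_int g.
Proof.
move=> Hf Hg; rewrite sphere_intD//; last exact: sphere_funN.
rewrite -[X in _ = _ + X]mulN1r -sphere_intZ//; congr (_ + sphere_int _).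
by apply/funext => v; rewrite mulN1r.
Qed.

End SphereFunSub.

Ltac sfun := repeat first [ assumption | exact: sphere_fun_cst
  | exact: sphere_fun_coord | exact: sphere_fun_dotr
  | apply: sphere_funB | apply: sphere_funD | apply: sphere_funM
  | apply: sphere_funN ].

Section SphereMoments.
Variables (R : realType) (d : nat).
Hypothesis d_gt1 : (1 < d)%N.
Let d_gt0 : (0 < d)%N := ltnW d_gt1.
Implicit Types (f g : 'rV[R]_d -> R) (v y : 'rV[R]_d) (i j k l : 'I_d).
Local Notation m := (@sphere_int R d).
Local Notation area := (@sphere_int R d (fun=> 1)).

Lemma rot_deriv_ext_int i j f g h : i != j -> rot_deriv i j f g ->
  (forall v, enorm v = 1 -> h v = g v) -> m h = 0.
Proof.
move=> ij H hg; rewrite -(sphere_int_rot_deriv d_gt0 ij H).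
by case: H => _ Hg _; apply: sphere_int_ext.
Qed.

Lemma enorm1_sum v : enorm v = 1 -> \sum_k v ord0 k ^+ 2 = 1.
Proof. by move=> v1; rewrite -enorm_sqr v1 expr1n. Qed.

Lemma enorm1_sumM v : enorm v = 1 -> \sum_k v ord0 k * v ord0 k = 1.
Proof. by move=> v1; rewrite -(enorm1_sum v1); apply: eq_bigr => k _; rewrite expr2. Qed.

(* Summing v_i d_j - v_j d_i applied to v_j f over j gives
   (d - 1 + deg f) v_i f - d_i f on the sphere for f homogeneous. *)
Lemma sphere_int_coord_deriv i f (h : 'I_d -> 'rV[R]_d -> R) :
  sphere_fun f -> (forall j, sphere_fun (h j)) ->
  (forall j, i != j -> rot_deriv i j f (h j)) ->
  m (fun v => (d%:R - 1) * (v ord0 i * f v) +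
    \sum_(j < d) (if j == i then 0 else v ord0 j * h j v)) = 0.
Proof.
move=> Hf Hh Hd.
pose E j v := if j == i then 0 else v ord0 i * f v + v ord0 j * h j v.
have HE j : sphere_fun (E j).
  by rewrite /E; case: eqP => _; sfun; exact: Hh.
transitivity (m (fun v => \sum_(j < d) E j v)).
  congr m; apply/funext => v; rewrite /E.
  rewrite (bigD1 i)//= eqxx add0r [in RHS](bigD1 i)//= eqxx add0r.
  under eq_bigr => j /negbTE -> do [].
  under [in RHS]eq_bigr => j /negbTE -> do [].
  rewrite big_split/=; congr (_ + _).
  apply: (addrI (v ord0 i * f v)).
  rewrite -(@bigD1 _ _ _ _ i xpredT (fun=> v ord0 i * f v))//=.
  by rewrite sumr_const card_ord -mulr_natl; ring.
rewrite sphere_int_sum//; apply: big1 => j _; rewrite /E.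
have [ji|ji] := eqVneq j i.
  by rewrite -[RHS](mul0r area) -sphere_intZ ?mul0r//; sfun.
have ij : i != j by rewrite eq_sym.
apply: (rot_deriv_ext_int ij (rot_derivM ij (rot_deriv_coord R j ij) (Hd j ij))) => v _.
by rewrite eqxx (negbTE ji) mul1r mul0r subr0.
Qed.

Lemma exists_neq i : exists j, i != j.
Proof.
have [i0|i0] := eqVneq i (Ordinal d_gt0).
  by exists (Ordinal d_gt1); rewrite i0.
by exists (Ordinal d_gt0).
Qed.

(** v_i is the rotational derivative of v_j for any j other than i, and d >= 2 provides such a j. *)
Lemma sphere_moment1 i : m (fun v => v ord0 i) = 0.
Proof.
have [j ij] := exists_neq i.
apply: (rot_deriv_ext_int ij (rot_deriv_coord R j ij)) => v _.
by rewrite eqxx eq_sym (negbTE ij) mul1r mul0r subr0.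
Qed.

Let kd (i j : 'I_d) : R := (i == j)%:R.

Lemma sum_kd i (a : 'I_d -> R) : \sum_j kd i j * a j = a i.
Proof.
rewrite (bigD1 i)//= /kd eqxx mul1r big1 ?addr0// => j ji.
by rewrite eq_sym (negbTE ji) mul0r.
Qed.

(* The diagonal terms of the sum vanish, so the excluded index may be put back. *)
Lemma sphere_int_coord_deriv' i f (h : 'I_d -> 'rV[R]_d -> R) :
  sphere_fun f -> (forall j, sphere_fun (h j)) -> (forall v, h i v = 0) ->
  (forall j, i != j -> rot_deriv i j f (h j)) ->
  m (fun v => (d%:R - 1) * (v ord0 i * f v) + \sum_j v ord0 j * h j v) = 0.
Proof.
move=> Hf Hh hi Hd; rewrite -[RHS](sphere_int_coord_deriv Hf Hh Hd).
congr m; apply/funext => v; congr (_ + _); apply: eq_bigr => j _.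
by case: eqP => // ->; rewrite hi mulr0.
Qed.

(** For f = v_k the integrated expression is d v_i v_k - delta_ki on the sphere. *)
Lemma sphere_moment2 i k : m (fun v => v ord0 i * v ord0 k) = kd i k * (area / d%:R).
Proof.
have Hf : sphere_fun (fun v : 'rV[R]_d => v ord0 k) by sfun.
pose h j v := kd k j * v ord0 i - kd k i * v ord0 j.
have Hh j : sphere_fun (h j) by rewrite /h; sfun.
have := sphere_int_coord_deriv' Hf Hh (fun v => subrr _) (fun j ij => rot_deriv_coord R k ij).
rewrite (@sphere_int_ext _ _ d_gt0 _ (fun v => d%:R * (v ord0 i * v ord0 k) - kd k i * 1)); last 2 first.
- by sfun.
- move=> v v1.
  have -> : \sum_j v ord0 j * h j v = v ord0 k * v ord0 i - kd k i * 1.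
    rewrite -(enorm1_sumM v1) mulr_sumr -(sum_kd k (fun j => v ord0 j * v ord0 i)) -sumrB.
    by apply: eq_bigr => j _; rewrite /h; ring.
  by ring.
rewrite sphere_intB; [|by sfun..].
rewrite !sphere_intZ; [|by sfun..].
move=> /eqP; rewrite subr_eq0 => /eqP H.
have d0 : d%:R != 0 :> R by rewrite pnatr_eq0 -lt0n.
apply: (mulfI d0); rewrite H /kd eq_sym; field => //.
Qed.

(** For f = v_a v_b v_c the factor d - 1 + deg f is d + 2, and the derivative of f leaves three
    second moments, one for each pairing of i. *)
Lemma sphere_moment4 i a b c :
  m (fun v => v ord0 i * (v ord0 a * v ord0 b * v ord0 c)) =
  (kd i a * kd b c + kd i b * kd a c + kd i c * kd a b) *
    (area / (d%:R * (d%:R + 2))).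
Proof.
have Hf : sphere_fun (fun v : 'rV[R]_d => v ord0 a * v ord0 b * v ord0 c) by sfun.
pose hh k j v := kd k j * v ord0 i - kd k i * v ord0 j.
pose h j v := (hh a j v * v ord0 b + v ord0 a * hh b j v) * v ord0 c +
  v ord0 a * v ord0 b * hh c j v.
have Hh j : sphere_fun (h j) by rewrite /h /hh; sfun.
have hi v : h i v = 0 by rewrite /h /hh !subrr; ring.
have Hd j (ij : i != j) : rot_deriv i j (fun v => v ord0 a * v ord0 b * v ord0 c) (h j).
  apply: (rot_derivM ij (rot_derivM ij (rot_deriv_coord R a ij) (rot_deriv_coord R b ij)) (rot_deriv_coord R c ij)).
have := sphere_int_coord_deriv' Hf Hh hi Hd.
rewrite (@sphere_int_ext _ _ d_gt0 _ (fun v =>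
  (d%:R + 2) * (v ord0 i * (v ord0 a * v ord0 b * v ord0 c)) -
  (kd a i * (v ord0 b * v ord0 c) + kd b i * (v ord0 a * v ord0 c)
   + kd c i * (v ord0 a * v ord0 b)))); last 2 first.
- by sfun.
- move=> v v1.
  have E k : \sum_j v ord0 j * hh k j v = v ord0 k * v ord0 i - kd k i * 1.
    rewrite -(enorm1_sumM v1) mulr_sumr -(sum_kd k (fun j => v ord0 j * v ord0 i)) -sumrB.
    by apply: eq_bigr => j _; rewrite /hh; ring.
  have -> : \sum_j v ord0 j * h j v =
      (\sum_j v ord0 j * hh a j v) * (v ord0 b * v ord0 c) +
      (\sum_j v ord0 j * hh b j v) * (v ord0 a * v ord0 c) +
      (\sum_j v ord0 j * hh c j v) * (v ord0 a * v ord0 b).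
    rewrite !mulr_suml -!big_split/=.
    by apply: eq_bigr => j _; rewrite /h; ring.
  by rewrite !E; ring.
rewrite sphere_intB; [|by sfun..].
rewrite !sphere_intD; [|by sfun..].
rewrite !sphere_intZ; [|by sfun..].
move=> /eqP; rewrite subr_eq0 !sphere_moment2 => /eqP H.
have d0 : d%:R != 0 :> R by rewrite pnatr_eq0 -lt0n.
have d20 : d%:R + 2 != 0 :> R by rewrite gt_eqF// ltr_wpDl.
apply: (mulfI d20); rewrite H /kd ![_ == i]eq_sym; field.
by rewrite d0 d20.
Qed.

End SphereMoments.

(** * Zonal functions and the Poisson kernel *)

Section Zonal.
Variables (R : realType) (d : nat).
Hypothesis d_gt1 : (1 < d)%N.
Let d_gt0 : (0 < d)%N := ltnW d_gt1.
Implicit Types (f : 'rV[R]_d -> R) (v y e : 'rV[R]_d) (i j k l : 'I_d).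
Local Notation m := (@sphere_int R d).
Local Notation area := (@sphere_int R d (fun=> 1)).

Lemma taylor2_sphere_fun y (G g : R -> R) : taylor2 (enorm y) G g ->
  sphere_fun (fun v => G (dotr y v)) /\ sphere_fun (fun v => g (dotr y v)).
Proof.
move=> [mG mg [M M0 HM]].
by split; apply: (sphere_fun_comp_dotr (M := M)) => // x /HM[].
Qed.

(** Obtained by applying [sphere_int_coord_deriv'] to y_i g(y.v) and summing over i. For y nonzero
    it is integration by parts in s = y.v against the weight (|y|^2 - s^2)^((d-3)/2). *)
Lemma zonal_by_parts y (g g' : R -> R) : taylor2 (enorm y) g g' ->
  m (fun v => (d%:R - 1) * (dotr y v * g (dotr y v)) +
              g' (dotr y v) * (dotr y v ^+ 2 - enorm y ^+ 2)) = 0.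
Proof.
move=> Hg; have [Sg Sg'] := taylor2_sphere_fun Hg.
pose h i j v := y ord0 i * (g' (dotr y v) * (y ord0 j * v ord0 i - y ord0 i * v ord0 j)).
have Hh i j : sphere_fun (h i j) by rewrite /h; sfun.
have H i : m (fun v => (d%:R - 1) * (v ord0 i * (y ord0 i * g (dotr y v))) +
    \sum_j v ord0 j * h i j v) = 0.
  apply: sphere_int_coord_deriv' => //.
  - by sfun.
  - by move=> v; rewrite /h; ring.
  move=> j ij; have := rot_derivM ij (rot_deriv_cst i j (y ord0 i)) (rot_deriv_comp_dotr ij Hg).
  by move=> H; apply: eq_rot_deriv H _ _ => v //; rewrite /h; ring.
transitivity (m (fun v => \sum_i ((d%:R - 1) * (v ord0 i * (y ord0 i * g (dotr y v))) +
    \sum_j v ord0 j * h i j v))); last first.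
  rewrite sphere_int_sum; first by apply: big1 => i _; exact: H.
  move=> i; apply: sphere_funD; first by sfun.
  by apply: sphere_fun_sum => j; sfun.
apply: sphere_int_ext => //.
  apply: sphere_fun_sum => i; apply: sphere_funD; first by sfun.
  by apply: sphere_fun_sum => j; sfun.
move=> v v1; rewrite big_split/=; congr (_ + _).
  rewrite -mulr_sumr {1}/dotr mulr_suml; congr (_ * _).
  by apply: eq_bigr => i _; ring.
rewrite (_ : _ - _ = \sum_i \sum_j (y ord0 i * v ord0 i * (y ord0 j * v ord0 j) -
    y ord0 i ^+ 2 * v ord0 j ^+ 2)).
  rewrite mulr_sumr; apply: eq_bigr => i _; rewrite mulr_sumr.
  by apply: eq_bigr => j _; rewrite /h; ring.
under [RHS]eq_bigr do rewrite sumrB -!mulr_sumr (enorm1_sum v1) mulr1.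
by rewrite sumrB -mulr_suml -enorm_sqr expr2.
Qed.

Definition zmom1 y (p : R -> R) i : R := m (fun v => v ord0 i * p (dotr y v)).

(** The rotational derivative of G(y.v) is p(y.v) (y_j v_i - y_i v_j), so the vector of first
    moments is parallel to y. *)
Lemma zonal_moment1_sym y (G p : R -> R) i j : taylor2 (enorm y) G p ->
  y ord0 j * zmom1 y p i = y ord0 i * zmom1 y p j.
Proof.
have [->//|ij] := eqVneq i j => HG; have [_ Sp] := taylor2_sphere_fun HG.
have := rot_deriv_ext_int d_gt1 ij (rot_deriv_comp_dotr ij HG) (fun v _ => erefl).
move=> H; apply/eqP; rewrite -subr_eq0 /zmom1 -!sphere_intZ; [|by sfun..].
rewrite -sphere_intB; [|by sfun..].
rewrite -[X in _ == X]H; apply/eqP; congr m; apply/funext => v; ring.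
Qed.

Lemma zonal_moment1 y (G p : R -> R) i : taylor2 (enorm y) G p ->
  enorm y ^+ 2 * zmom1 y p i =
  y ord0 i * m (fun v => dotr y v * p (dotr y v)).
Proof.
move=> HG; have [_ Sp] := taylor2_sphere_fun HG.
rewrite enorm_sqr mulr_suml.
under eq_bigr do rewrite expr2 -mulrA (zonal_moment1_sym i _ HG) mulrCA.
rewrite -mulr_sumr; congr (_ * _).
rewrite [RHS](_ : _ = m (fun v => \sum_j y ord0 j * (v ord0 j * p (dotr y v)))).
  rewrite sphere_int_sum => [|j]; last by sfun.
  by apply: eq_bigr => j _; rewrite sphere_intZ//; sfun.
congr m; apply/funext => v; rewrite {1}/dotr mulr_suml.
by apply: eq_bigr => j _; rewrite mulrA.
Qed.

Definition zmom2 y (p : R -> R) i l : R :=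
  m (fun v => v ord0 i * v ord0 l * p (dotr y v)).

(** The rotational derivative of v_l G(y.v) has zero integral; the Leibniz terms on v_l give the
    right-hand side. *)
Lemma zonal_moment2_rel y (G p : R -> R) i j l : taylor2 (enorm y) G p ->
  y ord0 j * zmom2 y p i l - y ord0 i * zmom2 y p j l =
  (l == i)%:R * zmom1 y G j - (l == j)%:R * zmom1 y G i.
Proof.
have [->|ij] := eqVneq i j => HG; first by rewrite !subrr.
have [SG Sp] := taylor2_sphere_fun HG.
have := rot_deriv_ext_int d_gt1 ij
  (rot_derivM ij (rot_deriv_coord R l ij) (rot_deriv_comp_dotr ij HG)) (fun v _ => erefl).
move=> H; apply/eqP; rewrite -subr_eq0 /zmom1 /zmom2 -!sphere_intZ; [|by sfun..].
rewrite -!sphere_intB; [|by sfun..].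
rewrite -[X in _ == X]H; apply/eqP; congr m; apply/funext => v; ring.
Qed.

(** The shape forced by symmetry under rotations fixing y. The primitive G2 serves to make the first
    moments of G1 equal to tau y. *)
Lemma zonal_moment2 y (G1 G2 p : R -> R) : enorm y != 0 ->
  taylor2 (enorm y) G1 p -> taylor2 (enorm y) G2 G1 ->
  exists a b, forall i l,
    zmom2 y p i l = a * (i == l)%:R + b * (y ord0 i * y ord0 l).
Proof.
move=> y0 H1 H2.
pose r2 := enorm y ^+ 2; have r20 : r2 != 0 by rewrite expf_neq0.
pose tau := m (fun v => dotr y v * G1 (dotr y v)) / r2.
have T j : zmom1 y G1 j = tau * y ord0 j.
  by apply: (mulfI r20); rewrite (zonal_moment1 _ H2) /tau; field.
(* Subtracting tau times the identity cancels the right-hand side of [zonal_moment2_rel]: the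
   columns of M become parallel to y, and symmetry makes M a multiple of the matrix (y_i y_l). *)
pose M i l := zmom2 y p i l - tau * (i == l)%:R.
have Mrel i j l : y ord0 j * M i l = y ord0 i * M j l.
  have := zonal_moment2_rel i j l H1; rewrite !T ![l == _]eq_sym => /eqP.
  rewrite -subr_eq0 => /eqP E; apply/eqP; rewrite -subr_eq0; apply/eqP.
  by rewrite -[RHS]E /M; ring.
have Msym i l : M i l = M l i.
  rewrite /M eq_sym; congr (_ - _); rewrite /zmom2; congr m.
  by apply/funext => v; rewrite [v ord0 i * _]mulrC.
pose w l := \sum_j y ord0 j * M j l.
have Mw i l : r2 * M i l = y ord0 i * w l.
  rewrite /r2 enorm_sqr mulr_suml /w mulr_sumr; apply: eq_bigr => j _.
  by rewrite expr2 -mulrA Mrel mulrCA.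
have ww i l : y ord0 i * w l = y ord0 l * w i by rewrite -!Mw Msym.
pose k := (\sum_j y ord0 j * w j).
have wk l : r2 * w l = y ord0 l * k.
  rewrite /r2 enorm_sqr mulr_suml /k mulr_sumr; apply: eq_bigr => j _.
  by rewrite expr2 -mulrA ww mulrCA.
exists tau, (k / r2 / r2) => i l.
have : r2 * (r2 * M i l) = y ord0 i * (y ord0 l * k) by rewrite Mw mulrCA wk.
rewrite /M => H.
have {}H : zmom2 y p i l - tau * (i == l)%:R = y ord0 i * (y ord0 l * k) / r2 / r2.
  by rewrite -H; field.
by rewrite -(subrK (tau * (i == l)%:R) (zmom2 y p i l)) H; ring.
Qed.

End Zonal.

(** * Powers of |r e - v|^2 as functions of the radius r *)

Section RadialDerivative.
Variable R : realType.

(** This is |r e - v|^2 for unit vectors e and v with e.v = t. *)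
Definition kbase (t r : R) : R := 1 + r ^+ 2 - 2 * (r * t).

Lemma kbase_ge (a t r : R) : a < 1 -> `|r| <= a -> `|t| <= 1 ->
  (1 - a) ^+ 2 <= kbase t r <= 4.
Proof.
move=> a1 ra t1; have r0 := normr_ge0 r.
have rt : `|r * t| <= `|r| by rewrite normrM ler_piMr.
have r2 : r ^+ 2 = `|r| ^+ 2 by rewrite real_normK ?num_real.
move: rt; rewrite ler_norml => /andP[rt1 rt2].
by rewrite /kbase r2; apply/andP; split; nra.
Qed.

Lemma is_derive_kbase (t r : R) : is_derive r 1 (kbase t) (2 * (r - t)).
Proof.
apply: (@is_derive_quad _ _ _ _ 1 1) => // u _.
rewrite (_ : _ - _ - _ = 1 * u ^+ 2); last by rewrite /kbase; ring.
by rewrite ger0_norm// mul1r sqr_ge0.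
Qed.

Lemma is_derive_kbase_pow (p t r : R) : 0 < kbase t r ->
  is_derive r 1 (fun r => kbase t r `^ p) (p * (2 * (r - t)) * kbase t r `^ (p - 1)).
Proof.
move=> D0; have H := @is_derive1_comp R (fun z => z `^ p) (kbase t) r _ _
  (is_derive1_powR p D0) (is_derive_kbase t r).
by apply: (is_derive_eq H); ring.
Qed.

(** B does not depend on t, so the estimate can be integrated over v. It is finite because r stays
    below a < 1, which keeps the base away from 0. *)
Lemma kbase_pow_taylor (p a : R) : 0 <= a -> a < 1 -> exists2 B, 0 <= B &
  forall t r r', `|t| <= 1 -> `|r| <= a -> `|r'| <= a ->
  `|kbase t r' `^ p - kbase t r `^ p -
    p * (2 * (r - t)) * kbase t r `^ (p - 1) * (r' - r)| <= B * (r' - r) ^+ 2.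
Proof.
move=> a0 a1; have a2 : 0 < (1 - a) ^+ 2 by rewrite exprn_gt0// subr_gt0.
pose b q := ((1 - a) ^+ 2) `^ q + (4 : R) `^ q.
have b0 q : 0 <= b q by rewrite addr_ge0// powR_ge0.
pose h t r := p * 2 * kbase t r `^ (p - 1) +
  p * (2 * (r - t)) * ((p - 1) * (2 * (r - t)) * kbase t r `^ (p - 1 - 1)).
exists (`|p * 2| * b (p - 1) + `|p| * 4 * (`|p - 1| * 4 * b (p - 1 - 1))).
  by rewrite addr_ge0// !mulr_ge0.
move=> t r r' t1 ra ra'.
have Hr : - a <= r <= a by rewrite -ler_norml.
have Hr' : - a <= r' <= a by rewrite -ler_norml.
have D0 u : - a <= u <= a -> 0 < kbase t u.
  rewrite -ler_norml => ua; have /andP[+ _] := kbase_ge a1 ua t1.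
  exact: lt_le_trans.
have Db q u : - a <= u <= a -> `|kbase t u `^ q| <= b q.
  rewrite -ler_norml => ua; rewrite ger0_norm ?powR_ge0//.
  exact: powR_le_endpoints (kbase_ge a1 ua t1).
apply: (is_derive_taylor (G := fun r => kbase t r `^ p)
  (g := fun r => p * (2 * (r - t)) * kbase t r `^ (p - 1)) (h := h t) _ _ _ Hr Hr').
- by move=> u /D0; exact: is_derive_kbase_pow.
- move=> u /D0 Du; rewrite /h.
  have dl : is_derive u 1 (fun r => p * (2 * (r - t))) (p * 2).
    apply: (@is_derive_quad _ _ _ _ 0 1) => // w _.
    by rewrite (_ : _ - _ - _ = 0) ?normr0 ?mul0r//; ring.
  have H := is_deriveM dl (is_derive_kbase_pow (p - 1) Du).
  by apply: (is_derive_eq H); rewrite /GRing.scale/=; ring.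
move=> u Hu; rewrite /h (le_trans (ler_normD _ _))// lerD//.
  by rewrite normrM ler_wpM2l// Db.
have ut : `|2 * (u - t)| <= 4.
  rewrite normrM (ger0_norm (_ : 0 <= 2))// (_ : 4 = 2 * (1 + 1)); last by ring.
  rewrite ler_wpM2l// (le_trans (ler_normB _ _))// lerD//.
  by rewrite (le_trans (_ : _ <= a)) ?ler_norml// ltW.
rewrite normrM [`|p * _|]normrM ler_pM ?mulr_ge0//; first by rewrite ler_wpM2l.
by rewrite normrM ler_pM ?Db// normrM ler_wpM2l.
Qed.

End RadialDerivative.

(** * Total mass and moments of the Poisson kernel *)

Section Poisson.
Variables (R : realType) (d : nat).
Hypothesis d_gt1 : (1 < d)%N.
Let d_gt0 : (0 < d)%N := ltnW d_gt1.
Implicit Types (f : 'rV[R]_d -> R) (v y e : 'rV[R]_d) (i j k l : 'I_d).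
Local Notation m := (@sphere_int R d).
Local Notation area := (@sphere_int R d (fun=> 1)).

Lemma dotrZ a y v : dotr (a *: y) v = a * dotr y v.
Proof. by rewrite /dotr mulr_sumr; apply: eq_bigr => k _; rewrite mxE mulrA. Qed.

Lemma affpow_kbase e v r p : affpow (1 + r ^+ 2) p (dotr (r *: e) v) = kbase (dotr e v) r `^ p.
Proof. by rewrite /affpow /kbase dotrZ. Qed.

Definition radial e p (r : R) : R := m (fun v => kbase (dotr e v) r `^ p).

Section Unit.
Variable e : 'rV[R]_d.
Hypothesis e1 : enorm e = 1.

Let dot_le1 v : enorm v = 1 -> `|dotr e v| <= 1.
Proof. by move=> v1; have := dotr_le e v; rewrite e1 v1 mulr1. Qed.

Let enorm_re r : enorm (r *: e) = `|r|.
Proof. by rewrite enormZ e1 mulr1. Qed.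

Let aff_gt0 (r : R) : `|r| < 1 -> 0 < 1 + r ^+ 2 - 2 * `|r|.
Proof.
move=> r1; rewrite (_ : _ - _ = (1 - `|r|) ^+ 2); last first.
  by rewrite -(real_normK (num_real r)); ring.
by rewrite exprn_gt0// subr_gt0.
Qed.

Let sphere_fun_kbase r p : `|r| < 1 -> sphere_fun (fun v => kbase (dotr e v) r `^ p).
Proof.
move=> r1; have H := taylor2_affpow (normr_ge0 r) (aff_gt0 r1) p.
rewrite -enorm_re in H; have [H1 _] := taylor2_sphere_fun H.
by move: H1; under eq_fun do rewrite affpow_kbase.
Qed.

Lemma kbase_powS (t r p : R) : 0 < kbase t r -> kbase t r `^ (p + 1) = kbase t r * kbase t r `^ p.
Proof.
move=> D0; rewrite powRD; last by apply/implyP => _; rewrite gt_eqF.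
by rewrite (powRr1 (ltW D0)) mulrC.
Qed.

Let kb_gt0 v r : `|r| < 1 -> enorm v = 1 -> 0 < kbase (dotr e v) r.
Proof.
move=> r1 v1; have /andP[+ _] := kbase_ge r1 (lexx _) (dot_le1 v1).
by apply: lt_le_trans; rewrite exprn_gt0// subr_gt0.
Qed.

(** This is [zonal_by_parts] for y = r e and g = [affpow]. Writing D for the base, y.v = (1 + r^2 -
    D) / 2, and 4 ((y.v)^2 - r^2) = (1 - r^2)^2 - 2 (1 + r^2) D + D^2 produces the neighbouring
    exponents. *)
Lemma radial_rec r p : `|r| < 1 ->
  (d%:R - 1) * ((1 + r ^+ 2) * radial e p r - radial e (p + 1) r) =
  p * ((1 - r ^+ 2) ^+ 2 * radial e (p - 1) r - 2 * (1 + r ^+ 2) * radial e p r +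
       radial e (p + 1) r).
Proof.
move=> r1; have H := taylor2_affpow (normr_ge0 r) (aff_gt0 r1) p.
rewrite -enorm_re in H; have := zonal_by_parts d_gt1 H.
have S q := @sphere_fun_kbase r q r1.
rewrite (@sphere_int_ext _ _ d_gt0 _ (fun v =>
  2^-1 * ((d%:R - 1) * ((1 + r ^+ 2) * kbase (dotr e v) r `^ p - kbase (dotr e v) r `^ (p + 1)) -
  p * ((1 - r ^+ 2) ^+ 2 * kbase (dotr e v) r `^ (p - 1)
       - 2 * (1 + r ^+ 2) * kbase (dotr e v) r `^ p + kbase (dotr e v) r `^ (p + 1))))); last 2 first.
- by sfun.
- move=> v v1; rewrite !affpow_kbase !dotrZ enorm_re real_normK ?num_real//.
  have D0 := kb_gt0 r1 v1.
  have Ep : kbase (dotr e v) r `^ p = kbase (dotr e v) r * kbase (dotr e v) r `^ (p - 1).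
    by rewrite -kbase_powS// subrK.
  rewrite kbase_powS// Ep; set P := kbase _ _ `^ _; rewrite /kbase.
  by field.
rewrite sphere_intZ; last by sfun.
rewrite sphere_intB; [|by sfun..].
rewrite !sphere_intZ; [|by sfun..].
rewrite sphere_intB; [|by sfun..].
rewrite sphere_intD; [|by sfun..].
rewrite sphere_intB; [|by sfun..].
rewrite !sphere_intZ; [|by sfun..].
rewrite -!/(radial _ _ _) => /eqP; rewrite mulf_eq0 invr_eq0 pnatr_eq0/= subr_eq0.
by move/eqP.
Qed.

(** Because 2 r (r - t) = D - (1 - r^2) for the base D, multiplying the derivative by r expresses it
    again through radial integrals. *)
Lemma radial_derive (r p : R) : `|r| < 1 -> exists2 l,
  is_derive r 1 (radial e p) l &
  r * l = p * (radial e p r - (1 - r ^+ 2) * radial e (p - 1) r).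
Proof.
(* The midpoint of |r| and 1 leaves room for increments of r inside a disc on which the Taylor bound
   is uniform. *)
move=> r1; pose a := (1 + `|r|) / 2.
have ra : `|r| < a by rewrite /a ltr_pdivlMr// mulr_natr mulr2n ltrD2r.
have a1 : a < 1 by rewrite /a ltr_pdivrMr// mul1r -[2]/(1 + 1) ltrD2l.
have a0 : 0 <= a by exact: le_trans (ltW ra).
have [B B0 HB] := kbase_pow_taylor p a0 a1.
have S q := @sphere_fun_kbase r q r1.
pose l v := p * (2 * (r - dotr e v)) * kbase (dotr e v) r `^ (p - 1).
have Sl : sphere_fun l by rewrite /l; sfun.
exists (m l).
  apply: (@is_derive_quad _ _ _ _ (B * area) (a - `|r|)); first by rewrite subr_gt0.
  move=> u ur; have rua : `|r + u| < a.
    by rewrite (le_lt_trans (ler_normD _ _))// addrC -ltrBrDr.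
  have S' := sphere_fun_kbase p (lt_trans rua a1).
  rewrite /radial -sphere_intZ// -!sphere_intB; [|by sfun..].
  rewrite mulrAC; apply: (sphere_int_norm_le d_gt0); first by sfun.
  move=> v v1; have := HB _ _ _ (dot_le1 v1) (ltW ra) (ltW rua).
  rewrite (_ : r + u - r = u); last by ring.
  by rewrite [u * l v]mulrC.
rewrite /radial -!sphere_intZ; [|by sfun..].
rewrite -sphere_intB; [|by sfun..].
rewrite -sphere_intZ; [|by sfun..].
apply: (sphere_int_ext d_gt0); first by sfun.
move=> v v1; have D0 := kb_gt0 r1 v1.
have Ep : kbase (dotr e v) r `^ p = kbase (dotr e v) r * kbase (dotr e v) r `^ (p - 1).
  by rewrite -kbase_powS// subrK.
by rewrite Ep /l; set P := kbase _ _ `^ _; rewrite /kbase; ring.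
Qed.

(** [X] integrates the Newtonian potential |r e - v|^(2-d) and [Y] the Poisson kernel. Their
    exponents differ by one, so recurrence and derivative close into a linear system of two
    equations. *)
Let X := radial e (1 - d%:R / 2).
Let Y (r : R) : R := (1 - r ^+ 2) * radial e (- (d%:R / 2)) r.

Let Xderive (r : R) : `|r| < 1 -> exists2 l, is_derive r 1 X l &
  r * l = (d%:R / 2 - 1) * (Y r - X r).
Proof.
move=> /(radial_derive (1 - d%:R / 2))[l Hl E]; exists l => //.
by rewrite E /X /Y (_ : 1 - _ - 1 = - (d%:R / 2)); [ring|ring].
Qed.

Let Yderive (r : R) : `|r| < 1 -> exists2 l, is_derive r 1 Y l &
  r * l = (d%:R / 2 - 1) * (X r - Y r).
Proof.
move=> r1; have [l Hl E] := radial_derive (- (d%:R / 2)) r1.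
exists ((1 - r ^+ 2) * l + radial e (- (d%:R / 2)) r * (- 2 * r)).
  have dq : is_derive r 1 (fun r : R => 1 - r ^+ 2) (- 2 * r).
    apply: (@is_derive_quad _ _ _ _ 1 1) => // u _.
    rewrite (_ : _ - _ - _ = - (1 * u ^+ 2)); last by ring.
    by rewrite normrN ger0_norm// mul1r sqr_ge0.
  have H := is_deriveM dq Hl.
  by apply: (is_derive_eq H).
(* The recurrence at p = -d/2 eliminates the integral with exponent -d/2 - 1 that differentiating
   [Y] brings in. *)
have rec := radial_rec (- (d%:R / 2)) r1.
rewrite [- _ + 1]addrC in rec.
rewrite mulrDr mulrCA E /X /Y.
set J := radial e (- _) r in E rec *; set J1 := radial e (- _ - 1) r in E rec *.
set X0 := radial e (1 - _) r in rec *.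
have -> : (1 - r ^+ 2) * (- (d%:R / 2) * (J - (1 - r ^+ 2) * J1)) =
  - (d%:R / 2) * (1 - r ^+ 2) * J -
  (- (d%:R / 2)) * ((1 - r ^+ 2) ^+ 2 * J1 - 2 * (1 + r ^+ 2) * J + X0)
  + (d%:R / 2) * (2 * (1 + r ^+ 2) * J - X0) by ring.
by rewrite -rec; field.
Qed.

Let radial0 p : radial e p 0 = area.
Proof.
rewrite /radial; congr m; apply/funext => v.
by rewrite /kbase expr0n/= addr0 mul0r mulr0 subr0 powR1.
Qed.

(** The equation u l = 0 says nothing about l at u = 0, but the mean value theorem picks an interior
    point; at 0 only continuity is used. *)
Let cst_on (F : R -> R) (r : R) : 0 < r -> r < 1 ->
  (forall u : R, 0 <= u -> u < 1 -> exists2 l, is_derive u 1 F l & u * l = 0) ->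
  F r = F 0.
Proof.
move=> r0 r1 HF.
have HF' (u : R) : exists l : R, 0 <= u -> u < 1 -> is_derive u 1 F l /\ u * l = 0.
  have [u0|u0] := leP 0 u; last by exists 0.
  have [u1|u1] := ltP u 1; last by exists 0.
  by have [l ? ?] := HF u u0 u1; exists l.
have [df Hdf] := choice HF'.
have [||c /[!in_itv]/=/andP[c0 cr] E] := @MVT R F df 0 r r0.
- move=> u; rewrite in_itv/= => /andP[u0 ur].
  by have [] := Hdf u (ltW u0) (lt_trans ur r1).
- apply: derivable_within_continuous => u; rewrite in_itv/= => /andP[u0 ur].
  have [H _] := Hdf u u0 (le_lt_trans ur r1); exact: ex_derive.
have [_ /eqP] := Hdf c (ltW c0) (lt_trans cr r1).
rewrite mulf_eq0 (gt_eqF c0)/= => /eqP dc.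
by move/eqP: E; rewrite dc mul0r subr_eq0 => /eqP.
Qed.

(* As r X' = s (Y - X) and r Y' = s (X - Y) with s = d/2 - 1, both X + Y and
   r^(d-2) (Y - X) are constant. *)
Lemma radial_const r : 0 <= r -> r < 1 -> X r = area /\ Y r = area.
Proof.
move=> r0 r1; have X0 : X 0 = area by exact: radial0.
have Y0 : Y 0 = area by rewrite /Y radial0 expr0n subr0 mul1r.
have [->//|rn0] := eqVneq r 0.
have {r0 rn0} r0 : 0 < r by rewrite lt_neqAle eq_sym rn0.
have sum : X r + Y r = X 0 + Y 0.
  apply: (@cst_on (fun r => X r + Y r)) => // u u0 u1.
  have u1' : `|u| < 1 by rewrite ger0_norm.
  have [l1 H1 E1] := Xderive u1'; have [l2 H2 E2] := Yderive u1'.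
  exists (l1 + l2); first exact: is_deriveD.
  by rewrite mulrDr E1 E2; ring.
have dif : r ^+ (d - 2) * (Y r - X r) = 0 ^+ (d - 2) * (Y 0 - X 0).
  apply: (@cst_on (fun r => r ^+ (d - 2) * (Y r - X r))) => // u u0 u1.
  have u1' : `|u| < 1 by rewrite ger0_norm.
  have [l1 H1 E1] := Xderive u1'; have [l2 H2 E2] := Yderive u1'.
  have dn : is_derive u 1 (fun r : R => r ^+ (d - 2)) ((d - 2)%:R * u ^+ (d - 2).-1 *: 1).
    have := is_deriveX (d - 2) (is_derive_id u (1 : R)); rewrite exprfctE; exact.
  have H := is_deriveM dn (is_deriveB H2 H1).
  eexists; first exact: H.
  rewrite /GRing.scale/= mulr1.
  have -> : u * (u ^+ (d - 2) * (l2 - l1) + (Y u - X u) * ((d - 2)%:R * u ^+ (d - 2).-1)) =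
    u ^+ (d - 2) * (u * l2 - u * l1) + (d - 2)%:R * (u * u ^+ (d - 2).-1) * (Y u - X u) by ring.
  (* For d = 2 the exponent is 0 and its predecessor is truncated; then s = d/2 - 1 vanishes too and
     every term is zero. *)
  rewrite E1 E2; case: (posnP (d - 2)) => [d2|d2].
    have -> : d%:R = 2 :> R.
      by move/eqP: d2; rewrite subn_eq0 => d2; have -> : d = 2%N by apply/eqP; rewrite eqn_leq d2.
    by rewrite d2 divff ?pnatr_eq0// !subrr; ring.
  by rewrite -exprS prednK// natrB//; field.
move: dif; rewrite X0 Y0 subrr mulr0 => /eqP; rewrite mulf_eq0 expf_eq0 (gt_eqF r0) andbF/=.
rewrite subr_eq0 => /eqP YX.
have Xa : X r = area by move: sum; rewrite YX X0 Y0; set x := X r; lra.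
by rewrite YX Xa.
Qed.

End Unit.

Section Moments.
Variable y : 'rV[R]_d.
Hypothesis y1 : enorm y < 1.

Definition poisson v : R :=
  (1 - enorm y ^+ 2) * affpow (1 + enorm y ^+ 2) (- (d%:R / 2)) (dotr y v).

Let r := enorm y.
Let r0 : 0 <= r := enorm_ge0 y.

(** The case y = 0 is separate throughout: there is no direction e, and the zonal lemmas divide by
    |y|. *)
Let poisson0 : r = 0 -> forall v, poisson v = 1.
Proof.
move=> y0 v; rewrite /poisson -/r y0.
have -> : y = 0 by apply/eqP; rewrite -enorm0 -/r y0.
rewrite (_ : dotr 0 v = 0); last first.
  by rewrite /dotr big1// => k _; rewrite mxE mul0r.
by rewrite /affpow expr0n mulr0 !subr0 addr0 powR1 mulr1.
Qed.

Let e := r^-1 *: y.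

Let c2r : 0 < 1 + r ^+ 2 - 2 * r.
Proof.
rewrite (_ : _ - _ = (1 - r) ^+ 2); last by ring.
by rewrite exprn_gt0// subr_gt0.
Qed.

Let T q := taylor2_affpow r0 c2r q.

Let zJ q := m (fun v => affpow (1 + r ^+ 2) q (dotr y v)).

Let Sq q : sphere_fun (fun v => affpow (1 + r ^+ 2) q (dotr y v)).
Proof. by have [] := taylor2_sphere_fun (T q). Qed.

Lemma sphere_fun_poisson : sphere_fun poisson.
Proof. by apply: sphere_funM; [exact: sphere_fun_cst|exact: Sq]. Qed.

Let zJE q : r != 0 -> zJ q = radial e q r.
Proof.
move=> rn0; rewrite /zJ /radial; congr m; apply/funext => v.
by rewrite -affpow_kbase /e scalerA divff// scale1r.
Qed.

Let e1 : r != 0 -> enorm e = 1.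
Proof. by move=> rn0; apply: enorm_unit; rewrite -enorm0. Qed.

Let zJ1 : r != 0 -> zJ (1 - d%:R / 2) = area.
Proof. by move=> rn0; rewrite zJE//; have [] := radial_const (e1 rn0) r0 y1. Qed.

Let zJ0 : r != 0 -> (1 - r ^+ 2) * zJ (- (d%:R / 2)) = area.
Proof. by move=> rn0; rewrite zJE//; have [] := radial_const (e1 rn0) r0 y1. Qed.

Lemma poisson_moment0 : m poisson = area.
Proof.
have [rE|rn0] := eqVneq r 0.
  by congr m; apply/funext => v; rewrite poisson0.
by rewrite /poisson sphere_intZ// zJ0.
Qed.

Let affpowS v q : enorm v = 1 -> affpow (1 + r ^+ 2) (q + 1) (dotr y v) =
  (1 + r ^+ 2 - 2 * dotr y v) * affpow (1 + r ^+ 2) q (dotr y v).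
Proof.
move=> v1; rewrite /affpow powRD; last first.
  apply/implyP => _; rewrite gt_eqF// (lt_le_trans c2r)// lerB// ler_wpM2l//.
  by have := dotr_le y v; rewrite v1 mulr1; apply: le_trans; exact: ler_norm.
rewrite powRr1 1?mulrC// subr_ge0.
have : dotr y v <= r by have := dotr_le y v; rewrite v1 mulr1; apply: le_trans; exact: ler_norm.
have := c2r; set t := dotr y v; lra.
Qed.

Let tD v q : enorm v = 1 -> dotr y v * affpow (1 + r ^+ 2) q (dotr y v) =
  2^-1 * ((1 + r ^+ 2) * affpow (1 + r ^+ 2) q (dotr y v) -
          affpow (1 + r ^+ 2) (q + 1) (dotr y v)).
Proof. by move=> v1; rewrite affpowS//; field. Qed.

(** The moment vector is parallel to y, so only the integral of (y.v) P is required. As y.v is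
    affine in |y - v|^2, it reduces to the two known integrals with exponents -d/2 and 1 - d/2. *)
Lemma poisson_moment1 i : m (fun v => v ord0 i * poisson v) = y ord0 i * area.
Proof.
have [rE|rn0] := eqVneq r 0.
  have -> : y = 0 by apply/eqP; rewrite -enorm0 -/r rE.
  rewrite mxE mul0r -[RHS](sphere_moment1 R d_gt1 i).
  by congr m; apply/funext => v; rewrite poisson0// mulr1.
have [G HG] := affpow_primitive r0 c2r (- (d%:R / 2)).
have H := zonal_moment1 d_gt1 i HG.
have r20 : r ^+ 2 != 0 by rewrite expf_neq0.
have E : m (fun v => v ord0 i * poisson v) = (1 - r ^+ 2) *
    zmom1 y (affpow (1 + r ^+ 2) (- (d%:R / 2))) i.
  rewrite /zmom1 -sphere_intZ; last by sfun; exact: Sq.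
  by congr m; apply/funext => v; rewrite /poisson mulrCA.
apply: (mulfI r20); rewrite E mulrCA H mulrCA [RHS]mulrCA; congr (_ * _).
rewrite (@sphere_int_ext _ _ d_gt0 _ (fun v => 2^-1 * ((1 + r ^+ 2) *
  affpow (1 + r ^+ 2) (- (d%:R / 2)) (dotr y v) -
  affpow (1 + r ^+ 2) (1 - d%:R / 2) (dotr y v)))); last 2 first.
- by have S0 := Sq (- (d%:R / 2)); have S1 := Sq (1 - d%:R / 2); sfun.
- by move=> v v1; rewrite tD// [- _ + 1]addrC.
have S0 := Sq (- (d%:R / 2)); have S1 := Sq (1 - d%:R / 2).
rewrite sphere_intZ; last by sfun.
rewrite sphere_intB; [|by sfun..].
rewrite sphere_intZ// -/(zJ _) -/(zJ _) zJ1//.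
have {2}<- := zJ0 rn0; have := zJ0 rn0 => <-.
by field.
Qed.

(** The recurrence at p = 1 - d/2 links this exponent to the two already evaluated. *)
Let zJ2 : r != 0 -> d%:R * zJ (2 - d%:R / 2) =
  area * (d%:R + (4 - d%:R) * r ^+ 2).
Proof.
move=> rn0; have rr : `|r| < 1 by rewrite ger0_norm.
have := radial_rec (e1 rn0) (1 - d%:R / 2) rr.
rewrite -!zJE// zJ1// (_ : 1 - d%:R / 2 + 1 = 2 - d%:R / 2); last by ring.
rewrite (_ : 1 - d%:R / 2 - 1 = - (d%:R / 2)); last by ring.
rewrite (_ : (1 - r ^+ 2) ^+ 2 * _ = (1 - r ^+ 2) * area); last first.
  by rewrite -(zJ0 rn0); ring.
by set z := zJ _; lra.
Qed.

(** [zonal_moment2] leaves two unknowns a and b. The trace (where |v| = 1) and the value of the form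
    at y, which brings in the exponent 2 - d/2, give two equations; their elimination divides by d -
    1. *)
Lemma poisson_moment2 i l : m (fun v => v ord0 i * v ord0 l * poisson v) =
  area * ((1 - enorm y ^+ 2) / d%:R * (i == l)%:R + y ord0 i * y ord0 l).
Proof.
have d0 : d%:R != 0 :> R by rewrite pnatr_eq0 -lt0n.
have [rE|rn0] := eqVneq r 0.
  have y0 : y = 0 by apply/eqP; rewrite -enorm0 -/r rE.
  rewrite -/r rE y0 !mxE mul0r addr0 expr0n subr0.
  transitivity (m (fun v => v ord0 i * v ord0 l)).
    by congr m; apply/funext => v; rewrite poisson0// mulr1.
  by rewrite sphere_moment2//; ring.
have [G1 [G2 [H1 H2]]] := affpow_primitive2 r0 c2r (- (d%:R / 2)).
have [a [b Hab]] := zonal_moment2 d_gt1 rn0 H1 H2.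
have S0 := Sq (- (d%:R / 2)); have S1 := Sq (1 - d%:R / 2).
have S2 := Sq (2 - d%:R / 2).
pose P := affpow (1 + r ^+ 2) (- (d%:R / 2)).
have tr : a * d%:R + b * r ^+ 2 = zJ (- (d%:R / 2)).
  transitivity (\sum_k zmom2 y P k k).
    under eq_bigr do rewrite Hab eqxx mulr1.
    rewrite big_split/= sumr_const card_ord -mulr_sumr /r enorm_sqr.
    by rewrite -[a *+ d]mulr_natr; congr (_ + b * _).
  rewrite /zmom2 -sphere_int_sum; last by move=> k; sfun.
  apply: (sphere_int_ext d_gt0) => // v v1.
  by rewrite -mulr_suml enorm1_sumM// mul1r.
have qf : a * r ^+ 2 + b * r ^+ 4 = m (fun v => dotr y v ^+ 2 * P (dotr y v)).
  transitivity (\sum_k \sum_n y ord0 k * y ord0 n * zmom2 y P k n).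
    under eq_bigr do under eq_bigr do rewrite Hab mulrDr.
    under eq_bigr do rewrite big_split/=.
    rewrite big_split/=; congr (_ + _).
      rewrite /r enorm_sqr mulr_sumr; apply: eq_bigr => k _.
      rewrite (bigD1 k)//= eqxx/= mulr1 big1 ?addr0; first by ring.
      by move=> n nk; rewrite eq_sym (negbTE nk) !mulr0.
    rewrite (_ : r ^+ 4 = r ^+ 2 * r ^+ 2); last by ring.
    rewrite /r enorm_sqr mulr_suml mulr_sumr; apply: eq_bigr => k _.
    by rewrite !mulr_sumr; apply: eq_bigr => n _; ring.
  have Sz k n : sphere_fun (fun v => y ord0 k * y ord0 n * (v ord0 k * v ord0 n * P (dotr y v))).
    by sfun.
  transitivity (m (fun v => \sum_k \sum_n y ord0 k * y ord0 n * (v ord0 k * v ord0 n * P (dotr y v)))).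
    rewrite sphere_int_sum; last by move=> k; exact: sphere_fun_sum.
    apply: eq_bigr => k _; rewrite sphere_int_sum//.
    by apply: eq_bigr => n _; rewrite sphere_intZ//; sfun.
  congr m; apply/funext => v; rewrite expr2 {1 2}/dotr !mulr_suml.
  apply: eq_bigr => k _; rewrite mulrAC mulr_sumr.
  by apply: eq_bigr => n _; ring.
have qE : 4 * m (fun v => dotr y v ^+ 2 * P (dotr y v)) =
    (1 + r ^+ 2) ^+ 2 * zJ (- (d%:R / 2)) - 2 * (1 + r ^+ 2) * zJ (1 - d%:R / 2) + zJ (2 - d%:R / 2).
  rewrite /zJ -!sphere_intZ; [|by sfun..].
  rewrite -sphere_intB; [|by sfun..].
  rewrite -sphere_intD; [|by sfun..].
  apply: (sphere_int_ext d_gt0) => [|v v1]; first by sfun.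
  rewrite (_ : 2 - d%:R / 2 = (1 - d%:R / 2) + 1); last by ring.
  rewrite (_ : 1 - d%:R / 2 = - (d%:R / 2) + 1); last by ring.
  by rewrite !affpowS// /P; ring.
have E : m (fun v => v ord0 i * v ord0 l * poisson v) = (1 - r ^+ 2) * zmom2 y P i l.
  rewrite /zmom2 -sphere_intZ; last by sfun.
  by congr m; apply/funext => v; rewrite /poisson mulrCA.
rewrite E Hab -/r.
have q0 := zJ0 rn0; have q2 := zJ2 rn0.
rewrite zJ1// in qE; rewrite -qf in qE.
set z := zJ (- _) in tr qE q0; set z2 := zJ (2 - _) in qE q2.
have r20 : r ^+ 2 != 0 by rewrite expf_neq0.
have d1 : d%:R - 1 != 0 :> R by rewrite subr_eq0 pnatr_eq1 gtn_eqF.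
suff [Ha Hb] : (1 - r ^+ 2) * a = area * ((1 - r ^+ 2) / d%:R) /\ (1 - r ^+ 2) * b = area.
  by rewrite mulrDr !mulrA Ha Hb; ring.
have h1 : (1 - r ^+ 2) * a * d%:R + (1 - r ^+ 2) * b * r ^+ 2 = area.
  by rewrite -q0 -tr; ring.
have h2 : ((1 - r ^+ 2) * a + (1 - r ^+ 2) * b * r ^+ 2) * d%:R =
    area * (1 + r ^+ 2 * (d%:R - 1)).
  have r40 : 4 * r ^+ 2 != 0 :> R by rewrite mulf_neq0// pnatr_eq0.
  apply: (mulfI r40).
  transitivity (d%:R * (1 - r ^+ 2) * (4 * (a * r ^+ 2 + b * r ^+ 4))); first by ring.
  rewrite qE; transitivity (d%:R * (1 + r ^+ 2) ^+ 2 * ((1 - r ^+ 2) * z) -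
    2 * d%:R * (1 + r ^+ 2) * (1 - r ^+ 2) * area + (1 - r ^+ 2) * (d%:R * z2)); first by ring.
  by rewrite q0 q2; ring.
set al := (1 - r ^+ 2) * a in h1 h2 *; set be := (1 - r ^+ 2) * b in h1 h2 *.
have Ha : al * d%:R = area * (1 - r ^+ 2).
  apply: (mulfI d1); transitivity ((al * d%:R + be * r ^+ 2) * d%:R -
    (al + be * r ^+ 2) * d%:R); first by ring.
  by rewrite h1 h2; ring.
split; first by rewrite mulrA -Ha mulfK.
apply: (mulIf r20); apply: (addrI (al * d%:R)); rewrite h1 Ha; ring.
Qed.

End Moments.

End Poisson.

(** * Bounded random variables *)

Section BoundedExpectation.
Context d0 (T : measurableType d0) (R : realType) (P : probability T R).
Implicit Types (X Y Z : T -> R).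

(** Bounded everywhere and not just almost surely, so that sums and products are integrable at once.
    The sample enters this class through truncated coordinates. *)
Definition brv X : Prop :=
  measurable_fun setT X /\ exists C, forall w, `|X w| <= C.

Definition Ex X : R := \int[P]_(w in setT) X w.

Lemma brv_integrable X : brv X -> P.-integrable setT (EFin \o X).
Proof.
move=> [mX [C HC]]; apply: measurable_bounded_integrable => //.
  by rewrite (le_lt_trans (probability_le1 P _))// ltry.
exists C; split; first exact: num_real.
by move=> x Cx w _ /=; rewrite (le_trans (HC w))// ltW.
Qed.

Lemma ExE X : brv X -> 'E_P[X]%E = (Ex X)%:E.
Proof.
move=> /brv_integrable iX; rewrite unlock /Ex /Rintegral fineK//.
exact: integrable_fin_num.
Qed.

Lemma brv_cst c : brv (fun=> c).
Proof. by split; [exact: measurable_cst|exists `|c|]. Qed.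

Lemma brvD X Y : brv X -> brv Y -> brv (fun w => X w + Y w).
Proof.
move=> [mX [C HC]] [mY [D HD]]; split; first exact: measurable_funD.
by exists (C + D) => w; rewrite (le_trans (ler_normD _ _))// lerD.
Qed.

Lemma brvM X Y : brv X -> brv Y -> brv (fun w => X w * Y w).
Proof.
move=> [mX [C HC]] [mY [D HD]]; split; first exact: measurable_funM.
by exists (C * D) => w; rewrite normrM ler_pM.
Qed.

Lemma brvN X : brv X -> brv (fun w => - X w).
Proof.
move=> HX; under eq_fun do rewrite -mulN1r.
by apply: brvM => //; exact: brv_cst.
Qed.

Lemma brvB X Y : brv X -> brv Y -> brv (fun w => X w - Y w).
Proof. by move=> HX HY; apply: brvD => //; exact: brvN. Qed.

Lemma brv_sum (I : Type) (s : seq I) (F : I -> T -> R) :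
  (forall i, brv (F i)) -> brv (fun w => \sum_(i <- s) F i w).
Proof.
move=> HF; elim: s => [|i s IH].
  by under eq_fun do rewrite big_nil; exact: brv_cst.
by under eq_fun do rewrite big_cons; exact: brvD.
Qed.

Lemma brv_comp (h : R -> R) X C : measurable_fun setT h -> measurable_fun setT X ->
  (forall x, `|h x| <= C) -> brv (fun w => h (X w)).
Proof.
move=> mh mX hC; split; first exact: (measurableT_comp mh mX).
by exists C => w.
Qed.

Lemma ExD X Y : brv X -> brv Y -> Ex (fun w => X w + Y w) = Ex X + Ex Y.
Proof. by move=> /brv_integrable iX /brv_integrable iY; exact: RintegralD. Qed.

Lemma ExZ a X : brv X -> Ex (fun w => a * X w) = a * Ex X.
Proof. by move=> /brv_integrable iX; exact: RintegralZl. Qed.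

Lemma ExB X Y : brv X -> brv Y -> Ex (fun w => X w - Y w) = Ex X - Ex Y.
Proof. by move=> /brv_integrable iX /brv_integrable iY; exact: RintegralB. Qed.

Lemma Ex_cst c : Ex (fun=> c) = c.
Proof. by rewrite /Ex Rintegral_cst//; have /= -> := probability_setT P; rewrite mulr1. Qed.

Lemma Ex_sum (I : Type) (s : seq I) (F : I -> T -> R) :
  (forall i, brv (F i)) ->
  Ex (fun w => \sum_(i <- s) F i w) = \sum_(i <- s) Ex (F i).
Proof.
move=> HF; elim: s => [|i s IH].
  rewrite big_nil -[RHS](Ex_cst 0); congr Ex; apply/funext => w.
  by rewrite big_nil.
rewrite big_cons -IH -ExD//; last exact: brv_sum.
by congr Ex; apply/funext => w; rewrite big_cons.
Qed.

Lemma le_Ex X Y : brv X -> brv Y -> (forall w, X w <= Y w) -> Ex X <= Ex Y.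
Proof. by move=> /brv_integrable iX /brv_integrable iY XY; apply: le_Rintegral. Qed.

Lemma Ex_norm_le X C : brv X -> (forall w, `|X w| <= C) -> `|Ex X| <= C.
Proof.
move=> HX HC; rewrite ler_norml -[- C]Ex_cst -[X in _ && (_ <= X)]Ex_cst.
apply/andP; split; apply: le_Ex => // [|w]; try exact: brv_cst.
  by have := HC w; rewrite ler_norml => /andP[].
by have := HC w; rewrite ler_norml => /andP[].
Qed.

Lemma brv_indic (A : set T) : measurable A -> brv (\1_A).
Proof.
move=> mA; split; first exact: measurable_indic.
by exists 1 => w; rewrite indicE; case: (_ \in _); rewrite ?normr1 ?normr0.
Qed.

Lemma Ex_indic (A : set T) : measurable A -> Ex (\1_A) = fine (P A).
Proof. by move=> mA; rewrite /Ex /Rintegral integral_indic// setIT. Qed.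

(** The sum counts the positive integers up to z, so it is the integer part of z. *)
Lemma layer_count N (z : R) : 0 <= z <= N%:R ->
  z - 1 <= \sum_(k < N) (if k.+1%:R <= z then 1 else 0) <= z.
Proof.
elim: N z => [|N IH] z.
  move=> /andP[z0 z1]; have -> : z = 0 by apply/eqP; rewrite eq_le z0 z1.
  by rewrite big_ord0 sub0r lexx oppr_le0 ler01.
move=> /andP[z0 zN]; rewrite big_ord_recr/=.
have [zN'|zN'] := leP z N%:R.
  rewrite ifF ?addr0; first by apply: IH; rewrite z0.
  by apply/negbTE; rewrite -ltNge (le_lt_trans zN')// ltr_nat.
have -> : \sum_(k < N) (if k.+1%:R <= z then 1 else 0 : R) = N%:R.
  rewrite (eq_bigr (fun=> 1)) ?sumr_const ?card_ord// => k _.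
  by rewrite ifT// (le_trans _ (ltW zN'))// ler_nat.
case: ifP => [Nz|/negbT]; first by rewrite -natr1 in zN Nz *; lra.
by rewrite -ltNge -natr1 in zN *; lra.
Qed.

(* Layer-cake: a bounded variable is a uniform limit of combinations of the
   indicators of its superlevel sets. *)
Lemma Ex_mul_of_levels Z X (kappa : R) : brv Z -> brv X ->
  (forall a, Ex (fun w => Z w * \1_[set w | a <= X w] w) =
             kappa * fine (P [set w | a <= X w])) ->
  Ex (fun w => Z w * X w) = kappa * Ex X.
Proof.
move=> HZ HX Hlev.
have [mX [M0 HM0]] := HX; have [mZ [C0 HC0]] := HZ.
pose M := M0 + 1; have M00 : 0 <= M0 by exact: le_trans (normr_ge0 _) (HM0 point).
have C00 : 0 <= C0 by exact: le_trans (normr_ge0 _) (HC0 point).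
have M_gt0 : 0 < M by rewrite ltr_wpDl.
pose Y w := (X w + M) / (2 * M).
have M20 : 2 * M != 0 by rewrite mulf_neq0// gt_eqF.
have HY : brv Y by apply: brvM; [apply: brvD => //|]; exact: brv_cst.
have Y01 w : 0 <= Y w <= 1.
  have := HM0 w; rewrite ler_norml => /andP[X1 X2].
  rewrite /Y; apply/andP; split.
    by apply: divr_ge0; [rewrite /M; lra|rewrite mulr_ge0// ltW].
  by rewrite ler_pdivrMr ?mulr_gt0// mul1r /M; lra.
have mlev a : measurable [set w | a <= X w].
  by rewrite -[X in measurable X]setTI; apply: (measurable_fun_ler (measurable_cst a) mX) => //.
have XE : X = fun w => 2 * M * Y w - M.
  by apply/funext => w; rewrite /Y; field; rewrite gt_eqF.
(* The superlevel set at -M0 is the whole space, which identifies kappa. *)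
have EZ : Ex Z = kappa.
  have := Hlev (- M0).
  have -> : [set w | - M0 <= X w] = setT.
    by apply/seteqP; split => // w _ /=; have := HM0 w; rewrite ler_norml => /andP[].
  have /= -> := probability_setT P; rewrite mulr1 => <-; congr Ex; apply/funext => w.
  by rewrite indicE in_setT mulr1.
have lev N (k : 'I_N) w : (if k.+1%:R <= N%:R * Y w then 1 else 0 : R) =
    \1_[set w | k.+1%:R / N%:R * (2 * M) - M <= X w] w.
  have N0 : 0 < N%:R :> R by rewrite ltr0n (leq_ltn_trans _ (ltn_ord k)).
  have E : (k.+1%:R / N%:R * (2 * M) - M <= X w) = (k.+1%:R <= N%:R * Y w).
    by rewrite lerBlDr -ler_pdivlMr ?mulr_gt0// -/(Y w) ler_pdivrMr// mulrC.
  by rewrite indicE; case: ifP => H; [rewrite mem_set//= E|rewrite memNset//= E H].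
(* [S N] is the integer part of N Y: a sum of indicators of superlevel sets of X, at distance at
   most 1 from N Y. *)
pose S N w : R := \sum_(k < N) (if k.+1%:R <= N%:R * Y w then 1 else 0).
have SE N : S N = fun w => \sum_(k < N) \1_[set w | k.+1%:R / N%:R * (2 * M) - M <= X w] w.
  by apply/funext => w; apply: eq_bigr => k _; exact: lev.
have bS N : brv (S N).
  by rewrite SE; apply: brv_sum => k; apply: brv_indic.
have ES N : Ex (fun w => Z w * S N w) = kappa * Ex (S N).
  rewrite SE Ex_sum; last by move=> k; exact: brv_indic.
  rewrite mulr_sumr -[LHS]/(Ex _).
  transitivity (Ex (fun w => \sum_(k < N) (Z w * \1_[set w | k.+1%:R / N%:R * (2 * M) - M <= X w] w))).
    by congr Ex; apply/funext => w; rewrite mulr_sumr.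
  rewrite Ex_sum; last by move=> k; apply: brvM => //; exact: brv_indic.
  by apply: eq_bigr => k _; rewrite Hlev Ex_indic.
suff EY : Ex (fun w => Z w * Y w) = kappa * Ex Y.
  have bZY : brv (fun w => Z w * Y w) by exact: brvM.
  have b2 W : brv W -> brv (fun w => 2 * M * W w).
    by move=> HW; apply: brvM => //; exact: brv_cst.
  rewrite XE (_ : (fun w => Z w * _) = (fun w => 2 * M * (Z w * Y w) - M * Z w)); last first.
    by apply/funext => w; ring.
  rewrite ExB; [|exact: b2|by apply: brvM => //; exact: brv_cst].
  rewrite [in RHS]ExB; [|exact: b2|exact: brv_cst].
  by rewrite !ExZ// Ex_cst EY EZ; ring.
have HN N : (0 < N)%N -> `|Ex (fun w => Z w * Y w) - kappa * Ex Y| <= (C0 + `|kappa|) / N%:R.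
  move=> N0; have N0' : 0 < N%:R :> R by rewrite ltr0n.
  have near w : `|N%:R * Y w - S N w| <= 1.
    have /andP[Y0 Y1] := Y01 w.
    have /andP[A1 A2] := @layer_count N (N%:R * Y w) (introT andP (conj (mulr_ge0 (ltW N0') Y0) (ler_piMr (ltW N0') Y1))).
    by rewrite ger0_norm ?subr_ge0// lerBlDr -lerBlDl.
  rewrite ler_pdivlMr// -[N%:R in X in X <= _](ger0_norm (ltW N0')) -normrM mulrC.
  rewrite (_ : N%:R * _ = Ex (fun w => Z w * (N%:R * Y w - S N w)) -
      kappa * Ex (fun w => N%:R * Y w - S N w)); last first.
    have bN W : brv W -> brv (fun w => N%:R * W w).
      by move=> HW; apply: brvM => //; exact: brv_cst.
    have bZY : brv (fun w => Z w * Y w) by exact: brvM.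
    have -> : Ex (fun w => Z w * (N%:R * Y w - S N w)) =
        N%:R * Ex (fun w => Z w * Y w) - kappa * Ex (S N).
      rewrite -ES -ExZ// -ExB; [|exact: bN|exact: brvM].
      by congr Ex; apply/funext => w; ring.
    rewrite ExB//; last exact: bN.
    by rewrite ExZ//; ring.
  have bD : brv (fun w => N%:R * Y w - S N w).
    by apply: brvB => //; apply: brvM => //; exact: brv_cst.
  rewrite (le_trans (ler_normB _ _))// lerD//.
    apply: Ex_norm_le; first exact: brvM.
    by move=> w; rewrite normrM -[leRHS]mulr1 ler_pM.
  rewrite normrM -[leRHS]mulr1 ler_wpM2l//.
  exact: Ex_norm_le.
apply/eqP; rewrite -subr_eq0 -normr_le0; apply/ler_addgt0Pr => e e0; rewrite add0r.
pose K := C0 + `|kappa|; have K0 : 0 <= K by rewrite addr_ge0.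
pose N := (Num.truncn (K / e)).+1.
apply: (le_trans (HN N _)) => //; rewrite ler_pdivrMr ?ltr0n// -ler_pdivrMl// mulrC.
by rewrite ltW// truncnS_gt.
Qed.

End BoundedExpectation.

(** * Characteristic functions of independent sums *)

Section TrigTaylor.
Variable R : realType.
Implicit Types x : R.

Let ball_in x : - `|x| <= x <= `|x|.
Proof. by rewrite -ler_norml. Qed.

Let zero_in x : - `|x| <= 0 <= `|x|.
Proof. by rewrite oppr_le0 normr_ge0. Qed.

(** Each use raises the power of |x| by one. Keeping the constant 1 instead of factorials is enough
    for the limit theorem. *)
Let from0 (g h : R -> R) x B : (forall t : R, is_derive t 1 g (h t)) ->
  (forall t, `|t| <= `|x| -> `|h t| <= B) -> `|g x - g 0| <= B * `|x|.
Proof.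
move=> dg hB; rewrite -[X in _ * `|X|]subr0.
apply: (is_derive_lip (a := - `|x|) (b := `|x|) (h := h)) => //.
by move=> t; rewrite -ler_norml => /hB.
Qed.

Lemma sin_le_norm x : `|sin x| <= `|x|.
Proof.
rewrite -[sin x]subr0 -(@sin0 R) -[leRHS]mul1r; apply: (from0 (h := cos)) => // t _.
exact: cos_max.
Qed.

Lemma cos_taylor1 x : `|cos x - 1| <= `|x| ^+ 2.
Proof.
rewrite -(@cos0 R) expr2; apply: (from0 (h := fun t => - sin t)) => // t tx.
by rewrite normrN (le_trans (sin_le_norm t)).
Qed.

Lemma sin_taylor1 x : `|sin x - x| <= `|x| ^+ 3.
Proof.
have := @from0 (fun t => sin t - t) (fun t => cos t - 1) x (`|x| ^+ 2).
rewrite sin0 !subr0 -exprSr; apply.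
- by move=> t tx; rewrite (le_trans (cos_taylor1 t))// ler_pXn2r// nnegrE.
Qed.

Lemma cos_taylor2 x : `|cos x - 1 + x ^+ 2 / 2| <= `|x| ^+ 4.
Proof.
have := @from0 (fun t => cos t - 1 + t ^+ 2 / 2) (fun t => - (sin t - t)) x (`|x| ^+ 3).
rewrite cos0 subrr expr0n mul0r addr0 subr0 -exprSr; apply.
- move=> t.
  have dq : is_derive t 1 (fun t : R => - 1 + t ^+ 2 / 2) t.
    apply: (@is_derive_quad _ _ _ _ 1 1) => // u _.
    rewrite (_ : _ - _ - _ = u ^+ 2 / 2); last by field.
    rewrite ger0_norm ?divr_ge0 ?sqr_ge0// mul1r ler_pdivrMr// ler_peMr ?sqr_ge0//.
    by rewrite ler1n.
  have H := is_deriveD (is_derive_cos t) dq.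
  under eq_fun do rewrite -addrA.
  by apply: (is_derive_eq H); ring.
- by move=> t tx; rewrite normrN (le_trans (sin_taylor1 t))// ler_pXn2r// nnegrE.
Qed.

Lemma expRN_taylor1 x : 0 <= x -> `|expR (- x) - 1 + x| <= x ^+ 2.
Proof.
move=> x0.
have x_in : 0 <= x <= x by rewrite x0 lexx.
have z_in : (0 : R) <= 0 <= x by rewrite lexx x0.
have de (t : R) : is_derive t 1 (fun t : R => expR (- t)) (- expR (- t)).
  have H := @is_derive1_comp R expR (fun t => - t) t _ _ (is_derive_expR (- t)) (is_deriveN (is_derive_id t (1 : R))).
  by apply: (is_derive_eq H); rewrite mulrN1.
have e1 t : 0 <= t <= x -> `|expR (- t) - 1| <= x.
  move=> Ht; rewrite -(@expR0 R) -oppr0.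
  apply: le_trans (is_derive_lip (a := 0) (b := x) (B := 1) (fun u _ => de u) _ z_in Ht) _.
    by move=> u /andP[u0 _]; rewrite normrN ger0_norm ?expR_ge0// expR_le1 oppr_le0.
  by rewrite mul1r subr0; case/andP: Ht => t0; rewrite ger0_norm.
have := is_derive_lip (g := fun t => expR (- t) - 1 + t) (h := fun t => - (expR (- t) - 1)) (a := 0) (b := x) (B := x) _ _ z_in x_in.
rewrite /= oppr0 expR0 subrr addr0 !subr0 addr0 (ger0_norm x0) -expr2; apply.
- move=> t _.
  have H := is_deriveD (is_deriveB (de t) (is_derive_cst (1 : R) t 1)) (is_derive_id t (1 : R)).
  by apply: (is_derive_eq H); ring.
- by move=> t /e1; rewrite normrN.
Qed.

End TrigTaylor.

(** * Cosine transforms and second moments of sums of independent bounded variables *)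

Section IndependentSums.
Context d0 (T : measurableType d0) (R : realType) (P : probability T R).
(** [S j] will be the sigma-algebra of the j-th pair and [Y j] a fixed linear combination of the
    centred summands of that pair. *)
Variables (S : nat -> set (set T)) (Y : nat -> T -> R).
Hypothesis S_measurable : forall j A, S j A -> measurable A.
Hypothesis indep : forall (J : seq nat) (E : nat -> set T), uniq J ->
  (forall j, j \in J -> S j (E j)) ->
  fine (P (\big[setI/setT]_(j <- J) E j)) = \prod_(j <- J) fine (P (E j)).
Hypothesis YS : forall j (B : set R), measurable B -> S j (Y j @^-1` B).
Variable M : R.
Hypothesis YM : forall j w, `|Y j w| <= M.
Local Notation Ex := (Ex P).

Lemma measurable_rv j : measurable_fun setT (Y j).
Proof. by move=> _ B mB; rewrite setTI; exact/S_measurable/YS. Qed.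

Lemma brv_rv j : brv (Y j).
Proof. by split; [exact: measurable_rv|exists M]. Qed.

Definition psum n w : R := \sum_(j < n) Y j w.

Lemma brv_psum n : brv (psum n).
Proof. by apply: brv_sum => j; exact: brv_rv. Qed.

(** The sine is the cosine with phase lowered by pi/2, so a statement for all phases c is closed
    under adding one more variable. *)
Let ccos s n c w : R := cos (s * psum n w + c).

Lemma brv_cos (X : T -> R) : measurable_fun setT X -> brv (fun w => cos (X w)).
Proof.
move=> mX; apply: (brv_comp (C := 1)) => //.
  by apply: continuous_measurable_fun; exact: continuous_cos.
by move=> x; rewrite ler_norml cos_geN1 cos_le1.
Qed.

Lemma brv_sin (X : T -> R) : measurable_fun setT X -> brv (fun w => sin (X w)).
Proof.
move=> mX; apply: (brv_comp (C := 1)) => //.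
  by apply: continuous_measurable_fun; exact: continuous_sin.
by move=> x; rewrite ler_norml sin_geN1 sin_le1.
Qed.

Let brv_ccos s n c : brv (ccos s n c).
Proof.
apply: brv_cos; apply: measurable_funD; last exact: measurable_cst.
by apply: measurable_funM; [exact: measurable_cst|case: (brv_psum n)].
Qed.

Let level_set j (h : R -> R) a : measurable_fun setT h ->
  S j [set w | a <= h (Y j w)].
Proof.
move=> mh; apply: (@YS j [set x | a <= h x]).
rewrite -[X in measurable X]setTI.
exact: (measurable_fun_ler (measurable_cst a) mh).
Qed.

(** A superlevel set of h(Y_n) is an event of index n; it joins the family E, whose indices exceed
    n, and the induction hypothesis applies. [Ex_mul_of_levels] passes from these events to h(Y_n)
    itself. *)
Let Ex_ccos_step s n c (J : seq nat) (E : nat -> set T) (h : R -> R) :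
  (forall c J (E : nat -> set T), uniq J -> {in J, forall j, (n <= j)%N} ->
    (forall j, j \in J -> S j (E j)) ->
    Ex (fun w => ccos s n c w * \1_(\big[setI/setT]_(j <- J) E j) w) =
    Ex (ccos s n c) * fine (P (\big[setI/setT]_(j <- J) E j))) ->
  uniq J -> {in J, forall j, (n < j)%N} -> (forall j, j \in J -> S j (E j)) ->
  measurable_fun setT h -> brv (fun w => h (Y n w)) ->
  Ex (fun w => ccos s n c w * \1_(\big[setI/setT]_(j <- J) E j) w * h (Y n w)) =
  Ex (ccos s n c) * fine (P (\big[setI/setT]_(j <- J) E j)) * Ex (fun w => h (Y n w)).
Proof.
move=> IH uJ nJ SE mh bh; set BJ := \big[setI/setT]_(j <- J) E j.
have mBJ : measurable BJ.
  rewrite /BJ big_seq; apply: (big_ind (fun A => measurable A)) => //.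
  - by move=> A1 A2; exact: measurableI.
  - by move=> j /SE/S_measurable.
apply: Ex_mul_of_levels => //.
  by apply: brvM => //; exact: brv_indic.
move=> a; set D := [set w | a <= h (Y n w)].
have SD : S n D by exact: level_set.
pose E' j := if j == n then D else E j.
have nJ' : n \notin J by apply/negP => /nJ; rewrite ltnn.
have EE : \big[setI/setT]_(j <- J) E' j = BJ.
  apply: eq_big_seq => j jJ; rewrite /E'; case: eqP => // jn.
  by move: nJ'; rewrite -jn jJ.
have EnE : \big[setI/setT]_(j <- n :: J) E' j = D `&` BJ.
  by rewrite big_cons EE /E' eqxx.
have uJ' : uniq (n :: J) by rewrite /= nJ'.
have SE' j : j \in n :: J -> S j (E' j).
  rewrite inE /E'; case: eqP => [->//|_ /=]; exact: SE.
transitivity (Ex (fun w => ccos s n c w * \1_(\big[setI/setT]_(j <- n :: J) E' j) w)).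
  rewrite EnE; congr Ex; apply/funext => w; rewrite -mulrA; congr (_ * _).
  by rewrite indicI/= mulrC.
rewrite IH//; last first.
  by move=> j; rewrite inE => /predU1P[->//|/nJ/ltnW].
rewrite -mulrA; congr (_ * _); rewrite (indep uJ' SE') big_cons mulrC.
rewrite {2}/E' eqxx; congr (_ * _).
rewrite /BJ (indep uJ SE); apply: eq_big_seq => j jJ; rewrite /E'; case: eqP => // jn.
by move: nJ'; rewrite -jn jJ.
Qed.

Let ccosS s n c w : ccos s n.+1 c w =
  ccos s n c w * cos (s * Y n w) - ccos s n (c - pi / 2) w * sin (s * Y n w).
Proof.
rewrite /ccos /psum big_ord_recr/=; set A := \sum_(i < n) _.
rewrite (_ : s * (A + Y n w) + c = (s * A + c) + s * Y n w); last by ring.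
rewrite cosD; congr (_ - _ * _).
by rewrite addrA cosB cos_pihalf sin_pihalf mulr0 add0r mulr1.
Qed.

Let mscos s : measurable_fun setT (fun x : R => cos (s * x)).
Proof.
apply: (@measurableT_comp _ _ _ _ _ _ (@cos R)).
  by apply: continuous_measurable_fun; exact: continuous_cos.
by apply: measurable_funM; [exact: measurable_cst|exact: measurable_id].
Qed.

Let mssin s : measurable_fun setT (fun x : R => sin (s * x)).
Proof.
apply: (@measurableT_comp _ _ _ _ _ _ (@sin R)).
  by apply: continuous_measurable_fun; exact: continuous_sin.
by apply: measurable_funM; [exact: measurable_cst|exact: measurable_id].
Qed.

Let bscos s n : brv (fun w => cos (s * Y n w)).
Proof.
by apply: brv_cos; apply: measurable_funM; [exact: measurable_cst|exact: measurable_rv].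
Qed.

Let bssin s n : brv (fun w => sin (s * Y n w)).
Proof.
by apply: brv_sin; apply: measurable_funM; [exact: measurable_cst|exact: measurable_rv].
Qed.

(** Independence of the first n variables from events of index at least n. The partial sum is not
    itself treated as a new random variable: the addition formula splits off one summand at a
    time. *)
Let Ex_ccos_indic s n c (J : seq nat) (E : nat -> set T) :
  uniq J -> {in J, forall j, (n <= j)%N} ->
  (forall j, j \in J -> S j (E j)) ->
  Ex (fun w => ccos s n c w * \1_(\big[setI/setT]_(j <- J) E j) w) =
  Ex (ccos s n c) * fine (P (\big[setI/setT]_(j <- J) E j)).
Proof.
have mbig (J' : seq nat) (E' : nat -> set T) : (forall j, j \in J' -> S j (E' j)) ->
    measurable (\big[setI/setT]_(j <- J') E' j).
  move=> SE'; rewrite big_seq; apply: (big_ind (fun A => measurable A)) => //.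
  - by move=> A1 A2; exact: measurableI.
  - by move=> j /SE'/S_measurable.
elim: n c J E => [|n IH] c J E uJ nJ SE.
  have E0 w : ccos s 0 c w = cos c by rewrite /ccos /psum big_ord0 mulr0 add0r.
  under eq_fun do rewrite E0.
  have -> : ccos s 0 c = (fun=> cos c) by apply/funext => w; exact: E0.
  by rewrite Ex_cst ExZ ?Ex_indic//; [exact: mbig|exact/brv_indic/mbig].
have gen (J' : seq nat) (E' : nat -> set T) : uniq J' -> {in J', forall j, (n < j)%N} ->
    (forall j, j \in J' -> S j (E' j)) ->
    Ex (fun w => ccos s n.+1 c w * \1_(\big[setI/setT]_(j <- J') E' j) w) =
    (Ex (ccos s n c) * Ex (fun w => cos (s * Y n w)) -
     Ex (ccos s n (c - pi / 2)) * Ex (fun w => sin (s * Y n w))) *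
    fine (P (\big[setI/setT]_(j <- J') E' j)).
  move=> uJ' nJ' SE'; set BJ := \big[setI/setT]_(j <- J') E' j.
  have bJ : brv (\1_BJ : T -> R) by apply: brv_indic; exact: mbig.
  rewrite (_ : (fun w => _) = (fun w => ccos s n c w * \1_BJ w * cos (s * Y n w) -
    ccos s n (c - pi / 2) w * \1_BJ w * sin (s * Y n w))); last first.
    by apply/funext => w; rewrite ccosS; ring.
  rewrite ExB; [|by apply: brvM => //; exact: brvM..].
  rewrite (@Ex_ccos_step s n c J' E' (fun x => cos (s * x)) IH uJ' nJ' SE' (mscos s) (bscos s n)).
  rewrite (@Ex_ccos_step s n (c - pi / 2) J' E' (fun x => sin (s * x)) IH uJ' nJ' SE' (mssin s) (bssin s n)).
  by rewrite -/BJ; ring.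
rewrite gen//; congr (_ * _).
(* The empty family identifies the bracket in [gen] as the mean of [ccos s n.+1 c]. *)
have := gen [::] E isT; rewrite big_nil; have /= -> := probability_setT P.
rewrite mulr1 => <- //; congr Ex; apply/funext => w.
by rewrite indicE in_setT mulr1.
Qed.

Lemma Ex_cos_psumS s n c :
  Ex (fun w => cos (s * psum n.+1 w + c)) =
  Ex (fun w => cos (s * psum n w + c)) * Ex (fun w => cos (s * Y n w)) -
  Ex (fun w => cos (s * psum n w + (c - pi / 2))) * Ex (fun w => sin (s * Y n w)).
Proof.
have e1 : {in [::], forall j, (n < j)%N} by [].
have e2 : forall j, j \in [::] -> S j (setT : set T) by [].
have step c' h := @Ex_ccos_step s n c' [::] (fun=> setT) h
  (fun c'' J E => @Ex_ccos_indic s n c'' J E) isT e1 e2.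
rewrite (_ : (fun w => cos (s * psum n.+1 w + c)) =
  (fun w => ccos s n c w * cos (s * Y n w) - ccos s n (c - pi / 2) w * sin (s * Y n w))); last first.
  by apply/funext => w; rewrite -ccosS.
rewrite ExB; [|exact: brvM..].
have H1 := step c (fun x => cos (s * x)) (mscos s) (bscos s n).
have H2 := step (c - pi / 2) (fun x => sin (s * x)) (mssin s) (bssin s n).
move: H1 H2; rewrite !big_nil; have /= -> := probability_setT P.
rewrite !mulr1 => H1 H2; congr (_ - _).
  by rewrite -[RHS]H1; congr Ex; apply/funext => w; rewrite indicE in_setT mulr1.
by rewrite -[RHS]H2; congr Ex; apply/funext => w; rewrite indicE in_setT mulr1.
Qed.

Variable sigma2 : R.
Hypothesis Y0 : forall j, Ex (Y j) = 0.
Hypothesis Y2 : forall j, Ex (fun w => Y j w ^+ 2) = sigma2.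

Let M0 : 0 <= M.
Proof. exact: le_trans (normr_ge0 _) (YM 0 point). Qed.

Let bY2 j : brv (fun w => Y j w ^+ 2).
Proof. by under eq_fun do rewrite expr2; apply: brvM; exact: brv_rv. Qed.

Let sigma2_ge0 : 0 <= sigma2.
Proof.
rewrite -(Y2 0) -(Ex_cst P 0); apply: le_Ex => //; first exact: brv_cst.
by move=> w; exact: sqr_ge0.
Qed.

Let Ex_cos_near s j : `|Ex (fun w => cos (s * Y j w)) - (1 - s ^+ 2 * sigma2 / 2)| <=
  `|s| ^+ 4 * M ^+ 4.
Proof.
have b1 := bscos s j.
rewrite (_ : 1 - _ = Ex (fun w => 1 - s ^+ 2 / 2 * Y j w ^+ 2)); last first.
  rewrite ExB; [|exact: brv_cst|by apply: brvM => //; exact: brv_cst].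
  by rewrite ExZ// Ex_cst Y2; ring.
have b2 : brv (fun w => 1 - s ^+ 2 / 2 * Y j w ^+ 2).
  by apply: brvB; [exact: brv_cst|apply: brvM => //; exact: brv_cst].
rewrite -ExB//; apply: Ex_norm_le; first exact: brvB.
move=> w; rewrite (_ : _ - _ = cos (s * Y j w) - 1 + (s * Y j w) ^+ 2 / 2); last by field.
rewrite (le_trans (cos_taylor2 _))// normrM exprMn ler_wpM2l ?exprn_ge0//.
by rewrite ler_pXn2r// nnegrE.
Qed.

Let Ex_sin_near s j : `|Ex (fun w => sin (s * Y j w))| <= `|s| ^+ 3 * M ^+ 3.
Proof.
have b1 := bssin s j; have bs : brv (fun w => s * Y j w).
  by apply: brvM; [exact: brv_cst|exact: brv_rv].
rewrite -[X in `|X|]subr0 -[X in _ - X](mulr0 s) -(Y0 j) -ExZ; last exact: brv_rv.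
rewrite -ExB//; apply: Ex_norm_le; first exact: brvB.
move=> w; rewrite (le_trans (sin_taylor1 _))// normrM exprMn ler_wpM2l ?exprn_ge0//.
by rewrite ler_pXn2r// nnegrE.
Qed.

(** Each new variable multiplies by E cos(sY), close to v, and mixes in E sin(sY), close to 0. All
    factors are at most 1, so the n errors add up. In the constant M^3 comes from the sine, M^4 from
    the cosine and sigma2^2 from the exponential; |s| <= 1 trades |s|^4 for |s|^3. *)
Lemma Ex_cos_psum_near s n c : `|s| <= 1 ->
  `|Ex (fun w => cos (s * psum n w + c)) - expR (- (s ^+ 2 * sigma2 / 2)) ^+ n * cos c|
  <= n%:R * (`|s| ^+ 3 * (M ^+ 3 + M ^+ 4 + sigma2 ^+ 2)).
Proof.
move=> s1; set v := expR _; set K := `|s| ^+ 3 * _.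
have x0 : 0 <= s ^+ 2 * sigma2 / 2 by rewrite divr_ge0// mulr_ge0// sqr_ge0.
have v1 : `|v| <= 1 by rewrite ger0_norm ?expR_ge0// expR_le1 oppr_le0.
have near j : `|Ex (fun w => cos (s * Y j w)) - v| + `|Ex (fun w => sin (s * Y j w))| <= K.
  have H1 := Ex_cos_near s j; have H2 := Ex_sin_near s j; have H3 := expRN_taylor1 x0.
  rewrite -/v in H3.
  have s4 : `|s| ^+ 4 <= `|s| ^+ 3 by rewrite exprS ler_piMl ?exprn_ge0.
  have H4 : `|Ex (fun w => cos (s * Y j w)) - v| <= `|s| ^+ 3 * (M ^+ 4 + sigma2 ^+ 2).
    rewrite (_ : _ - v = (Ex (fun w => cos (s * Y j w)) - (1 - s ^+ 2 * sigma2 / 2)) -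
      (v - 1 + s ^+ 2 * sigma2 / 2)); last by ring.
    rewrite (le_trans (ler_normB _ _))// mulrDr lerD//.
      by rewrite (le_trans H1)// ler_wpM2r// exprn_ge0.
    rewrite (le_trans H3)// (_ : (s ^+ 2 * sigma2 / 2) ^+ 2 = s ^+ 4 * (sigma2 ^+ 2 / 4)); last by field.
    have -> : s ^+ 4 = `|s| ^+ 4.
      by rewrite -normrX ger0_norm// (exprM s 2 2) sqr_ge0.
    rewrite ler_pM ?exprn_ge0 ?divr_ge0 ?sqr_ge0//.
    by rewrite ler_pdivrMr// ler_peMr ?sqr_ge0// ler1n.
  by apply: (le_trans (lerD H4 H2)); rewrite /K le_eqVlt; apply/orP; left; apply/eqP; ring.
elim: n c => [|n IH] c.
  by under eq_fun do rewrite /psum big_ord0 mulr0 add0r; rewrite Ex_cst expr0 !mul1r subrr normr0 mul0r.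
rewrite Ex_cos_psumS; have := near n.
set a := Ex (fun w => cos (s * Y n w)); set b := Ex (fun w => sin (s * Y n w)) => ab.
have := IH c; set A := Ex (fun w => cos (s * psum n w + c)) => HA.
set B := Ex (fun w => cos (s * psum n w + (c - pi / 2))).
have A1 : `|A| <= 1.
  apply: Ex_norm_le; first exact: brv_ccos.
  by move=> w; exact: cos_max.
have B1 : `|B| <= 1.
  apply: Ex_norm_le; first exact: brv_ccos.
  by move=> w; exact: cos_max.
rewrite exprS -natr1 mulrDl mul1r.
rewrite (_ : _ - _ = v * (A - v ^+ n * cos c) + (A * (a - v) - B * b)); last by ring.
rewrite (le_trans (ler_normD _ _))// lerD//.
  by rewrite normrM (le_trans _ HA)// ler_piMl.
rewrite (le_trans (ler_normB _ _))// (le_trans _ ab)// !normrM lerD// ler_piMl//.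
Qed.

(** At s = n^(-1/2) the error n |s|^3 becomes n^(-1/2), and v^n becomes exp(-sigma2/2). *)
Lemma Ex_cos_clt n c : (0 < n)%N ->
  `|Ex (fun w => cos ((Num.sqrt n%:R)^-1 * psum n w + c)) - expR (- (sigma2 / 2)) * cos c|
  <= (M ^+ 3 + M ^+ 4 + sigma2 ^+ 2) / Num.sqrt n%:R.
Proof.
move=> n0; set q := Num.sqrt _; have q0 : 0 < q by rewrite sqrtr_gt0 ltr0n.
have q2 : n%:R = q ^+ 2 by rewrite sqr_sqrtr// ler0n.
have q1 : 1 <= q by rewrite -sqrtr1 ler_sqrt// ?ler0n// ler1n.
have := @Ex_cos_psum_near q^-1 n c.
rewrite -expRM_natr ger0_norm ?invr_ge0 ?(ltW q0)// q2.
rewrite (_ : - (q^-1 ^+ 2 * sigma2 / 2) * q ^+ 2 = - (sigma2 / 2)); last first.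
  by field; rewrite gt_eqF.
rewrite (_ : q ^+ 2 * (q^-1 ^+ 3 * _) = (M ^+ 3 + M ^+ 4 + sigma2 ^+ 2) / q); last first.
  by field; rewrite gt_eqF.
by apply; rewrite invf_le1.
Qed.

(** Applying the layer-cake lemma to one factor and then to the other reduces the claim to two
    superlevel events. *)
Lemma Ex_mul_indep j k : j != k -> Ex (fun w => Y j w * Y k w) = 0.
Proof.
move=> jk; rewrite -(mul0r (Ex (Y k))) -(Y0 j).
apply: Ex_mul_of_levels; [exact: brv_rv|exact: brv_rv|] => a.
have Sk b i : S i [set w | b <= Y i w].
  exact: (@level_set i (fun x : R => x) b (@measurable_id _ _ setT)).
under eq_fun do rewrite mulrC; rewrite mulrC.
apply: Ex_mul_of_levels; [exact/brv_indic/S_measurable/Sk|exact: brv_rv|] => b.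
pose E i := if i == j then [set w | b <= Y j w] else [set w | a <= Y k w].
have kj : (k == j) = false by rewrite eq_sym (negbTE jk).
have := @indep [:: j; k] E; rewrite /= inE jk => /(_ isT).
rewrite !big_cons !big_nil /E eqxx kj setIT mulr1 => H.
rewrite [RHS]mulrC -H; last first.
  by move=> i; rewrite !inE => /orP[]/eqP->; rewrite ?eqxx ?kj; exact: Sk.
rewrite -Ex_indic; last by apply: measurableI; exact/S_measurable/Sk.
by congr Ex; apply/funext => w; rewrite indicI/= mulrC.
Qed.

Lemma Ex_psum_sqr n : Ex (fun w => psum n w ^+ 2) = n%:R * sigma2.
Proof.
rewrite (_ : (fun w => _) = (fun w => \sum_(i < n) \sum_(j < n) Y i w * Y j w)); last first.
  by apply/funext => w; rewrite expr2 /psum mulr_suml; apply: eq_bigr => i _; rewrite mulr_sumr.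
have bij i j : brv (fun w => Y i w * Y j w) by apply: brvM; exact: brv_rv.
rewrite Ex_sum; last by move=> i; apply: brv_sum => j.
rewrite mulr_natl -[in RHS](card_ord n) -sumr_const; apply: eq_bigr => i _.
rewrite Ex_sum// (bigD1 i)//= big1 ?addr0 => [|j ji].
  by rewrite -(Y2 i); congr Ex; apply/funext => w; rewrite expr2.
by apply: Ex_mul_indep; rewrite eq_sym.
Qed.

End IndependentSums.

(** * Gaussian integrals *)

Section GaussianIntegral.
Variable R : realType.
Local Notation mu := (@lebesgue_measure R).
Local Notation g := (@gauss1 R).

Lemma Rintegral_derive_eq0 (F f : R -> R) : (forall x : R, is_derive x 1 F (f x)) ->
  continuous f -> mu.-integrable setT (EFin \o f) ->
  (fun n : nat => F n%:R - F (- n%:R)) @ \oo --> (0 : R) ->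
  \int[mu]_(t in setT) f t = 0.
Proof.
move=> dF cf intf limF.
have cF : continuous F.
  by move=> x; apply/differentiable_continuous/derivable1_diffP; exact: ex_derive.
have mf : measurable_fun setT f by exact: continuous_measurable_fun.
pose h n x := (f x * \1_(`[(- n%:R : R), n%:R]%classic) x)%:E : \bar R.
(* The shift to [n.+1] keeps the interval nondegenerate for the fundamental theorem of calculus. *)
have E n : (\int[mu]_(x in setT) h n.+1 x = (F n.+1%:R - F (- n.+1%:R))%:E)%E.
  have n0 : - n.+1%:R < n.+1%:R :> R by rewrite -subr_gt0 opprK -natrD ltr0n addnS.
  rewrite EFinB -(@continuous_FTC2 _ f F _ _ n0).
  - rewrite [RHS]integral_mkcond; apply: eq_integral => x _.
    by rewrite /h patchE indicE; case: (x \in _); rewrite ?mulr1 ?mulr0.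
  - exact: continuous_subspaceT.
  - split.
    + by move=> x _; exact: ex_derive.
    + by apply: cvg_at_right_filter; exact: cF.
    + by apply: cvg_at_left_filter; exact: cF.
  - by move=> x _; rewrite derive1E; exact: derive_val.
have H : (\int[mu]_(x in setT) h n x)%E @[n --> \oo] --> (\int[mu]_(x in setT) (f x)%:E)%E.
  apply: (@dominated_cvg _ _ _ mu setT measurableT h _ (fun x => `|f x|%:E)).
  - move=> n; apply/measurable_EFinP; apply: measurable_funM => //.
  - move=> x _; apply: cvg_near_cst; near=> n.
    rewrite /h indicE mem_set ?mulr1//= in_itv/= -ler_norml.
    by near: n; exact: nbhs_infty_ger.
  - by [].
  - exact: integrable_norm.
  - move=> n x _; rewrite /h abse_EFin lee_fin normrM.
    by rewrite ler_piMr// indicE; case: (_ \in _); rewrite ?normr1 ?normr0.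
have H2 : (\int[mu]_(x in setT) h n.+1 x)%E @[n --> \oo] --> (0 : R)%:E.
  under eq_fun do rewrite E.
  by apply: cvg_EFin; [exact: nearW|move: limF; rewrite -(cvg_shiftS)].
have H3 : (\int[mu]_(x in setT) h n.+1 x)%E @[n --> \oo] --> (\int[mu]_(x in setT) (f x)%:E)%E.
  by move: H; rewrite -(cvg_shiftS).
by rewrite /Rintegral (cvg_unique _ H3 H2).
Unshelve. all: by end_near. Qed.

Let sqrt2pi_gt0 : 0 < Num.sqrt (2 * pi) :> R.
Proof. by rewrite sqrtr_gt0 mulr_gt0// pi_gt0. Qed.

Lemma gauss1_ge0 (t : R) : 0 <= g t.
Proof. by rewrite /gauss1 divr_ge0 ?expR_ge0 ?sqrtr_ge0. Qed.

Lemma gauss1E : g = normal_pdf 0 1.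
Proof.
apply/funext => t; rewrite /normal_pdf oner_eq0 /gauss1 /normal_peak /normal_fun.
by rewrite subr0 expr1n mul1r mulrC mulr_natl.
Qed.

Lemma is_derive_gauss1 (t : R) : is_derive t 1 g (- t * g t).
Proof.
have dq : is_derive t 1 (fun t : R => - (t ^+ 2) / 2) (- t).
  apply: (@is_derive_quad _ _ _ _ 1 1) => // u _.
  rewrite (_ : _ - _ - _ = - (u ^+ 2 / 2)); last by field.
  rewrite normrN ger0_norm ?divr_ge0 ?sqr_ge0// mul1r ler_pdivrMr// ler_peMr ?sqr_ge0//.
  by rewrite ler1n.
have de := @is_derive1_comp R expR (fun t : R => - (t ^+ 2) / 2) t _ _ (is_derive_expR _) dq.
have H := is_deriveM de (is_derive_cst ((Num.sqrt (2 * pi))^-1 : R) t (1 : R)).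
by apply: (is_derive_eq H); rewrite /GRing.scale/= /gauss1; ring.
Qed.

Let cont_deriv (F f : R -> R) : (forall x : R, is_derive x 1 F (f x)) -> continuous F.
Proof.
by move=> dF x; apply/differentiable_continuous/derivable1_diffP; exact: ex_derive.
Qed.

Lemma continuous_gauss1 : continuous g.
Proof. exact: (cont_deriv is_derive_gauss1). Qed.

Lemma measurable_gauss1 : measurable_fun setT g.
Proof. by apply: continuous_measurable_fun; exact: continuous_gauss1. Qed.

Lemma Rintegral_gauss1 : \int[mu]_(t in setT) g t = 1.
Proof. by rewrite gauss1E /Rintegral integral_normal_pdf. Qed.

(** The product of these weights over the coordinates dominates any integrand of quadratic growth
    times the Gaussian density. *)
Definition gweight (t : R) : R := (1 + t ^+ 2) * g t.

Lemma gweight_ge0 t : 0 <= gweight t.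
Proof. by rewrite mulr_ge0 ?gauss1_ge0// addr_ge0// sqr_ge0. Qed.

Let wide (t : R) : R := normal_pdf 0 (Num.sqrt 2) t.

(** Half of the exponent absorbs the polynomial: 1 + t^2/4 <= exp(t^2/4) gives (1 + t^2) exp(-t^2/4)
    <= 4, and what remains is the shape of a normal density of variance 2. *)
Let gweight_wide : exists C, forall t, gweight t <= C * wide t.
Proof.
have s2 : Num.sqrt 2 != 0 :> R by rewrite gt_eqF// sqrtr_gt0.
exists (4 / Num.sqrt (2 * pi) / normal_peak (Num.sqrt 2)) => t.
have pk : normal_peak (Num.sqrt 2) != 0 :> R by rewrite gt_eqF// normal_peak_gt0.
rewrite /wide /normal_pdf (negbTE s2) mulrA divfK//.
have iS : 0 <= (Num.sqrt (2 * pi) : R)^-1 by rewrite invr_ge0 ltW.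
rewrite /gweight /gauss1 mulrA [X in _ <= X]mulrAC ler_wpM2r//.
rewrite /normal_fun subr0 sqr_sqrtr//.
have -> : expR (- t ^+ 2 / 2) = expR (- t ^+ 2 / (2 *+ 2)) * expR (- (t ^+ 2 / 4)) :> R.
  by rewrite -expRD; congr expR; rewrite -mulr_natr; field.
rewrite mulrCA [4 * _]mulrC ler_wpM2l ?expR_ge0//.
rewrite expRN ler_pdivrMr ?expR_gt0//.
have := expR_ge1Dx (t ^+ 2 / 4); set x := t ^+ 2; set y := expR _.
by lra.
Qed.

Lemma integrable_gweight : mu.-integrable setT (EFin \o gweight).
Proof.
have [C HC] := gweight_wide.
apply: (@le_integrable _ _ _ mu setT measurableT _ (fun t => (C * wide t)%:E)).
- apply/measurable_EFinP; apply: measurable_funM; last exact: measurable_gauss1.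
  by apply: measurable_funD; [exact: measurable_cst|exact: measurable_funX].
- move=> t _; rewrite lee_fin (ger0_norm (gweight_ge0 t)) (le_trans (HC t))//.
  exact: ler_norm.
- by have := integrableZl measurableT C (integrable_normal_pdf 0 (Num.sqrt 2 : R)).
Qed.

Let gweight_integrable (f : R -> R) C : continuous f -> (forall t, `|f t| <= C * gweight t) ->
  mu.-integrable setT (EFin \o f).
Proof.
move=> cf fC; apply: (@le_integrable _ _ _ mu setT measurableT _ (fun t => (C * gweight t)%:E)).
- by apply/measurable_EFinP; exact: continuous_measurable_fun.
- by move=> t _; rewrite lee_fin (le_trans (fC t))// ler_norm.
- by have := integrableZl measurableT C integrable_gweight.
Qed.

Let gweight_bounded : exists2 C, 0 <= C & forall t, gweight t <= C.
Proof.
have [C HC] := gweight_wide.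
have s2 : Num.sqrt 2 != 0 :> R by rewrite gt_eqF// sqrtr_gt0.
exists (`|C| * normal_peak (Num.sqrt 2)); first by rewrite mulr_ge0// normal_peak_ge0.
move=> t; rewrite (le_trans (HC t))//.
rewrite (@le_trans _ _ (`|C| * wide t))//; first by rewrite ler_wpM2r ?normal_pdf_ge0// ler_norm.
by rewrite ler_wpM2l// normal_pdf_ub.
Qed.

Let gauss_tail (F : R -> R) K : (forall t, `|F t| <= K * ((1 + `|t|) * g t)) ->
  (fun n : nat => F n%:R - F (- n%:R)) @ \oo --> (0 : R).
Proof.
move=> FK; have [C C0 HC] := gweight_bounded.
have g0 : 0 < g 0.
  by rewrite /gauss1 divr_gt0 ?expR_gt0.
have K0 : 0 <= K.
  by have := le_trans (normr_ge0 _) (FK 0); rewrite normr0 addr0 mul1r pmulr_lge0.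
have gN t : g (- t) = g t by rewrite /gauss1 sqrrN.
apply/cvgrPdist_le => e e0; near=> n.
have n1 : (1 <= n)%N by near: n; exact: nbhs_infty_ge.
have ne : 4 * (K * C) / e <= n%:R by near: n; exact: nbhs_infty_ger.
have n1' : 1 <= n%:R :> R by rewrite ler1n.
have n0 : 0 < n%:R :> R by rewrite ltr0n.
rewrite sub0r normrN (le_trans (ler_normB _ _))//.
have H1 := FK n%:R; have H2 := FK (- n%:R).
rewrite normrN gN in H2; rewrite (ger0_norm (ltW n0)) in H1 H2.
have H3 : (1 + n%:R) * g n%:R <= 2 * C / n%:R.
  rewrite ler_pdivlMr//; apply: le_trans (_ : 2 * gweight n%:R <= _); last by rewrite ler_wpM2l.
  rewrite /gweight mulrA mulrAC ler_wpM2r ?gauss1_ge0//.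
  by set x := n%:R : R; nra.
apply: le_trans (lerD H1 H2) _.
apply: (@le_trans _ _ (4 * (K * C) / n%:R)); last by rewrite ler_pdivrMr// [e * _]mulrC -ler_pdivrMr.
have AB := ler_wpM2l K0 H3.
rewrite (_ : 4 * (K * C) / n%:R = K * (2 * C / n%:R) + K * (2 * C / n%:R)); last by ring.
exact: lerD.
Unshelve. all: by end_near. Qed.

Let g_le_gweight t : g t <= gweight t.
Proof. by rewrite /gweight mulrDl mul1r lerDl mulr_ge0 ?sqr_ge0 ?gauss1_ge0. Qed.

Let sqrg_le_gweight t : t ^+ 2 * g t <= gweight t.
Proof. by rewrite /gweight mulrDl mul1r lerDr gauss1_ge0. Qed.

Let idg_le_gweight t : `|t| * g t <= gweight t.
Proof.
rewrite /gweight ler_wpM2r ?gauss1_ge0// -(real_normK (num_real t)).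
by have := normr_ge0 t; set x := `|t|; nra.
Qed.

Lemma integrable_gauss1 : mu.-integrable setT (EFin \o g).
Proof.
apply: (@gweight_integrable _ 1); first exact: continuous_gauss1.
by move=> t; rewrite mul1r ger0_norm ?gauss1_ge0.
Qed.

Let caff (a w t : R) := cos (a * t + w).
Let saff (a w t : R) := sin (a * t + w).

Let is_derive_aff1 (a w t : R) : is_derive t 1 (fun t => a * t + w) a.
Proof.
apply: (@is_derive_quad _ _ _ _ 0 1) => // u _.
by rewrite (_ : _ - _ - _ = 0) ?normr0 ?mul0r//; ring.
Qed.

Let is_derive_caff (a w t : R) : is_derive t 1 (caff a w) (- saff a w t * a).
Proof.
exact: (@is_derive1_comp R cos (fun t : R => a * t + w) t _ _ (is_derive_cos _) (is_derive_aff1 a w t)).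
Qed.

Let is_derive_saff (a w t : R) : is_derive t 1 (saff a w) (caff a w t * a).
Proof.
exact: (@is_derive1_comp R sin (fun t : R => a * t + w) t _ _ (is_derive_sin _) (is_derive_aff1 a w t)).
Qed.

Let Jw w a := \int[mu]_(t in setT) (caff a w t * g t).

Let cont_caff a w : continuous (caff a w).
Proof. by apply: cont_deriv => x; exact: is_derive_caff. Qed.

Let cont_saff a w : continuous (saff a w).
Proof. by apply: cont_deriv => x; exact: is_derive_saff. Qed.

Let int_cg a w : mu.-integrable setT (EFin \o (fun t => caff a w t * g t)).
Proof.
apply: (@gweight_integrable _ 1) => [x|t].
  by apply: cvgM; [exact: cont_caff|exact: continuous_gauss1].
rewrite mul1r normrM (ger0_norm (gauss1_ge0 t)).
by rewrite (le_trans _ (g_le_gweight t))// ler_piMl ?gauss1_ge0// cos_max.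
Qed.

Let int_tsg a w : mu.-integrable setT (EFin \o (fun t => - (t * saff a w t * g t))).
Proof.
apply: (@gweight_integrable _ 1) => [x|t].
  apply: cvgN; apply: cvgM; last exact: continuous_gauss1.
  by apply: cvgM; [exact: cvg_id|exact: cont_saff].
rewrite mul1r normrN (normrM (t * saff a w t)) (ger0_norm (gauss1_ge0 t)) normrM.
rewrite (le_trans _ (idg_le_gweight t))// ler_wpM2r ?gauss1_ge0//.
by rewrite ler_piMr// sin_max.
Qed.

(** Since g' = -t g, the derivative of sin(a t + w) g(t) is the sum of the two integrands, and its
    integral over the line is zero. *)
Let Jw_parts a w : \int[mu]_(t in setT) (- (t * saff a w t * g t)) = - a * Jw w a.
Proof.
have dF (t : R) : is_derive t 1 (fun t => saff a w t * g t)
    (a * (caff a w t * g t) + - (t * saff a w t * g t)).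
  have H := is_deriveM (is_derive_saff a w t) (is_derive_gauss1 t).
  by apply: (is_derive_eq H); rewrite /GRing.scale/=; ring.
have iac : mu.-integrable setT (EFin \o (fun t => a * (caff a w t * g t))).
  by have := integrableZl measurableT a (int_cg a w).
have := Rintegral_derive_eq0 dF.
rewrite RintegralD// RintegralZl// -/(Jw w a) => H.
apply/eqP; rewrite mulNr -addr_eq0 addrC; apply/eqP; apply: H.
- move=> x; apply: cvgD.
    apply: cvgM; first exact: cvg_cst.
    by apply: cvgM; [exact: cont_caff|exact: continuous_gauss1].
  apply: cvgN; apply: cvgM; last exact: continuous_gauss1.
  by apply: cvgM; [exact: cvg_id|exact: cont_saff].
- by have := integrableD measurableT iac (int_tsg a w).
- apply: (@gauss_tail (fun t => saff a w t * g t) 1) => t.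
  rewrite mul1r normrM (ger0_norm (gauss1_ge0 t)) ler_wpM2r ?gauss1_ge0//.
  by rewrite (le_trans (sin_max _))// lerDl.
Qed.

Lemma integrable_gauss1_cos (a w : R) :
  mu.-integrable setT (EFin \o (fun t => cos (a * t + w) * g t)).
Proof. exact: int_cg. Qed.

(** Differentiation under the integral: the remainder is at most u^2 t^2 g(t) pointwise, which
    [gweight] dominates. *)
Let Jw_derive w (a : R) : is_derive a 1 (Jw w) (- a * Jw w a).
Proof.
rewrite -Jw_parts; set l := \int[mu]_(t in setT) _.
apply: (@is_derive_quad _ _ _ _ (\int[mu]_(t in setT) gweight t) 1) => // u _.
have iu : mu.-integrable setT (EFin \o (fun t => u * - (t * saff a w t * g t))).
  by have := integrableZl measurableT u (int_tsg a w).
have i1 := integrableB measurableT (int_cg (a + u) w) (int_cg a w).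
rewrite /l /Jw -RintegralZl// -RintegralB// -RintegralB//.
have i2 := integrableB measurableT i1 iu.
rewrite (le_trans (le_normr_Rintegral _ _))// mulrC -RintegralZl//; last exact: integrable_gweight.
apply: le_Rintegral => //.
- by have := integrable_norm i2.
- by have := integrableZl measurableT (u ^+ 2) integrable_gweight.
move=> t _; rewrite (_ : _ - _ = (caff (a + u) w t - caff a w t - (- sin (a * t + w)) * ((a + u) * t + w - (a * t + w))) * g t); last first.
  by rewrite /saff; ring.
rewrite normrM (ger0_norm (gauss1_ge0 t)).
apply: (@le_trans _ _ (u ^+ 2 * (t ^+ 2 * g t))); last by rewrite ler_wpM2l ?sqr_ge0 ?sqrg_le_gweight.
rewrite mulrA ler_wpM2r ?gauss1_ge0//.
rewrite (_ : u ^+ 2 * t ^+ 2 = 1 * ((a + u) * t + w - (a * t + w)) ^+ 2); last by ring.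
pose m := `|(a + u) * t + w| + `|a * t + w|.
apply: (@is_derive_taylor R cos (fun x => - sin x) (fun x => - cos x) (- m) m 1) => //.
- by move=> x _; rewrite normrN cos_max.
- by rewrite -ler_norml /m lerDr.
- by rewrite -ler_norml /m lerDl.
Qed.

(** The equation J' = -a J makes J(a) exp(a^2/2) constant, with value cos w at a = 0. *)
Lemma Rintegral_gauss1_cos (a w : R) :
  \int[mu]_(t in setT) (cos (a * t + w) * g t) = expR (- (a ^+ 2 / 2)) * cos w.
Proof.
have dH (x : R) : is_derive x 1 (fun x => Jw w x * expR (x ^+ 2 / 2)) 0.
  have dq : is_derive x 1 (fun t : R => t ^+ 2 / 2) x.
    apply: (@is_derive_quad _ _ _ _ 1 1) => // u _.
    rewrite (_ : _ - _ - _ = u ^+ 2 / 2); last by field.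
    rewrite ger0_norm ?divr_ge0 ?sqr_ge0// mul1r ler_pdivrMr// ler_peMr ?sqr_ge0//.
    by rewrite ler1n.
  have de := @is_derive1_comp R expR (fun t : R => t ^+ 2 / 2) x _ _ (is_derive_expR _) dq.
  have H := is_deriveM (Jw_derive w x) de.
  by apply: (is_derive_eq H); rewrite /GRing.scale/=; ring.
have := is_derive_0_is_cst a 0 dH.
rewrite expr0n mul0r expR0 mulr1.
have -> : Jw w 0 = cos w.
  rewrite /Jw /caff (_ : (fun t => _) = (fun t => cos w * g t)); last first.
    by apply/funext => t; rewrite mul0r add0r.
  by rewrite RintegralZl//; [rewrite Rintegral_gauss1 mulr1|exact: integrable_gauss1].
by move=> <-; rewrite expRN mulrC mulfK// gt_eqF// expR_gt0.
Qed.

End GaussianIntegral.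

(** * Expectations under the standard normal law *)

Section StdNormal.
Variable R : realType.
Local Notation mu := (@lebesgue_measure R).
Local Notation g := (@gauss1 R).
Implicit Types (w m : (nat -> R) -> R) (y : nat -> R).

Definition invariant_on (s : seq nat) (w : (nat -> R) -> R) : Prop :=
  forall y k t, k \in s -> w (upd y k t) = w y.

Lemma invariant_on_cst s c : invariant_on s (fun=> c).
Proof. by []. Qed.

Lemma invariant_on_cons k s w : invariant_on (k :: s) w -> invariant_on s w.
Proof. by move=> H y j t js; apply: H; rewrite inE js orbT. Qed.

Lemma invariant_on_coord k s (h : R -> R) : k \notin s -> invariant_on s (fun y => h (y k)).
Proof. by move=> ks y j t js; rewrite upd_diff//; apply: contraNneq ks => ->. Qed.

(** The functions m and w carry what does not depend on the variables of s: while the inner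
    integrals are evaluated, the outer variable contributes its density to m and its term a_k y_k to
    the phase. *)
Lemma Ints_cos s m (a : nat -> R) w y : uniq s -> invariant_on s m ->
  invariant_on s w ->
  Ints s (fun y => m y * (cos (\sum_(k <- s) a k * y k + w y) * \prod_(k <- s) g (y k))) y =
  m y * (expR (- (\sum_(k <- s) a k ^+ 2) / 2) * cos (w y)).
Proof.
elim: s m w y => [|k s IH] m w y.
  by rewrite /= !big_nil add0r mulr1 oppr0 mul0r expR0 mul1r.
move=> /= /andP[ks us] Hm Hw.
have -> : Ints s (fun y => m y * (cos (\sum_(j <- k :: s) a j * y j + w y) * \prod_(j <- k :: s) g (y j))) =
    (fun y => (m y * g (y k)) * (expR (- (\sum_(j <- s) a j ^+ 2) / 2) * cos (a k * y k + w y))).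
  apply/funext => x; rewrite -(IH (fun y => m y * g (y k)) (fun y => a k * y k + w y))//.
  - congr (Ints s _ x); apply/funext => z; rewrite !big_cons.
    rewrite (_ : _ + \sum_(j <- s) _ + w z = \sum_(j <- s) a j * z j + (a k * z k + w z)); last by ring.
    by ring.
  - move=> z j t js; rewrite (invariant_on_cons Hm)//; congr (_ * _).
    exact: (@invariant_on_coord k s).
  - move=> z j t js; rewrite (invariant_on_cons Hw)//; congr (_ + _).
    exact: (@invariant_on_coord k s (fun x => a k * x)).
rewrite /Int1.
under eq_Rintegral => t _.
  rewrite (Hm y k t (mem_head _ _)) (Hw y k t (mem_head _ _)) upd_same.
  rewrite (_ : _ * _ = (m y * expR (- (\sum_(j <- s) a j ^+ 2) / 2)) * (cos (a k * t + w y) * g t)); last by ring.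
  over.
rewrite RintegralZl//; last exact: integrable_gauss1_cos.
rewrite Rintegral_gauss1_cos big_cons.
rewrite (_ : - (a k ^+ 2 + _) / 2 = - (\sum_(j <- s) a j ^+ 2) / 2 + - (a k ^+ 2 / 2)); last by field.
by rewrite expRD; ring.
Qed.

Variable n : nat.
Implicit Types f : 'rV[R]_n -> R.

Definition quad_growth f : Prop :=
  row_measurable f /\ exists2 C, 0 <= C & forall v, `|f v| <= C * (1 + \sum_i v ord0 i ^+ 2).

Let gw := @gweight R.

(** The inequality 1 + sum y_k^2 <= prod (1 + y_k^2), multiplied by the density. *)
Lemma prod_gweight_ge (s : seq nat) y :
  (1 + \sum_(k <- s) y k ^+ 2) * \prod_(k <- s) g (y k) <= \prod_(k <- s) gw (y k).
Proof.
elim: s => [|k s IH]; first by rewrite !big_nil addr0 mulr1.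
rewrite !big_cons; set S := \sum_(j <- s) _ in IH *; set G := \prod_(j <- s) g _ in IH *.
have G0 : 0 <= G by apply: prodr_ge0 => j _; exact: gauss1_ge0.
have S0 : 0 <= S by apply: sumr_ge0 => j _; exact: sqr_ge0.
apply: (@le_trans _ _ (gw (y k) * ((1 + S) * G))); last first.
  by rewrite ler_wpM2l// gweight_ge0.
rewrite /gw /gweight (_ : (1 + y k ^+ 2) * g (y k) * ((1 + S) * G) =
  ((1 + y k ^+ 2) * (1 + S)) * (g (y k) * G)); last by ring.
apply: ler_wpM2r; first by rewrite mulr_ge0// gauss1_ge0.
by have := sqr_ge0 (y k); set x := y k ^+ 2; nra.
Qed.

Let cs := rev (iota 0 n).
Let us : uniq cs. Proof. by rewrite rev_uniq iota_uniq. Qed.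
Let igw := integrable_gweight R.

Let dens f (x : nat -> R) := f (row_of n x) * \prod_(i < n) g (x i).

Lemma sum_coords_row (F : nat -> R) : \sum_(k <- cs) F k = \sum_(i < n) F i.
Proof. by rewrite /cs (perm_big (index_iota 0 n)) ?big_mkord// /index_iota subn0 perm_rev. Qed.

Lemma prod_coords_row (F : nat -> R) : \prod_(k <- cs) F k = \prod_(i < n) F i.
Proof. by rewrite /cs (perm_big (index_iota 0 n)) ?big_mkord// /index_iota subn0 perm_rev. Qed.

Lemma std_normal_EE f : std_normal_E f = Ints cs (dens f) (fun=> 0).
Proof. by rewrite /std_normal_E iintE. Qed.

Lemma dens_dominated f : quad_growth f -> dominated gw cs (dens f).
Proof.
move=> [mf [C C0 HC]]; split.
  move=> d' S' p mp; apply: measurable_funM; first exact: mf.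
  apply: (@measurable_prod _ _ _ _ _ (index_enum 'I_n) (fun i s => g (p s i))) => i _.
  exact: (measurableT_comp (@measurable_gauss1 R) (mp i)).
exists C => // y; rewrite /dens normrM -(prod_coords_row (fun k => g (y k))).
rewrite [`|\prod_(k <- cs) _|]ger0_norm; last by apply: prodr_ge0 => j _; exact: gauss1_ge0.
apply: le_trans (_ : C * ((1 + \sum_(k <- cs) y k ^+ 2) * \prod_(k <- cs) g (y k)) <= _).
  rewrite mulrA ler_wpM2r//; first by apply: prodr_ge0 => j _; exact: gauss1_ge0.
  apply: le_trans (HC _) _; rewrite ler_wpM2l// lerD2l (sum_coords_row (fun k => y k ^+ 2)).
  by under eq_bigr do rewrite mxE.
by rewrite ler_wpM2l// prod_gweight_ge.
Qed.

Lemma quad_growth_bounded f C : row_measurable f -> (forall v, `|f v| <= C) -> quad_growth f.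
Proof.
move=> mf HC; split => //; exists C; first exact: le_trans (normr_ge0 _) (HC 0).
move=> v; rewrite (le_trans (HC v))// ler_peMr ?lerDl ?sumr_ge0//.
  exact: le_trans (normr_ge0 _) (HC 0).
by move=> i _; exact: sqr_ge0.
Qed.

Lemma quad_growthD f1 f2 : quad_growth f1 -> quad_growth f2 ->
  quad_growth (fun v => f1 v + f2 v).
Proof.
move=> [m1 [C1 C10 H1]] [m2 [C2 C20 H2]]; split; first exact: row_measurableD.
exists (C1 + C2); first exact: addr_ge0.
by move=> v; rewrite mulrDl (le_trans (ler_normD _ _))// lerD.
Qed.

Lemma quad_growthZ f a : quad_growth f -> quad_growth (fun v => a * f v).
Proof.
move=> [m1 [C1 C10 H1]]; split.
  by apply: row_measurableM => //; exact: row_measurable_cst.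
exists (`|a| * C1); first exact: mulr_ge0.
by move=> v; rewrite normrM -mulrA ler_wpM2l.
Qed.

Lemma quad_growth_sum (I : Type) (s : seq I) (F : I -> 'rV[R]_n -> R) :
  (forall i, quad_growth (F i)) -> quad_growth (fun v => \sum_(i <- s) F i v).
Proof.
move=> HF; elim: s => [|i s IH].
  under eq_fun do rewrite big_nil.
  by apply: (@quad_growth_bounded _ 0) => [|v]; [exact: row_measurable_cst|rewrite normr0].
by under eq_fun do rewrite big_cons; exact: quad_growthD.
Qed.

Lemma std_normal_ED f1 f2 : quad_growth f1 -> quad_growth f2 ->
  std_normal_E (fun v => f1 v + f2 v) = std_normal_E f1 + std_normal_E f2.
Proof.
move=> H1 H2; rewrite !std_normal_EE.
rewrite -(IntsD (@gweight_ge0 R) igw (s' := [::])) ?cats0//; try exact: dens_dominated.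
by congr (Ints _ _ _); apply/funext => x; rewrite /dens mulrDl.
Qed.

Lemma std_normal_EZ a f : quad_growth f ->
  std_normal_E (fun v => a * f v) = a * std_normal_E f.
Proof.
move=> H; rewrite !std_normal_EE.
rewrite -(IntsZ (@gweight_ge0 R) igw (s' := [::])) ?cats0//; try exact: dens_dominated.
by congr (Ints _ _ _); apply/funext => x; rewrite /dens mulrA.
Qed.

Lemma le_std_normal_E f1 f2 : quad_growth f1 -> quad_growth f2 ->
  (forall v, f1 v <= f2 v) -> std_normal_E f1 <= std_normal_E f2.
Proof.
move=> H1 H2 H12; rewrite !std_normal_EE.
apply: (le_Ints (@gweight_ge0 R) igw (s' := [::])); rewrite ?cats0//; try exact: dens_dominated.
by move=> y; rewrite /dens ler_wpM2r//; apply: prodr_ge0 => j _; exact: gauss1_ge0.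
Qed.

Lemma std_normal_E_cos (a : 'rV[R]_n) c :
  std_normal_E (fun v => cos (\sum_i a ord0 i * v ord0 i + c)) =
  expR (- (\sum_i a ord0 i ^+ 2) / 2) * cos c.
Proof.
pose a' (k : nat) := if insub k is Some i then a ord0 i else 0.
have a'E (i : 'I_n) : a' i = a ord0 i by rewrite /a' valK.
rewrite std_normal_EE.
have := @Ints_cos cs (fun=> 1) a' (fun=> c) (fun=> 0) us (@invariant_on_cst cs 1) (@invariant_on_cst cs c).
rewrite mul1r (sum_coords_row (fun k => a' k ^+ 2)).
under [in X in _ = X -> _]eq_bigr do rewrite a'E.
move=> <-; congr (Ints _ _ _); apply/funext => x.
rewrite /dens mul1r (prod_coords_row (fun k => g (x k))) (sum_coords_row (fun k => a' k * x k)).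
congr (cos (_ + _) * _); apply: eq_bigr => i _.
by rewrite a'E mxE.
Qed.

End StdNormal.

(** * Approximation by trigonometric polynomials *)

Section TrigPolynomials.
Variables (R : realType) (k : nat).
Implicit Types (f h : 'rV[R]_k -> R) (x y t : 'rV[R]_k).

Inductive trigpoly : ('rV[R]_k -> R) -> Prop :=
| trigpoly_cos t c : trigpoly (fun x => cos (\sum_i t ord0 i * x ord0 i + c))
| trigpolyD f h : trigpoly f -> trigpoly h -> trigpoly (fun x => f x + h x)
| trigpolyZ a f : trigpoly f -> trigpoly (fun x => a * f x).

Lemma trigpoly_cst a : trigpoly (fun=> a).
Proof.
have := trigpolyZ a (trigpoly_cos 0 0); congr (trigpoly _); apply/funext => x.
by rewrite big1 ?addr0 ?cos0 ?mulr1// => i _; rewrite mxE mul0r.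
Qed.

Lemma trigpoly_sin (i : 'I_k) a : trigpoly (fun x => sin (a * x ord0 i)).
Proof.
have := trigpoly_cos (\row_j (if j == i then a else 0)) (- (pi / 2)).
congr (trigpoly _); apply/funext => x; rewrite cosBpihalf (bigD1 i)//= mxE eqxx.
by rewrite big1 ?addr0// => j ji; rewrite mxE (negbTE ji) mul0r.
Qed.

Lemma trigpolyM f h : trigpoly f -> trigpoly h -> trigpoly (fun x => f x * h x).
Proof.
move=> tf th; elim: tf => [t c|f1 f2 _ H1 _ H2|a f1 _ H1].
- elim: th => [t' c'|f1 f2 _ H1 _ H2|a f1 _ H1].
  + have := trigpolyZ 2^-1 (trigpolyD (trigpoly_cos (t + t') (c + c'))
                                      (trigpoly_cos (t - t') (c - c'))).
    congr (trigpoly _); apply/funext => x.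
    rewrite (_ : \sum_i (t + t') _ _ * _ + _ = (\sum_i t ord0 i * x ord0 i + c) + (\sum_i t' ord0 i * x ord0 i + c')); last first.
      by rewrite addrACA -big_split/=; congr (_ + _); apply: eq_bigr => i _; rewrite mxE mulrDl.
    rewrite (_ : \sum_i (t - t') _ _ * _ + _ = (\sum_i t ord0 i * x ord0 i + c) - (\sum_i t' ord0 i * x ord0 i + c')); last first.
      rewrite opprD addrACA -sumrB; congr (_ + _); apply: eq_bigr => i _.
      by rewrite !mxE mulrBl.
    by rewrite cosD cosB; field.
  + under eq_fun do rewrite mulrDr; exact: trigpolyD.
  + under eq_fun do rewrite mulrCA; exact: trigpolyZ.
- under eq_fun do rewrite mulrDl; exact: trigpolyD.
- under eq_fun do rewrite -mulrA; exact: trigpolyZ.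
Qed.

Lemma trigpoly_quad_growth f : trigpoly f -> quad_growth f.
Proof.
elim=> [t c|f1 f2 _ H1 _ H2|a f1 _ H1].
- apply: (@quad_growth_bounded _ _ _ 1).
    apply: (@row_measurable_comp _ _ cos).
      by apply: continuous_measurable_fun; exact: continuous_cos.
    apply: row_measurableD; last exact: row_measurable_cst.
    apply: row_measurable_sum => i; apply: row_measurableM.
      exact: row_measurable_cst.
    exact: row_measurable_coord.
  by move=> v; rewrite ler_norml cos_geN1 cos_le1.
- exact: quad_growthD.
- exact: quad_growthZ.
Qed.

(* A recursive form of the multivariate Bernstein operator: [walk_mean p s h n]
   is the mean of [h] at the end of a random walk from [n] whose steps, listed
   in [s], move coordinate [i] up with probability [p i]. *)
Definition walk_step (p : 'I_k -> R) (i : 'I_k) (h : ('I_k -> nat) -> R) n :=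
  (1 - p i) * h n + p i * h (fun j => n j + (j == i))%N.

Definition walk_mean p (s : seq 'I_k) (h : ('I_k -> nat) -> R) := foldr (walk_step p) h s.

Lemma walk_mean_near p s (h g : ('I_k -> nat) -> R) a : (forall i, 0 <= p i <= 1) ->
  (forall n, `|a - h n| <= g n) -> forall n, `|a - walk_mean p s h n| <= walk_mean p s g n.
Proof.
move=> Hp H; elim: s => [|i s IH]//= n; rewrite /walk_step.
have /andP[p0 p1] := Hp i; set u := walk_mean _ _ _ _; set v := walk_mean _ _ _ _.
rewrite (_ : a - _ = (1 - p i) * (a - u) + p i * (a - v)); last by ring.
rewrite (le_trans (ler_normD _ _))// !normrM (ger0_norm p0) ger0_norm ?subr_ge0//.
by rewrite lerD// ler_wpM2l ?subr_ge0// IH.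
Qed.

(** Coordinatewise, the squared offset of the mean plus the binomial variance N (p - p^2). *)
Lemma walk_mean_sqr p s e D (a : 'I_k -> R) n :
  walk_mean p s (fun n => e + D * \sum_i ((n i)%:R - a i) ^+ 2) n =
  e + D * \sum_i (((n i)%:R - a i + (count_mem i s)%:R * p i) ^+ 2 +
     (count_mem i s)%:R * (p i - p i ^+ 2)).
Proof.
elim: s n => [|j s IH] n /=.
  by congr (_ + _ * _); apply: eq_bigr => i _; rewrite !mul0r !addr0.
rewrite /walk_step !IH (bigD1 j)//= [in X in _ + _ * (_ + D * X)](bigD1 j)//=.
rewrite [in RHS](bigD1 j)//= !eqxx.
rewrite [X in _ + _ * (_ + D * (_ + X))](eq_bigr (fun i => ((n i)%:R - a i + (count_mem i s)%:R * p i) ^+ 2 + (count_mem i s)%:R * (p i - p i ^+ 2))); last first.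
  by move=> i ij; rewrite (negbTE ij) addn0.
rewrite [X in _ = _ + _ * (_ + X)](eq_bigr (fun i => ((n i)%:R - a i + (count_mem i s)%:R * p i) ^+ 2 + (count_mem i s)%:R * (p i - p i ^+ 2))); last first.
  by move=> i ij; rewrite [j == i]eq_sym (negbTE ij) add0n.
by rewrite !natrD -[nat_of_bool true]/1%N; ring.
Qed.

Lemma trigpoly_walk_mean (p : 'rV[R]_k -> 'I_k -> R) s (h : ('I_k -> nat) -> R) n :
  (forall i, trigpoly (fun x => p x i)) -> trigpoly (fun x => walk_mean (p x) s h n).
Proof.
move=> Hp; elim: s n => [|i s IH] n /=; first exact: trigpoly_cst.
apply: trigpolyD; apply: trigpolyM => //.
apply: trigpolyD; first exact: trigpoly_cst.
by under eq_fun do rewrite -mulN1r; exact: trigpolyZ.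
Qed.

(** Uniform continuity from the near-covering form of compactness. Halving the radius around each
    point leaves room for y, which may lie outside the cube. *)
Lemma continuous_box_modulus f L e : continuous f -> 0 < e ->
  exists2 eta, 0 < eta & forall x y, (forall i, `|x ord0 i| <= L) ->
    (forall i, `|x ord0 i - y ord0 i| < eta) -> `|f x - f y| < e.
Proof.
move=> cf e0.
pose K := [set x : 'rV[R]_k | forall i, `[- L, L]%classic (x ord0 i)].
have cK : compact K.
  by apply: (@rV_compact _ _ (fun=> `[- L, L]%classic)) => i; exact: segment_compact.
pose Pr (eta : R) x := forall y, (forall i, `|x ord0 i - y ord0 i| < eta) -> `|f x - f y| < e.
have nK : \forall eta \near 0^'+, K `<=` Pr eta.
  have /(_ _ 0^'+ Pr) := (compact_near_coveringP K).1 cK; apply => x Kx.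
  have [r r0 Hr] : exists2 r, 0 < r & forall y, ball x r y -> `|f x - f y| < e / 2.
    have /cvgrPdist_lt/(_ (e / 2)) := cf x; rewrite divr_gt0// => /(_ isT).
    by move=> /nbhs_ballP[r r0 Hr]; exists r.
  exists (ball x (r / 2), [set t | 0 < t < r / 2]).
    split; first by apply: nbhsx_ballx; rewrite divr_gt0.
    have r20 : 0 < r / 2 by rewrite divr_gt0.
    near=> t; apply/andP; split; first by near: t; exact: nbhs_right_gt.
    by near: t; exact: nbhs_right_lt.
  move=> [x' t] /= [[_ Hx'] /andP[t0 tr]] y Hy.
  have H1 : `|f x - f x'| < e / 2.
    apply: Hr; split => // i j; apply: le_ball (Hx' i j).
    by rewrite ler_pdivrMr// ler_peMr ?ltW//; lra.
  have H2 : `|f x - f y| < e / 2.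
    apply: Hr; split => // i j; have := Hx' i j; have := Hy j.
    rewrite /ball/= (ord1 i) => h1 h2.
    rewrite (_ : x ord0 j - y ord0 j = (x ord0 j - x' ord0 j) + (x' ord0 j - y ord0 j)); last by ring.
    by rewrite (le_lt_trans (ler_normD _ _))//; lra.
  rewrite (_ : f x' - f y = (f x - f y) - (f x - f x')); last by ring.
  by rewrite (le_lt_trans (ler_normB _ _))//; lra.
have [eta [eta0 Heta]] : exists eta, 0 < eta /\ K `<=` Pr eta.
  near (0 : R)^'+ => eta; exists eta; split; near: eta => //.
  exact: nbhs_right_gt.
exists eta => // x y Hx; apply: Heta => i /=.
by rewrite in_itv/= -ler_norml.
Unshelve. all: by end_near. Qed.

(** With h = (a - b)/2 and g = (a + b)/2, the difference of sines is 2 sin h cos g. For b <= a the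
    bound |g| <= pi/2 - h gives cos g >= sin h, so the difference is at least 2 (sin m)^2 once h >=
    m. *)
Lemma sin_separates (eta : R) : 0 < eta -> exists2 delta, 0 < delta &
  forall a b : R, `|a| <= pi / 2 -> `|b| <= pi / 2 ->
    `|sin a - sin b| < delta -> `|a - b| < eta.
Proof.
move=> eta0; have pi0 := @pihalf_02 R; pose m := Num.min (eta / 2) (pi / 2).
have m0 : 0 < m by rewrite lt_min divr_gt0//=; lra.
have mpi : m <= pi / 2 by rewrite ge_min lexx orbT.
have sm0 : 0 < sin m by apply: sin_gt0_pi; rewrite m0/=; lra.
exists (2 * sin m ^+ 2); first by rewrite mulr_gt0// exprn_gt0.
suff main (a b : R) : `|a| <= pi / 2 -> `|b| <= pi / 2 -> b <= a ->
    `|sin a - sin b| < 2 * sin m ^+ 2 -> `|a - b| < eta.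
  move=> a b Ha Hb; case: (leP b a) => [|/ltW] ba; first exact: main.
  by rewrite distrC [X in _ -> X < _]distrC; exact: main.
rewrite !ler_norml => /andP[a1 a2] /andP[b1 b2] ba; apply: contraTT; rewrite -!leNgt => Hab.
rewrite ger0_norm ?subr_ge0// in Hab.
set h := (a - b) / 2; set g := (a + b) / 2.
have h1 : m <= h by rewrite ge_min; apply/orP; left; rewrite /h; lra.
have h2 : h <= pi / 2 by rewrite /h; lra.
have sh : sin m <= sin h.
  have [mh|hm|->//] := ltrgtP m h; last by lra.
  by rewrite ltW// ltr_sin// in_itv/=; apply/andP; split; lra.
have cg : sin h <= cos g.
  have step (z : R) : 0 <= z -> z <= pi / 2 - h -> sin h <= cos z.
    move=> z0 z1; rewrite -sinDpihalf -[_ + pi / 2]opprK sinN -[X in _ <= - sin X]addr0.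
    rewrite (_ : - (z + pi / 2) + 0 = (pi / 2 - z) - pi); last by field.
    rewrite sinB cospi sinpi mulr0 subr0 mulrN1 opprK.
    have [hz|hz|->//] := ltrgtP h (pi / 2 - z); last by lra.
    by rewrite ltW// ltr_sin// in_itv/=; apply/andP; split; lra.
  case: (leP 0 g) => [g0|/ltW g0]; first by apply: step => //; rewrite /g /h; lra.
  by rewrite -cosN; apply: step; rewrite ?oppr_ge0// /g /h; lra.
have -> : sin a - sin b = 2 * (sin h * cos g).
  have -> : a = g + h by rewrite /g /h; field.
  have -> : b = g - h by rewrite /g /h; field.
  by rewrite sinD sinB; ring.
rewrite ger0_norm; last first.
  by apply: mulr_ge0 => //; apply: mulr_ge0; apply: le_trans sh _ || apply: le_trans (ltW sm0) _ => //; lra.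
by rewrite expr2; apply: ler_wpM2l => //; apply: ler_pM; lra.
Qed.

(* Far from the origin the sum of squares dominates. On a large cube the
   sin (x_i / c) separate points, and the Bernstein operator in the variables
   (1 + sin (x_i / c)) / 2 yields trigonometric polynomials. *)
Lemma trigpoly_dense f C e : continuous f -> (forall x, `|f x| <= C) -> 0 < e ->
  exists2 h, trigpoly h & forall x, `|f x - h x| <= e * (1 + \sum_i x ord0 i ^+ 2).
Proof.
move=> cf HC e0.
have C0 : 0 <= C := le_trans (normr_ge0 _) (HC 0).
(* Chosen so that 2C <= e L^2: outside the cube of half-side L the trivial error 2C is covered by e
   |x|^2. *)
pose L := 2 * C / e + 1.
have Ce0 : 0 <= 2 * C / e by rewrite divr_ge0 ?mulr_ge0// ltW.
have L1 : 1 <= L by rewrite /L; lra.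
have LC : 2 * C <= e * L ^+ 2.
  have : 2 * C / e <= L ^+ 2 by rewrite expr2 /L; nra.
  by rewrite ler_pdivrMr// [_ * e]mulrC.
have pi0 := @pihalf_02 R.
(* This scale maps the cube onto [-pi/2, pi/2] in each coordinate, where the sine is injective. *)
pose c := L / (pi / 2).
have c0 : 0 < c by rewrite divr_gt0; lra.
have [|eta eta0 Heta] := @continuous_box_modulus f L (e / 2) cf; first by rewrite divr_gt0.
have [|delta1 delta1_gt0 Hdelta] := @sin_separates (eta / c); first by rewrite divr_gt0.
(* Halved because sines are compared through p = (1 + sin)/2. *)
pose delta := delta1 / 2.
have delta0 : 0 < delta by rewrite divr_gt0.
(* m is the number of steps per coordinate; this size makes the variance term D m k at most e/2. *)
have [m m0 Hm] : exists2 m, (0 < m)%N & (2 * C * k%:R / (delta ^+ 2 * (e / 2)) <= m%:R :> R).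
  exists (Num.Def.truncn (2 * C * k%:R / (delta ^+ 2 * (e / 2)))).+1 => //.
  by rewrite ltW// truncnS_gt.
have m0' : 0 < m%:R :> R by rewrite ltr0n.
pose p x (i : 'I_k) := 2^-1 * (1 + sin (c^-1 * x ord0 i)).
have p01 x i : 0 <= p x i <= 1.
  have := sin_geN1 (c^-1 * x ord0 i); have := sin_le1 (c^-1 * x ord0 i).
  by rewrite /p; set z := sin _ => h1 h2; apply/andP; split; lra.
(* The cap at 1 keeps the argument of [asin] in range, since the estimate below is made for every
   position n. *)
pose q (n : nat) := Num.min (n%:R / m%:R) (1 : R).
pose node (n : 'I_k -> nat) : 'rV[R]_k := \row_i (c * asin (2 * q (n i) - 1)).
pose s := flatten [seq nseq m i | i <- enum 'I_k].
have cs i : count_mem i s = m.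
  rewrite /s count_flatten -map_comp sumnE big_map.
  rewrite (bigD1_seq i) ?mem_enum ?enum_uniq//= count_nseq/= eqxx mul1n big1 ?addn0// => j ji.
  by rewrite count_nseq/= (negbTE ji) mul0n.
pose D := 2 * C / (m%:R * delta) ^+ 2.
have D0 : 0 <= D by apply: divr_ge0; [exact: mulr_ge0|exact: sqr_ge0].
exists (fun x => walk_mean (p x) s (fun n => f (node n)) (fun=> 0%N)).
  apply: trigpoly_walk_mean => i; apply: trigpolyZ; apply: trigpolyD.
    exact: trigpoly_cst.
  exact: trigpoly_sin.
move=> x; set X := \sum_i _.
have X0 : 0 <= X by apply: sumr_ge0 => i _; exact: sqr_ge0.
(* Three cases: x outside the cube, where e |x|^2 pays; some coordinate of n far from its mean,
   where the D term exceeds 2C; otherwise the node is near x and the modulus of continuity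
   applies. *)
have main n : `|f x - f (node n)| <= (e / 2 + e * X) + D * \sum_i ((n i)%:R - m%:R * p x i) ^+ 2.
  set Y := \sum_i ((n i)%:R - _) ^+ 2.
  have Y0 : 0 <= Y by apply: sumr_ge0 => i _; exact: sqr_ge0.
  have F2C : `|f x - f (node n)| <= 2 * C.
    by rewrite (le_trans (ler_normB _ _))//; have := HC x; have := HC (node n); lra.
  have DY0 : 0 <= D * Y by exact: mulr_ge0.
  have eX0 : 0 <= e * X by rewrite mulr_ge0// ltW.
  case: (boolP [exists i, L < `|x ord0 i|]) => [/existsP[i Li]|].
    apply: le_trans F2C _; apply: le_trans LC _.
    have : L ^+ 2 <= X.
      rewrite /X (bigD1 i)//= -[leLHS]addr0 lerD ?sumr_ge0//; last by move=> j _; exact: sqr_ge0.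
      by rewrite -[x ord0 i ^+ 2]real_normK ?num_real// lerXn2r ?nnegrE// ?ltW//; lra.
    by move=> /(ler_wpM2l (ltW e0)); lra.
  rewrite negb_exists => /forallP Hx.
  have {}Hx i : `|x ord0 i| <= L by rewrite leNgt.
  case: (boolP [exists i, m%:R * delta <= `|(n i)%:R - m%:R * p x i|]) => [/existsP[i Li]|].
    apply: le_trans F2C _.
    have : (m%:R * delta) ^+ 2 <= Y.
      rewrite /Y (bigD1 i)//= -[leLHS]addr0 lerD ?sumr_ge0//; last by move=> j _; exact: sqr_ge0.
      rewrite -[X in _ <= X]real_normK ?num_real// lerXn2r ?nnegrE//.
      by rewrite mulr_ge0// ltW.
    move=> /(ler_wpM2l D0); rewrite {1}/D divfK; last first.
      by rewrite expf_neq0// mulf_neq0 ?gt_eqF.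
    by lra.
  rewrite negb_exists => /forallP Hn.
  suff : `|f x - f (node n)| < e / 2 by lra.
  apply: Heta => // i; have := Hn i; rewrite -ltNge => {}Hn.
  have qi : 0 <= q (n i) <= 1.
    by rewrite ge_min lexx orbT andbT le_min ler01 divr_ge0.
  have nodeI : -1 <= 2 * q (n i) - 1 <= 1 by move: qi => /andP[? ?]; apply/andP; split; lra.
  rewrite mxE (_ : x ord0 i = c * (c^-1 * x ord0 i)); last by rewrite mulVKf ?gt_eqF.
  rewrite -mulrBr normrM (gtr0_norm c0) mulrC -ltr_pdivlMr//.
  apply: Hdelta.
  - rewrite normrM gtr0_norm ?invr_gt0// ler_pdivrMl// /c divfK//; lra.
  - by rewrite ler_norml asin_geNpi2// asin_lepi2.
  - rewrite asinK ?in_itv//= (_ : _ - _ = 2 * (p x i - q (n i))); last by rewrite /p; field.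
    rewrite normrM ger0_norm// mulrC -ltr_pdivlMr//.
    have Hn' : `|p x i - (n i)%:R / m%:R| < delta.
      rewrite distrC -(ltr_pM2l m0') -[X in X * `|_|](gtr0_norm m0') -normrM.
      by rewrite mulrBr [_ * (_ / _)]mulrC divfK ?gt_eqF.
    apply: le_lt_trans Hn'; rewrite /q /Num.min; case: ltP => // h1.
    have /andP[p0 p1] := p01 x i.
    by rewrite !ler0_norm ?subr_le0//; lra.
apply: le_trans (walk_mean_near s (p01 x) main (fun=> 0%N)) _.
rewrite walk_mean_sqr.
have : \sum_i ((0%:R - m%:R * p x i + (count_mem i s)%:R * p x i) ^+ 2 +
    (count_mem i s)%:R * (p x i - p x i ^+ 2)) <= m%:R * k%:R.
  rewrite -[X in _ * X%:R]card_ord mulr_natr -sumr_const.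
  apply: ler_sum => i _; rewrite cs sub0r addNr expr0n/= add0r.
  rewrite -[leRHS]mulr1 ler_wpM2l ?ler0n//; have /andP[p0 p1] := p01 x i.
  by have := sqr_ge0 (p x i); lra.
move=> /(ler_wpM2l D0) HD.
have : D * (m%:R * k%:R) <= e / 2.
  move: Hm; rewrite ler_pdivrMr ?mulr_gt0 ?exprn_gt0 ?divr_gt0// => Hm.
  rewrite /D (_ : _ * _ = (2 * C * k%:R) / (m%:R * delta ^+ 2)); last first.
    by field; rewrite !gt_eqF.
  rewrite ler_pdivrMr ?mulr_gt0 ?exprn_gt0//.
  by rewrite (_ : e / 2 * _ = m%:R * (delta ^+ 2 * (e / 2))); [|ring].
by rewrite mulrDr mulr1; lra.
Qed.

End TrigPolynomials.

(** * Weak convergence *)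

Section WeakConvergence.
Variables (R : realType) (k : nat).
Implicit Types (f h : 'rV[R]_k -> R) (E : ('rV[R]_k -> R) -> R).

(** Trigonometric polynomials are measurable along coordinates, and density with errors 1/(n+1)
    makes f their pointwise limit. *)
Lemma row_measurable_continuous f C : continuous f -> (forall x, `|f x| <= C) ->
  row_measurable f.
Proof.
move=> cf HC d' S p mp.
have /choice[h Hh] : forall n, exists h, trigpoly h /\
    forall x, `|f x - h x| <= n.+1%:R^-1 * (1 + \sum_i x ord0 i ^+ 2).
  by move=> n; have [|h th Hh] := @trigpoly_dense _ _ f C n.+1%:R^-1 cf HC; [rewrite invr_gt0|exists h].
apply: (@measurable_fun_cvg _ _ _ setT (fun n s => h n (row_of k (p s)))).
  by move=> n; have [mh _] := trigpoly_quad_growth (Hh n).1; exact: mh.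
move=> s _; set x := row_of k (p s).
have : (fun n => n.+1%:R^-1 * (1 + \sum_i x ord0 i ^+ 2)) @ \oo --> (0 : R).
  by rewrite -[X in _ --> X](mul0r (1 + \sum_i x ord0 i ^+ 2)); apply: cvgMr_tmp; exact: cvg_harmonic.
move=> /cvgrPdist_le Hc; apply/cvgrPdist_le => e /Hc; apply: filterS => n.
rewrite sub0r normrN => /(le_trans (ler_norm _)); apply: le_trans; exact: (Hh n).2.
Qed.

(** The laws of the scaled sums and the normal law enter only through this interface; quadratic
    growth admits the weight 1 + |x|^2 as a test function. *)
Definition positive_linear E : Prop :=
  [/\ forall f h, quad_growth f -> quad_growth h -> E (fun x => f x + h x) = E f + E h,
      forall a f, quad_growth f -> E (fun x => a * f x) = a * E f
    & forall f h, quad_growth f -> quad_growth h -> (forall x, f x <= h x) -> E f <= E h].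

Let qsum := fun x : 'rV[R]_k => 1 + \sum_i x ord0 i ^+ 2.

Lemma quad_growth_qsum : quad_growth qsum.
Proof.
split; last by exists 1 => // v; rewrite mul1r ger0_norm// addr_ge0// sumr_ge0// => i _; exact: sqr_ge0.
apply: row_measurableD; first exact: row_measurable_cst.
by apply: row_measurable_sum => i; apply: row_measurableM; exact: row_measurable_coord.
Qed.

Lemma positive_linear_near E f h e B : positive_linear E -> quad_growth f -> quad_growth h ->
  0 <= e -> (forall x, `|f x - h x| <= e * qsum x) -> E qsum <= B -> `|E f - E h| <= e * B.
Proof.
move=> [ED EZ El] qf qh e0 H EB.
have qe : quad_growth (fun x => e * qsum x) by exact/quad_growthZ/quad_growth_qsum.
have eB : E (fun x => e * qsum x) <= e * B by rewrite EZ ?ler_wpM2l//; exact: quad_growth_qsum.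
have H1 : E f <= E h + E (fun x => e * qsum x).
  rewrite -ED//; apply: El => //; first exact: quad_growthD.
  by move=> x; have := H x; rewrite ler_norml => /andP[_]; rewrite lerBlDl.
have H2 : E h <= E f + E (fun x => e * qsum x).
  rewrite -ED//; apply: El => //; first exact: quad_growthD.
  by move=> x; have := H x; rewrite distrC ler_norml => /andP[_]; rewrite lerBlDl.
by rewrite ler_norml; apply/andP; split; lra.
Qed.

(** An error e (1 + |x|^2) costs at most e B under every functional, uniformly in n; three such
    thirds finish the argument. *)
Lemma positive_linear_cvg (E : nat -> ('rV[R]_k -> R) -> R) E0 B0 f C :
  (forall n, positive_linear (E n)) -> positive_linear E0 ->
  (forall n, E n qsum <= B0) ->
  (forall t c, (fun n => E n (fun x : 'rV[R]_k => cos (\sum_i (t : 'rV[R]_k) ord0 i * x ord0 i + c))) @ \oo -->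
     E0 (fun x : 'rV[R]_k => cos (\sum_i (t : 'rV[R]_k) ord0 i * x ord0 i + c))) ->
  continuous f -> (forall x, `|f x| <= C) -> (fun n => E n f) @ \oo --> E0 f.
Proof.
move=> HE HE0 Hqsum Hcos cf HC; pose B := Num.max B0 (E0 qsum).
have HB n : E n qsum <= B by rewrite le_max Hqsum.
have HB0 : E0 qsum <= B by rewrite le_max lexx orbT.
have Htrig h : trigpoly h -> (fun n => E n h) @ \oo --> E0 h.
  elim=> [t c|f1 f2 t1 H1 t2 H2|a f1 t1 H1]; first exact: Hcos.
  - have [q1 q2] := (trigpoly_quad_growth t1, trigpoly_quad_growth t2).
    have [ED _ _] := HE0; rewrite ED//.
    under eq_cvg => n do have [/(_ _ _ q1 q2) -> _ _] := HE n.
    exact: cvgD.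
  - have q1 := trigpoly_quad_growth t1.
    have [_ EZ _] := HE0; rewrite EZ//.
    under eq_cvg => n do have [_ /(_ a _ q1) -> _] := HE n.
    exact: cvgMl_tmp.
have qf : quad_growth f := quad_growth_bounded (row_measurable_continuous cf HC) HC.
apply/cvgrPdist_le => e e0.
have B1 : 0 < `|B| + 1 by rewrite ltr_wpDl.
have [|h th Hh] := @trigpoly_dense _ _ f C (e / 3 / (`|B| + 1)) cf HC.
  by rewrite !divr_gt0.
have qh := trigpoly_quad_growth th.
have near_h E' : positive_linear E' -> E' qsum <= B -> `|E' f - E' h| <= e / 3.
  move=> HE' HB'; rewrite (le_trans (positive_linear_near HE' qf qh _ Hh HB'))//.
    by rewrite !divr_ge0// ltW.
  rewrite -[leRHS]mulr1 -(mulrA (e / 3)) ler_wpM2l ?divr_ge0 ?(ltW e0)//.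
  by rewrite ler_pdivrMl// mulr1 (le_trans (ler_norm B))// lerDl.
have := Htrig _ th => /cvgrPdist_le/(_ (e / 3)); rewrite divr_gt0// => /(_ isT).
apply: filterS => n Hn; have := near_h _ HE0 HB0; have := near_h _ (HE n) (HB n) => H1 H2.
rewrite (_ : E0 f - E n f = (E0 f - E0 h) + (E0 h - E n h) - (E n f - E n h)); last by ring.
rewrite (le_trans (ler_normB _ _))// (_ : e = (e / 3 + e / 3) + e / 3); last by field.
by rewrite lerD// (le_trans (ler_normD _ _))// lerD.
Qed.

Section Normal.
Variable A : 'M[R]_k.

Lemma quad_growth_coordM i j : quad_growth (fun v : 'rV[R]_k => v ord0 i * v ord0 j).
Proof.
split; first by apply: row_measurableM; exact: row_measurable_coord.
exists 1 => // v; rewrite mul1r.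
have coord_le l : v ord0 l ^+ 2 <= \sum_i v ord0 i ^+ 2.
  by rewrite (bigD1 l)//= lerDl sumr_ge0// => m _; exact: sqr_ge0.
have := coord_le i; have := coord_le j; set S := \sum_i _.
set a := v ord0 i; set b := v ord0 j => h1 h2.
have := sqr_ge0 (a - b); have := sqr_ge0 (a + b).
by rewrite ler_norml => h3 h4; apply/andP; split; nra.
Qed.

Lemma mulmx_trE (z : 'rV[R]_k) i : (z *m A^T) ord0 i = \sum_j z ord0 j * A i j.
Proof. by rewrite mxE; apply: eq_bigr => j _; rewrite mxE. Qed.

Lemma quad_growth_mulmx f : quad_growth f -> quad_growth (fun z => f (z *m A^T)).
Proof.
move=> [mf [C C0 HC]]; split.
  apply: row_measurable_lin => // i.
  under eq_fun do rewrite mulmx_trE.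
  apply: row_measurable_sum => j; apply: row_measurableM; first exact: row_measurable_coord.
  exact: row_measurable_cst.
have [_ [K K0 HK]] : quad_growth (fun z : 'rV[R]_k => qsum (z *m A^T)).
  apply: quad_growthD; first by apply: (@quad_growth_bounded _ _ _ 1) => [|v]; [exact: row_measurable_cst|rewrite normr1].
  apply: quad_growth_sum => i.
  have -> : (fun z : 'rV[R]_k => (z *m A^T) ord0 i ^+ 2) =
      (fun z => \sum_j \sum_l (A i j * A i l) * (z ord0 j * z ord0 l)).
    apply/funext => z; rewrite mulmx_trE expr2 mulr_suml; apply: eq_bigr => j _.
    by rewrite mulr_sumr; apply: eq_bigr => l _; ring.
  apply: quad_growth_sum => j; apply: quad_growth_sum => l.
  by apply: quad_growthZ; exact: quad_growth_coordM.
exists (C * K) => [|v]; first exact: mulr_ge0.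
rewrite (le_trans (HC _))// -mulrA ler_wpM2l//.
exact: le_trans (ler_norm _) (HK v).
Qed.

Lemma positive_linear_normal_E : positive_linear (normal_E A).
Proof.
split=> [f h qf qh|a f qf|f h qf qh fh]; rewrite /normal_E.
- by apply: (@std_normal_ED _ _ (fun z => f (z *m A^T))); exact: quad_growth_mulmx.
- by apply: (@std_normal_EZ _ _ a (fun z => f (z *m A^T))); exact: quad_growth_mulmx.
- by apply: le_std_normal_E => [||v]; [exact: quad_growth_mulmx|exact: quad_growth_mulmx|exact: fh].
Qed.

Lemma normal_E_cos (t : 'rV[R]_k) c :
  normal_E A (fun x => cos (\sum_i t ord0 i * x ord0 i + c)) =
  expR (- (t *m (A *m A^T) *m t^T) ord0 ord0 / 2) * cos c.
Proof.
transitivity (expR (- (\sum_i (t *m A) ord0 i ^+ 2) / 2) * cos c); last first.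
  congr (expR (- _ / 2) * _); rewrite !mulmxA -mulmxA -trmx_mul [RHS]mxE.
  by apply: eq_bigr => i _; rewrite [X in _ * X]mxE expr2.
rewrite -std_normal_E_cos /normal_E; congr std_normal_E; apply/funext => z.
congr (cos (_ + c)).
under eq_bigr do rewrite mulmx_trE mulr_sumr.
rewrite exchange_big/=; apply: eq_bigr => j _; rewrite mxE mulr_suml.
by apply: eq_bigr => i _; ring.
Qed.

End Normal.

Context d0 (T : measurableType d0) (P : probability T R).
Variable S : nat -> T -> 'rV[R]_k.
Hypothesis bS : forall n i, brv (fun w => S n w ord0 i).

Lemma brv_quad_growth n f : quad_growth f -> brv (fun w => f (S n w)).
Proof.
move=> [mf [C C0 HC]]; split.
  by apply: row_measurable_fun => // i; have [] := bS n i.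
have : brv (fun w => qsum (S n w)).
  apply: brvD; first exact: brv_cst.
  by apply: brv_sum => i; apply: brvM; exact: bS.
move=> [_ [K HK]]; exists (C * K) => w; rewrite (le_trans (HC _))// ler_wpM2l//.
exact: le_trans (ler_norm _) (HK w).
Qed.

Lemma Ex_cvg_normal_E (A : 'M[R]_k) B f C :
  (forall n, Ex P (fun w => qsum (S n w)) <= B) ->
  (forall t c, (fun n => Ex P (fun w => cos (\sum_i (t : 'rV[R]_k) ord0 i * S n w ord0 i + c))) @ \oo -->
     expR (- (t *m (A *m A^T) *m t^T) ord0 ord0 / 2) * cos c) ->
  continuous f -> (forall x, `|f x| <= C) ->
  (fun n => Ex P (fun w => f (S n w))) @ \oo --> normal_E A f.
Proof.
move=> HB Hcos cf HC.
apply: (@positive_linear_cvg (fun n h => Ex P (fun w => h (S n w))) _ B f C) => //.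
- move=> n; split=> [g h qg qh|a g qg|g h qg qh gh].
  + by apply: ExD; exact: brv_quad_growth.
  + by apply: ExZ; exact: brv_quad_growth.
  + by apply: le_Ex => [||w]; [exact: brv_quad_growth|exact: brv_quad_growth|exact: gh].
- exact: positive_linear_normal_E.
- by move=> t c; rewrite normal_E_cos; exact: Hcos.
Qed.

End WeakConvergence.

(** * Factorization of positive semidefinite matrices *)

Section Factorization.
Variable R : realType.
Implicit Types n : nat.

Definition quad_form n (M : 'M[R]_n) (t : 'rV[R]_n) : R := (t *m M *m t^T) ord0 ord0.

Lemma quad_form_block n (a s : R) (b u : 'rV[R]_n) (N : 'M[R]_n) :
  quad_form (block_mx a%:M b b^T N) (row_mx s%:M u) =
  s ^+ 2 * a + 2 * s * (u *m b^T) ord0 ord0 + quad_form N u.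
Proof.
have buE : (b *m u^T) ord0 ord0 = (u *m b^T) ord0 ord0.
  by rewrite -[in LHS](trmxK b) -trmx_mul mxE.
rewrite /quad_form mul_row_block tr_row_mx mul_row_col !mulmxDl tr_scalar_mx.
rewrite !mul_scalar_mx !mul_mx_scalar -scalemxAl.
have mE (X Y : 'M[R]_1) : (X + Y) ord0 ord0 = X ord0 ord0 + Y ord0 ord0 by rewrite mxE.
have zE c (X : 'M[R]_1) : (c *: X) ord0 ord0 = c * X ord0 ord0 by rewrite mxE.
rewrite !mE !zE buE (_ : a%:M ord0 ord0 = a); last by rewrite mxE eqxx mulr1n.
by ring.
Qed.

(* Either the corner entry is positive and one passes to the Schur
   complement, or it vanishes together with its row. *)
Lemma psd_factorization n (M : 'M[R]_n) : M^T = M -> (forall t, 0 <= quad_form M t) ->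
  exists A : 'M[R]_n, A *m A^T = M.
Proof.
elim: n M => [|n IH] M sM pM.
  by exists 0; apply/matrixP => i; have := ltn_ord i.
pose a := M ord0 ord0; pose M1 : 'M[R]_(1 + n) := M.
pose b := ursubmx M1; pose N := drsubmx M1.
have ulE : ulsubmx M1 = a%:M.
  by apply/matrixP => i j; rewrite !ord1 !mxE eqxx mulr1n; congr (M _ _); apply/val_inj.
have dlE : dlsubmx M1 = b^T by rewrite /b trmx_ursub /M1 sM.
have ME : M = block_mx a%:M b b^T N by rewrite -ulE -dlE /b /N submxK.
suff [A HA] : exists A : 'M[R]_(1 + n), A *m A^T = block_mx a%:M b b^T N.
  by exists A; rewrite ME -HA.
have sN : N^T = N by rewrite /N trmx_drsub /M1 sM.
have pB s u : 0 <= s ^+ 2 * a + 2 * s * (u *m b^T) ord0 ord0 + quad_form N u.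
  by rewrite -quad_form_block -ME.
have a0 : 0 <= a.
  have := pB 1 0; rewrite mul0mx /quad_form !mul0mx mxE mulr0 !addr0 expr1n mul1r.
  by [].
have [aE|an0] := eqVneq a 0.
  have bE : b = 0.
    apply/rowP => i; rewrite [RHS]mxE; apply/eqP/negPn/negP => bi.
    pose u : 'rV[R]_n := delta_mx ord0 i.
    have uE : (u *m b^T) ord0 ord0 = b ord0 i by rewrite -rowE [LHS]mxE [LHS]mxE.
    (* With a = 0 the form is affine in s; this s gives it the value -1, contradicting
       positivity. *)
    have := pB (- (quad_form N u + 1) / (2 * b ord0 i)) u.
    rewrite aE mulr0 add0r uE.
    rewrite (_ : 2 * _ * _ + _ = -1); first by rewrite ler0N1.
    by field.
  have [|A' HA'] := IH N sN.
    by move=> u; have := pB 0 u; rewrite expr0n !mulr0 !mul0r !add0r.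
  exists (block_mx 0 0 0 A'); rewrite tr_block_mx mulmx_block !trmx0 !mul0mx !mulmx0.
  by rewrite !add0r HA' bE aE trmx0 raddf0.
have a_gt0 : 0 < a by rewrite lt_def an0.
pose r := Num.sqrt a; have rr : r * r = a by rewrite -expr2 sqr_sqrtr.
have r0 : r != 0 by rewrite gt_eqF// sqrtr_gt0.
have bT (u : 'rV[R]_n) : quad_form (b^T *m b) u = (u *m b^T) ord0 ord0 ^+ 2.
  rewrite /quad_form mulmxA -mulmxA mxE big_ord1 expr2; congr (_ * _).
  by rewrite -[in LHS](trmxK b) -trmx_mul mxE.
have [||A' HA'] := IH (N - a^-1 *: (b^T *m b)).
- by rewrite raddfB/= linearZ/= sN trmx_mul trmxK.
(* This s minimizes the quadratic in s, and the minimum is the Schur complement form at u. *)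
- move=> u; have := pB (- (u *m b^T) ord0 ord0 / a) u.
  rewrite /quad_form mulmxBr mulmxBl -scalemxAr -scalemxAl -/(quad_form _ u).
  have -> (X Y : 'M[R]_1) c : (X - c *: Y) ord0 ord0 = X ord0 ord0 - c * Y ord0 ord0 by rewrite !mxE.
  rewrite -/(quad_form N u) -/(quad_form (b^T *m b) u) bT; congr (0 <= _).
  by field.
(* One step of a Cholesky factorization, with r the square root of the pivot. *)
exists (block_mx r%:M 0 (r^-1 *: b^T) A').
rewrite tr_block_mx mulmx_block !trmx0 !mul0mx !mulmx0 !addr0 tr_scalar_mx HA'.
rewrite -scalar_mxM rr linearZ/= trmxK mul_scalar_mx mul_mx_scalar !scalerA divff// !scale1r.
congr block_mx; rewrite -scalemxAl -scalemxAr scalerA -invfM rr addrC.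
by rewrite subrK.
Qed.

End Factorization.

(** * Joint moments *)

Section JointMoments.
Variables (R : realType) (d : nat) (rho : R) (Q : 'M[R]_d).
Hypothesis d_gt1 : (1 < d)%N.
Let d_gt0 : (0 < d)%N := ltnW d_gt1.
Hypotheses (rho0 : 0 <= rho) (rho1 : rho < 1) (QQ : Q *m Q^T = 1%:M).
Implicit Types (f : 'rV[R]_d -> 'rV[R]_d -> R) (u v : 'rV[R]_d) (i j k l : 'I_d).
Local Notation m := (@sphere_int R d).
Local Notation area := (@sphere_int R d (fun=> 1)).
Local Notation kd i j := ((i == j)%:R : R).

Definition joint_E f : R := m (fun u => m (fun v => f u v * cdens rho Q u v)).

Definition joint_mass : R := (Asurf R d ^+ 2)^-1 * area ^+ 2.

Lemma enorm_rotate u : enorm u = 1 -> enorm (rho *: (u *m Q)) = rho.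
Proof.
move=> u1; rewrite enormZ (ger0_norm rho0).
suff -> : enorm (u *m Q) = enorm u by rewrite u1 mulr1.
congr Num.sqrt; have tr_sqr (x : 'rV[R]_d) : \sum_i x ord0 i ^+ 2 = (x *m x^T) ord0 ord0.
  by rewrite mxE; apply: eq_bigr => i _; rewrite mxE expr2.
by rewrite !tr_sqr trmx_mul mulmxA -(mulmxA u) QQ mulmx1.
Qed.

Lemma cdens_poisson u v : enorm u = 1 ->
  cdens rho Q u v = (Asurf R d ^+ 2)^-1 * poisson (rho *: (u *m Q)) v.
Proof.
move=> u1; rewrite /cdens /poisson (enorm_rotate u1) /affpow powRN; congr (_ * (_ * (_ `^ _)^-1)).
suff -> : (u *m Q *m v^T) ord0 ord0 = dotr (u *m Q) v by rewrite dotrZ; ring.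
by rewrite mxE; apply: eq_bigr => k _; rewrite [v^T _ _]mxE.
Qed.

(** The product form is required on the sphere only, so f may be built from truncated coordinates,
    which are the identity there. *)
Lemma joint_E_prod f a g h :
  (forall u v, enorm u = 1 -> enorm v = 1 -> f u v = a u * g v) ->
  sphere_fun g -> sphere_fun h ->
  (forall u, enorm u = 1 -> a u * m (fun v => g v * poisson (rho *: (u *m Q)) v) = h u) ->
  joint_E f = (Asurf R d ^+ 2)^-1 * m h.
Proof.
move=> fag sg sh Hh; rewrite /joint_E -sphere_intZ//.
apply: (sphere_int_ext d_gt0); first by apply: sphere_funM => //; exact: sphere_fun_cst.
move=> u u1; rewrite -Hh// mulrA.
have sgp : sphere_fun (fun v => g v * poisson (rho *: (u *m Q)) v).
  by apply: sphere_funM => //; apply: sphere_fun_poisson => //; rewrite enorm_rotate.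
rewrite -sphere_intZ//; apply: (sphere_int_ext d_gt0).
  by apply: sphere_funM => //; exact: sphere_fun_cst.
by move=> v v1; rewrite fag// cdens_poisson//; ring.
Qed.

Lemma sphere_int_cst c : m (fun=> c) = c * area.
Proof.
by rewrite -sphere_intZ; [under [in RHS]eq_fun do rewrite mulr1|exact: sphere_fun_cst].
Qed.

Lemma orthogonal_columns j l : \sum_a Q a j * Q a l = kd j l.
Proof.
have /matrixP/(_ j l) := mulmx1C QQ; rewrite !mxE => <-.
by apply: eq_bigr => a _; rewrite mxE.
Qed.

Lemma joint_E1 f : (forall u v, enorm u = 1 -> enorm v = 1 -> f u v = 1) ->
  joint_E f = joint_mass.
Proof.
move=> f1; rewrite (@joint_E_prod f (fun=> 1) (fun=> 1) (fun=> area)).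
- by rewrite sphere_int_cst -expr2.
- by move=> u v u1 v1; rewrite f1// mulr1.
- exact: sphere_fun_cst.
- exact: sphere_fun_cst.
- move=> u u1; rewrite mul1r; under eq_fun do rewrite mul1r.
  by apply: poisson_moment0 => //; rewrite enorm_rotate.
Qed.

Lemma joint_E0 f : (forall u v, enorm u = 1 -> enorm v = 1 -> f u v = 0) ->
  joint_E f = 0.
Proof.
move=> f0; rewrite (@joint_E_prod f (fun=> 0) (fun=> 1) (fun=> 0)).
- by rewrite sphere_int_cst mul0r mulr0.
- by move=> u v u1 v1; rewrite f0// mul0r.
- exact: sphere_fun_cst.
- exact: sphere_fun_cst.
- by move=> u u1; rewrite mul0r.
Qed.

Lemma joint_E_coord2 f i j :
  (forall u v, enorm u = 1 -> enorm v = 1 -> f u v = u ord0 i * v ord0 j) ->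
  joint_E f = joint_mass * (rho * Q i j / d%:R).
Proof.
move=> fE.
rewrite (@joint_E_prod f (fun u => u ord0 i) (fun v => v ord0 j)
  (fun u => \sum_a (rho * area * Q a j) * (u ord0 i * u ord0 a))).
- rewrite sphere_int_sum; last by move=> a; sfun.
  under eq_bigr => a _ do [rewrite sphere_intZ; [rewrite sphere_moment2//|by sfun]].
  rewrite (eq_bigr (fun a => kd i a * (rho * area * Q a j * (area / d%:R)))); last by move=> a _; ring.
  by rewrite sum_kd /joint_mass; ring.
- by move=> u v u1 v1; rewrite fE.
- by sfun.
- by apply: sphere_fun_sum => a; sfun.
- move=> u u1; rewrite poisson_moment1// ?enorm_rotate// mxE mxE mulr_sumr mulr_suml mulr_sumr.
  by apply: eq_bigr => a _; ring.
Qed.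

(** Given u, the second Poisson moment is a multiple of delta_jl plus a quadratic form in u. The
    fourth moments of u then give three pairings, and orthogonality of the columns of Q turns one of
    them into delta_ik delta_jl. *)
Lemma joint_E_coord4 f i j k l :
  (forall u v, enorm u = 1 -> enorm v = 1 ->
     f u v = u ord0 i * u ord0 k * (v ord0 j * v ord0 l)) ->
  joint_E f = joint_mass * ((1 - rho ^+ 2) / d%:R ^+ 2 * (kd i k * kd j l) +
    rho ^+ 2 / (d%:R * (d%:R + 2)) * (kd i k * kd j l + Q i j * Q k l + Q i l * Q k j)).
Proof.
move=> fE; have dR0 : d%:R != 0 :> R by rewrite pnatr_eq0 -lt0n.
have dR2 : d%:R + 2 != 0 :> R by rewrite gt_eqF// ltr_wpDl.
rewrite (@joint_E_prod f (fun u => u ord0 i * u ord0 k) (fun v => v ord0 j * v ord0 l)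
  (fun u => (area * (1 - rho ^+ 2) / d%:R * kd j l) * (u ord0 i * u ord0 k) +
    \sum_a \sum_b (area * rho ^+ 2 * (Q a j * Q b l)) * (u ord0 i * (u ord0 a * u ord0 b * u ord0 k)))).
- have s1 a b : sphere_fun (fun u : 'rV[R]_d => (area * rho ^+ 2 * (Q a j * Q b l)) * (u ord0 i * (u ord0 a * u ord0 b * u ord0 k))) by sfun.
  rewrite sphere_intD; [|by sfun|by apply: sphere_fun_sum => a; exact: sphere_fun_sum].
  rewrite sphere_intZ; last by sfun.
  rewrite sphere_moment2// sphere_int_sum; last by move=> a; exact: sphere_fun_sum.
  have mE a b : m (fun u : 'rV[R]_d => (area * rho ^+ 2 * (Q a j * Q b l)) * (u ord0 i * (u ord0 a * u ord0 b * u ord0 k))) =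
      kd i a * (kd k b * (area ^+ 2 * rho ^+ 2 / (d%:R * (d%:R + 2)) * (Q a j * Q b l))) +
      kd i b * (kd k a * (area ^+ 2 * rho ^+ 2 / (d%:R * (d%:R + 2)) * (Q a j * Q b l))) +
      kd a b * (kd i k * (area ^+ 2 * rho ^+ 2 / (d%:R * (d%:R + 2)) * (Q a j * Q b l))).
    rewrite sphere_intZ; last by sfun.
    by rewrite sphere_moment4// (eq_sym b k) (eq_sym a k); field; rewrite dR0 dR2.
  under eq_bigr => a _.
    rewrite sphere_int_sum//; under eq_bigr => b _ do rewrite mE.
    rewrite !big_split/= -mulr_sumr !sum_kd.
    over.
  rewrite !big_split/= !sum_kd -!mulr_sumr orthogonal_columns /joint_mass.
  by move: (Asurf R d ^- 2) => c; field; rewrite dR0 dR2.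
- by move=> u v u1 v1; rewrite fE.
- by sfun.
- apply: sphere_funD; first by sfun.
  by apply: sphere_fun_sum => a; apply: sphere_fun_sum => b; sfun.
- move=> u u1; rewrite poisson_moment2// ?enorm_rotate//.
  have yE q : (rho *: (u *m Q)) ord0 q = rho * \sum_a u ord0 a * Q a q by rewrite mxE mxE.
  rewrite !yE; set A := \sum_a \sum_b _.
  suff -> : A = area * rho ^+ 2 * (u ord0 i * u ord0 k) * ((\sum_a u ord0 a * Q a j) * (\sum_a u ord0 a * Q a l)).
    by field.
  rewrite mulr_suml mulr_sumr; apply: eq_bigr => a _; rewrite !mulr_sumr.
  by apply: eq_bigr => b _; ring.
Qed.

End JointMoments.

(** * The estimator *)

Section Score.
Variables (R : realType) (d : nat) (rho : R) (Q : 'M[R]_d).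
Implicit Types (u v : 'rV[R]_d).

(* The density hypothesis only speaks of bounded test functions, hence truncated
   coordinates; testing it with [|clip 2 x - clip 1 x|] shows that the sample
   coordinates almost surely agree with their truncations. *)
Definition clip (c x : R) : R := (`|x + c| - `|x - c|) / 2.

Lemma clip_id c x : `|x| <= c -> clip c x = x.
Proof.
rewrite ler_norml /clip => /andP[h1 h2].
by rewrite ger0_norm ?ler0_norm; lra.
Qed.

Lemma clip_le c x : 0 <= c -> `|clip c x| <= c.
Proof.
move=> c0; rewrite /clip ler_norml.
by case: (lerP 0 (x + c)) => h1; case: (lerP 0 (x - c)) => h2;
  rewrite ?(ger0_norm h1) ?(ltr0_norm h1) ?(ger0_norm h2) ?(ltr0_norm h2);
  apply/andP; split; lra.
Qed.

Lemma clip2_eq1 x : clip 2 x = clip 1 x -> `|x| <= 1.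
Proof.
have norm_cases (z : R) : (0 <= z /\ `|z| = z) \/ (z <= 0 /\ `|z| = - z).
  by have [z0|z0] := leP 0 z; [left; rewrite ger0_norm|right; rewrite ltr0_norm// ltW].
rewrite /clip ler_norml => e; apply/andP; split; move: e.
  by case: (norm_cases (x + 2)) (norm_cases (x - 2)) (norm_cases (x + 1)) (norm_cases (x - 1))
    => -[? ->] [] [? ->] [] [? ->] [] [? ->]; lra.
by case: (norm_cases (x + 2)) (norm_cases (x - 2)) (norm_cases (x + 1)) (norm_cases (x - 1))
  => -[? ->] [] [? ->] [] [? ->] [] [? ->]; lra.
Qed.

Lemma continuous_clip c : continuous (clip c).
Proof.
move=> x; apply: cvgMr_tmp; apply: cvgB.
  by apply: cvg_norm; apply: cvgD; [exact: cvg_id|exact: cvg_cst].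
by apply: cvg_norm; apply: cvgB; [exact: cvg_id|exact: cvg_cst].
Qed.

Lemma measurable_clip c : measurable_fun setT (clip c).
Proof. by apply: continuous_measurable_fun; exact: continuous_clip. Qed.

Lemma coord1_le u i : enorm u = 1 -> `|u ord0 i| <= 1.
Proof. by move=> <-; exact: le_coord_enorm. Qed.

Lemma clip1_sphere u i : enorm u = 1 -> clip 1 (u ord0 i) = u ord0 i.
Proof. by move=> u1; rewrite clip_id// coord1_le. Qed.

Lemma continuous_clip_l (i : 'I_d) (c : R) :
  continuous (fun p : 'rV[R]_d * 'rV[R]_d => clip c (p.1 ord0 i)).
Proof.
move=> p; apply: (@continuous_comp _ _ _ (fun p : 'rV[R]_d * 'rV[R]_d => p.1 ord0 i) (clip c)); last exact: continuous_clip.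
apply: (@continuous_comp _ _ _ fst (fun u : 'rV[R]_d => u ord0 i)); first exact: cvg_fst.
exact: coord_continuous.
Qed.

Lemma continuous_clip_r (i : 'I_d) (c : R) :
  continuous (fun p : 'rV[R]_d * 'rV[R]_d => clip c (p.2 ord0 i)).
Proof.
move=> p; apply: (@continuous_comp _ _ _ (fun p : 'rV[R]_d * 'rV[R]_d => p.2 ord0 i) (clip c)); last exact: continuous_clip.
apply: (@continuous_comp _ _ _ snd (fun u : 'rV[R]_d => u ord0 i)); first exact: cvg_snd.
exact: coord_continuous.
Qed.

Lemma continuous_realM (Y : topologicalType) (f g : Y -> R) :
  continuous f -> continuous g -> continuous (fun x => f x * g x).
Proof. by move=> cf cg x; apply: cvgM; [exact: cf|exact: cg]. Qed.

Lemma continuous_clip_product (i k : 'I_d) :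
  continuous (fun p : 'rV[R]_d * 'rV[R]_d => clip 1 (p.1 ord0 i) * clip 1 (p.2 ord0 k)).
Proof. exact: (continuous_realM (@continuous_clip_l i 1) (@continuous_clip_r k 1)). Qed.

Lemma mxvec_gidx (m : 'I_(d * d)) : mxvec_index (gidx m).2 (gidx m).1 = m.
Proof.
rewrite /mxvec_index /gidx /= -surjective_pairing enum_valK cast_ordKV.
by [].
Qed.

Lemma gidx_inj : injective (@gidx d).
Proof. by move=> m n e; rewrite -(mxvec_gidx m) -(mxvec_gidx n) e. Qed.

Lemma gvecE (A : 'M[R]_d) m : gvec A ord0 m = A (gidx m).1 (gidx m).2.
Proof. by rewrite /gvec -[in LHS](mxvec_gidx m) mxvecE mxE. Qed.

(** One centred summand of the estimator, vectorized, with truncated coordinates so that it is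
    bounded everywhere. *)
Definition score u v : 'rV[R]_(d * d) := \row_m
  (d%:R * (clip 1 (u ord0 (gidx m).1) * clip 1 (v ord0 (gidx m).2)) -
   rho * Q (gidx m).1 (gidx m).2).

(** The source space is arbitrary because the lemma serves twice: on T, and on T with the
    sigma-algebra of a single pair. *)
Lemma measurable_score d' (S : measurableType d') (p q : S -> 'rV[R]_d) :
  (forall i, measurable_fun setT (fun s => p s ord0 i)) ->
  (forall i, measurable_fun setT (fun s => q s ord0 i)) ->
  forall t : 'rV[R]_(d * d),
  measurable_fun setT (fun s => \sum_m t ord0 m * score (p s) (q s) ord0 m).
Proof.
move=> mp mq t.
apply: (@measurable_sum _ _ _ _ _ (index_enum 'I_(d * d)) (fun m s => t ord0 m * score (p s) (q s) ord0 m)) => m.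
under eq_fun do rewrite mxE.
apply: measurable_funM; first exact: measurable_cst.
apply: measurable_funB; last exact: measurable_cst.
apply: measurable_funM; first exact: measurable_cst.
by apply: measurable_funM; apply: (measurableT_comp (@measurable_clip 1)).
Qed.

Lemma score_bounded u v m : `|score u v ord0 m| <= d%:R + `|rho * Q (gidx m).1 (gidx m).2|.
Proof.
rewrite mxE (le_trans (ler_normB _ _))// lerD2r normrM ger0_norm ?ler0n//.
by rewrite -[leRHS]mulr1 ler_wpM2l ?ler0n// normrM mulr_ile1// clip_le.
Qed.

End Score.

(** * Unbiasedness, consistency and asymptotic normality for the sample *)

Section Sample.
Variables (R : realType) (d : nat) (rho : R) (Q : 'M[R]_d).
Context (d0 : measure_display) (T : measurableType d0) (P : probability T R).
Variables (U V : nat -> T -> 'rV[R]_d).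
Hypotheses (d_gt1 : (2 <= d)%N) (rho0 : 0 <= rho) (rho1 : rho < 1).
Hypothesis QQ : Q *m Q^T = 1%:M.
Hypothesis mU : forall j (i : 'I_d), measurable_fun setT (fun w => U j w ord0 i).
Hypothesis mV : forall j (i : 'I_d), measurable_fun setT (fun w => V j w ord0 i).
Hypothesis indep : mutually_independent P U V.
Hypothesis density : forall (j : nat) (f : 'rV[R]_d -> 'rV[R]_d -> R),
  bounded_fun (fun p : 'rV[R]_d * 'rV[R]_d => f p.1 p.2) ->
  continuous (fun p : 'rV[R]_d * 'rV[R]_d => f p.1 p.2) ->
  ('E_P[fun w => f (U j w) (V j w)] =
    (sphere_int (fun u => sphere_int (fun v => f u v * cdens rho Q u v)))%:E)%E.
Local Notation Ex := (Ex P).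
Local Notation score := (score rho Q).

Let dR0 : d%:R != 0 :> R.
Proof. by rewrite pnatr_eq0 -lt0n ltnW. Qed.

Lemma expectation_joint j f C : (forall u v, `|f u v| <= C) ->
  continuous (fun p : 'rV[R]_d * 'rV[R]_d => f p.1 p.2) ->
  'E_P[fun w => f (U j w) (V j w)]%E = (joint_E rho Q f)%:E.
Proof.
move=> HC cf; apply: density => //; exists C; split; first exact: num_real.
by move=> x Cx [u v] _ /=; rewrite (le_trans (HC u v))// ltW.
Qed.

(* The constant test function gives the normalization, so the Gamma function in
   [Asurf] is never evaluated. *)
Lemma joint_mass_eq1 : joint_mass R d = 1.
Proof.
have := @expectation_joint 0 (fun _ _ => 1) 1.
rewrite normr1 lexx => /(_ (fun _ _ => isT)).
rewrite (joint_E1 d_gt1 rho0 rho1 QQ)// expectation_cst => H.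
by apply: EFin_inj; rewrite -H// => x; exact: cvg_cst.
Qed.

(** The indices are countable, so one null set serves all of them and whole sums can be replaced by
    their truncated versions for every n at once. *)
Lemma ae_coord_le1 : {ae P, forall w, forall j i, `|U j w ord0 i| <= 1 /\ `|V j w ord0 i| <= 1}.
Proof.
have aux (f : 'rV[R]_d -> 'rV[R]_d -> R) (x : T -> R) j : measurable_fun setT x ->
    (forall w, f (U j w) (V j w) = `|clip 2 (x w) - clip 1 (x w)|) ->
    (forall u v, `|f u v| <= 3) ->
    continuous (fun p : 'rV[R]_d * 'rV[R]_d => f p.1 p.2) ->
    (forall u v, enorm u = 1 -> enorm v = 1 -> f u v = 0) ->
    {ae P, forall w, `|x w| <= 1}.
  move=> mx fE f3 cf f0.
  have := expectation_joint j f3 cf.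
  rewrite (joint_E0 d_gt1 rho0 rho1 QQ f0) unlock => H.
  pose g w := (clip 2 (x w) - clip 1 (x w))%:E.
  have mg : measurable_fun setT g.
    apply/measurable_EFinP; apply: measurable_funB.
      exact: (measurableT_comp (measurable_clip 2)).
    exact: (measurableT_comp (measurable_clip 1)).
  have /(ae_eq_integral_abs P measurableT mg) : (\int[P]_(w in setT) `|g w| = 0)%E.
    by rewrite -[RHS]H; apply: eq_integral => w _; rewrite fE.
  apply: filterS => w /(_ I) -[] /eqP; rewrite subr_eq0 => /eqP; exact: clip2_eq1.
have b3 (x : R) : `| `|clip 2 x - clip 1 x| | <= 3.
  rewrite normr_id (le_trans (ler_normB _ _))//.
  by have := @clip_le _ 2 x; have := @clip_le _ 1 x; lra.
apply/ae_foralln => j; apply: filter_forall => i; apply: filterI.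
- apply: (aux (fun u _ => `|clip 2 (u ord0 i) - clip 1 (u ord0 i)|) _ j) => //.
    by move=> p; apply: cvg_norm; apply: cvgB; exact: continuous_clip_l.
  by move=> u v u1 _; rewrite !clip_id ?subrr ?normr0// (le_trans (coord1_le i u1))// ler1n.
- apply: (aux (fun _ u => `|clip 2 (u ord0 i) - clip 1 (u ord0 i)|) _ j) => //.
    by move=> p; apply: cvg_norm; apply: cvgB; exact: continuous_clip_r.
  by move=> u v _ u1; rewrite !clip_id ?subrr ?normr0// (le_trans (coord1_le i u1))// ler1n.
Qed.

Let X j w : 'rV[R]_(d * d) := score (U j w) (V j w).

Let bX j m : brv (fun w => X j w ord0 m).
Proof.
split; last by exists (d%:R + `|rho * Q (gidx m).1 (gidx m).2|) => w; exact: score_bounded.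
have := measurable_score rho Q (mU j) (mV j) (delta_mx ord0 m).
congr measurable_fun; apply/funext => w; rewrite (bigD1 m)//= mxE !eqxx mul1r.
by rewrite big1 ?addr0// => n nm; rewrite mxE (negbTE nm) andbF mul0r.
Qed.

Let clipUV j i k w := clip 1 (U j w ord0 i) * clip 1 (V j w ord0 k).

Let b_clipUV j i k : brv (clipUV j i k).
Proof.
have b (Y : T -> R) : measurable_fun setT Y -> brv (fun w => clip 1 (Y w)).
  move=> mY; split; first exact: (measurableT_comp (@measurable_clip _ 1)).
  by exists 1 => w; exact: clip_le.
by apply: brvM; exact: b.
Qed.

Let clip_le1 x : `|clip 1 x : R| <= 1. Proof. exact: clip_le. Qed.

Lemma Ex_clipUV j i k : Ex (clipUV j i k) = rho * Q i k / d%:R.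
Proof.
apply: EFin_inj; rewrite -ExE//.
pose f (u v : 'rV[R]_d) := clip 1 (u ord0 i) * clip 1 (v ord0 k).
rewrite (@expectation_joint j f 1).
- rewrite (@joint_E_coord2 _ _ _ _ d_gt1 rho0 rho1 QQ f i k) ?joint_mass_eq1 ?mul1r//.
  by move=> u v u1 v1; rewrite /f !clip1_sphere.
- by move=> u v; rewrite normrM mulr_ile1.
- exact: continuous_clip_product.
Qed.

Lemma Ex_clipUVM j i k a b : Ex (fun w => clipUV j i k w * clipUV j a b w) =
  (1 - rho ^+ 2) / d%:R ^+ 2 * ((i == a)%:R * (k == b)%:R) +
  rho ^+ 2 / (d%:R * (d%:R + 2)) *
    ((i == a)%:R * (k == b)%:R + Q i k * Q a b + Q i b * Q a k).
Proof.
apply: EFin_inj; rewrite -ExE; last by apply: brvM; exact: b_clipUV.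
pose f (u v : 'rV[R]_d) := clip 1 (u ord0 i) * clip 1 (v ord0 k) *
  (clip 1 (u ord0 a) * clip 1 (v ord0 b)).
rewrite (@expectation_joint j f 1).
- rewrite (@joint_E_coord4 _ _ _ _ d_gt1 rho0 rho1 QQ f i k a b) ?joint_mass_eq1 ?mul1r//.
  by move=> u v u1 v1; rewrite /f !clip1_sphere//; ring.
- have pM (x y : R) : `|x| <= 1 -> `|y| <= 1 -> `|x * y| <= 1.
    by move=> x1 y1; rewrite normrM mulr_ile1.
  by move=> u v; apply: (pM); apply: pM.
- exact: (continuous_realM (@continuous_clip_product R d i k) (@continuous_clip_product R d a b)).
Qed.

Let XE j m w : X j w ord0 m =
  d%:R * clipUV j (gidx m).1 (gidx m).2 w - rho * Q (gidx m).1 (gidx m).2.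
Proof. by rewrite /X mxE. Qed.

Lemma Ex_score j m : Ex (fun w => X j w ord0 m) = 0.
Proof.
under [X in Ex X]eq_fun do rewrite XE.
rewrite ExB; [|by apply: brvM => //; exact: brv_cst|exact: brv_cst].
by rewrite Ex_cst ExZ// Ex_clipUV mulrC divfK// subrr.
Qed.

(** With m = (i,k) and n = (a,b), both cases of [Sigma] come from one formula: delta_mn (1 - 2
    rho^2/(d+2)) + rho^2/(d+2) (d Q_ib Q_ak - 2 Q_ik Q_ab). *)
Lemma Ex_scoreM j m n : Ex (fun w => X j w ord0 m * X j w ord0 n) = Sigma rho Q m n.
Proof.
have dR2 : d%:R + 2 != 0 :> R by rewrite gt_eqF// ltr_wpDl.
pose i := (gidx m).1; pose k := (gidx m).2; pose a := (gidx n).1; pose b := (gidx n).2.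
have mn : (i == a)%:R * (k == b)%:R = (m == n)%:R :> R.
  rewrite -natrM mulnb; congr (_%:R); congr nat_of_bool.
  apply/andP/eqP => [[/eqP ia /eqP kb]|mn]; last by rewrite /i /k mn.
  by apply: gidx_inj; rewrite [LHS]surjective_pairing [RHS]surjective_pairing; congr (_, _).
rewrite (_ : (fun w => _) = (fun w => (d%:R ^+ 2 * (clipUV j i k w * clipUV j a b w) +
   (- (rho * Q i k)) * X j w ord0 n) + (- (rho * Q a b) * d%:R) * clipUV j i k w)); last first.
  by apply/funext => w; rewrite !XE -/i -/k -/a -/b; ring.
have bZ c Y : brv Y -> brv (fun w => c * Y w) by move=> bY; apply: brvM => //; exact: brv_cst.
have bM : brv (fun w => clipUV j i k w * clipUV j a b w) by exact: brvM.
rewrite ExD; [|by apply: brvD; exact: bZ|exact: bZ].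
rewrite ExD; [|exact: bZ|exact: bZ].
rewrite !ExZ// Ex_score Ex_clipUV Ex_clipUVM mn mxE/= -/i -/k -/a -/b.
have [mn1|mn1] := eqVneq m n.
  have [-> ->] : a = i /\ b = k by rewrite /a /b -mn1.
  by rewrite mulr1n; field; rewrite dR0 dR2.
by rewrite mulr0n; field; rewrite dR0 dR2.
Qed.

Let proj (t : 'rV[R]_(d * d)) j w : R := \sum_m t ord0 m * X j w ord0 m.

Let bZX t j m : brv (fun w => (t : 'rV[R]_(d * d)) ord0 m * X j w ord0 m).
Proof. by apply: brvM => //; exact: brv_cst. Qed.

Lemma Ex_proj t j : Ex (proj t j) = 0.
Proof. by rewrite Ex_sum// big1// => m _; rewrite ExZ// Ex_score mulr0. Qed.

Lemma Ex_proj_sqr t j : Ex (fun w => proj t j w ^+ 2) = quad_form (Sigma rho Q) t.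
Proof.
rewrite (_ : (fun w => _) = (fun w => \sum_m \sum_n (t ord0 m * t ord0 n) * (X j w ord0 m * X j w ord0 n))); last first.
  apply/funext => w; rewrite expr2 /proj mulr_suml; apply: eq_bigr => m _.
  by rewrite mulr_sumr; apply: eq_bigr => n _; ring.
have b m n : brv (fun w => (t ord0 m * t ord0 n) * (X j w ord0 m * X j w ord0 n)).
  by apply: brvM; [exact: brv_cst|exact: brvM].
rewrite Ex_sum; last by move=> m; exact: brv_sum.
rewrite /quad_form mxE; under [RHS]eq_bigr do rewrite mxE mulr_suml.
rewrite exchange_big/=; apply: eq_bigr => m _.
rewrite Ex_sum//; apply: eq_bigr => n _.
rewrite ExZ; last exact: brvM.
by rewrite Ex_scoreM [t^T _ _]mxE; ring.
Qed.

Lemma Sigma_factorization : exists A : 'M[R]_(d * d), A *m A^T = Sigma rho Q.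
Proof.
apply: psd_factorization => [|t].
  apply/matrixP => m n; rewrite [LHS]mxE -!(Ex_scoreM 0); congr Ex.
  by apply/funext => w; rewrite mulrC.
rewrite -(Ex_proj_sqr t 0) -(Ex_cst P 0); apply: le_Ex => [||w]; last exact: sqr_ge0.
  exact: brv_cst.
by apply: brvM; exact: brv_sum.
Qed.

Let S j := sigmaUV U V j.

Lemma measurable_sigmaUV j A : S j A -> measurable A.
Proof.
apply: (@smallest_sub _ _ _ (@measurable _ T)); first exact: sigma_algebra_measurable.
by move=> B [i [C [mC [->|->]]]]; rewrite -[X in measurable X]setTI; [exact: mU|exact: mV].
Qed.

(** The measurability proof is replayed with T carrying the sigma-algebra generated by the j-th
    pair. *)
Lemma sigmaUV_proj t j (B : set R) : measurable B -> S j (proj t j @^-1` B).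
Proof.
pose G := [set A | exists (i : 'I_d) (B : set R), measurable B /\
  (A = (fun w => U j w ord0 i) @^-1` B \/ A = (fun w => V j w ord0 i) @^-1` B)].
pose T' := g_sigma_algebraType G.
have mU' i : measurable_fun [set: T'] (fun w : T' => U j w ord0 i).
  by move=> _ C mC; rewrite setTI; apply: sub_sigma_algebra; exists i, C; split => //; left.
have mV' i : measurable_fun [set: T'] (fun w : T' => V j w ord0 i).
  by move=> _ C mC; rewrite setTI; apply: sub_sigma_algebra; exists i, C; split => //; right.
move=> mB; have mp : measurable_fun [set: T'] (proj t j) by exact: measurable_score.
by have := mp measurableT B mB; rewrite setTI.
Qed.

Let bound (t : 'rV[R]_(d * d)) : R :=
  \sum_m `|t ord0 m| * (d%:R + `|rho * Q (gidx m).1 (gidx m).2|).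

Lemma proj_bounded t j w : `|proj t j w| <= bound t.
Proof.
rewrite (le_trans (ler_norm_sum _ _ _))// ler_sum// => m _.
by rewrite normrM ler_wpM2l// score_bounded.
Qed.

Let scaled_sum n w : 'rV[R]_(d * d) := (Num.sqrt n%:R)^-1 *: \sum_(j < n) X j w.

Let scaled_sumE n w m : scaled_sum n w ord0 m = (Num.sqrt n%:R)^-1 * \sum_(j < n) X j w ord0 m.
Proof. by rewrite mxE summxE. Qed.

Let b_scaled_sum n m : brv (fun w => scaled_sum n w ord0 m).
Proof.
under eq_fun do rewrite scaled_sumE.
by apply: brvM; [exact: brv_cst|exact: (@brv_sum _ _ _ _ _ (fun (j : 'I_n) w => X j w ord0 m))].
Qed.

Lemma proj_scaled_sum (t : 'rV[R]_(d * d)) n w :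
  \sum_m t ord0 m * scaled_sum n w ord0 m = (Num.sqrt n%:R)^-1 * psum (proj t) n w.
Proof.
under eq_bigr do rewrite scaled_sumE mulrCA mulr_sumr.
by rewrite -mulr_sumr; congr (_ * _); rewrite exchange_big.
Qed.

Lemma div_sqrt_le (K e : R) : 0 < e -> \forall n \near \oo, K / Num.sqrt n%:R <= e.
Proof.
move=> e0; exists (Num.Def.truncn ((K / e) ^+ 2)).+1 => // n /= Nn.
have n0 : 0 < n%:R :> R by rewrite ltr0n (leq_trans _ Nn).
rewrite ler_pdivrMr ?sqrtr_gt0// mulrC -ler_pdivrMr//.
rewrite (le_trans (ler_norm _))// -sqrtr_sqr ler_wsqrtr// ltW//.
by rewrite (lt_le_trans (truncnS_gt _))// ler_nat.
Qed.

(** Cramer-Wold reduction: for fixed t the scalar product is a normalized sum of the independent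
    real variables [proj t j]. *)
Lemma Ex_cos_scaled_sum t c :
  (fun n => Ex (fun w => cos (\sum_m (t : 'rV[R]_(d * d)) ord0 m * scaled_sum n w ord0 m + c))) @ \oo -->
  expR (- quad_form (Sigma rho Q) t / 2) * cos c.
Proof.
apply/cvgrPdist_le => e e0; rewrite mulNr.
pose s2 := quad_form (Sigma rho Q) t.
have := div_sqrt_le (bound t ^+ 3 + bound t ^+ 4 + s2 ^+ 2) e0.
have : \forall n \near \oo, (0 < n)%N by exists 1%N.
apply: filterS2 => n n0 Hn; rewrite distrC; apply: le_trans Hn.
under [X in Ex X]eq_fun do rewrite proj_scaled_sum.
exact: (Ex_cos_clt measurable_sigmaUV indep (sigmaUV_proj t) (proj_bounded t) (Ex_proj t) (Ex_proj_sqr t)).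
Qed.

Lemma Ex_sum_score_sqr n m :
  Ex (fun w => (\sum_(j < n) X j w ord0 m) ^+ 2) = n%:R * Sigma rho Q m m.
Proof.
have projE j w : proj (delta_mx ord0 m) j w = X j w ord0 m.
  rewrite /proj (bigD1 m)//= mxE !eqxx mul1r.
  by rewrite big1 ?addr0// => k km; rewrite mxE (negbTE km) andbF mul0r.
rewrite -(Ex_scoreM 0).
rewrite -(Ex_psum_sqr measurable_sigmaUV indep (sigmaUV_proj (delta_mx ord0 m))
  (proj_bounded (delta_mx ord0 m)) (Ex_proj (delta_mx ord0 m))) => [|j].
  by congr Ex; apply/funext => w; congr (_ ^+ 2); apply: eq_bigr => j _; rewrite projE.
by rewrite !Ex_scoreM -(Ex_scoreM j); congr Ex; apply/funext => w; rewrite projE expr2.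
Qed.

Lemma Sigma_diag_ge0 m : 0 <= Sigma rho Q m m.
Proof.
rewrite -(Ex_scoreM 0) -(Ex_cst P 0); apply: le_Ex => [||w]; last by rewrite -expr2 sqr_ge0.
  exact: brv_cst.
exact: brvM.
Qed.

(** For n > 0 both sides agree; at n = 0 the scaled sum is 0, and the bound remains uniform. *)
Lemma Ex_scaled_sum_sqr n :
  Ex (fun w => 1 + \sum_m scaled_sum n w ord0 m ^+ 2) <= 1 + \sum_m Sigma rho Q m m.
Proof.
have b2 m : brv (fun w => scaled_sum n w ord0 m ^+ 2) by apply: brvM; exact: b_scaled_sum.
rewrite ExD; [|exact: brv_cst|exact: brv_sum].
rewrite Ex_cst lerD2l Ex_sum// ler_sum// => m _.
under [X in Ex X]eq_fun do rewrite scaled_sumE exprMn.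
rewrite ExZ; last first.
  by apply: brvM; exact: (@brv_sum _ _ _ _ _ (fun (j : 'I_n) w => X j w ord0 m)).
rewrite Ex_sum_score_sqr exprVn sqr_sqrtr ?ler0n// mulrA.
by rewrite ler_piMl ?Sigma_diag_ge0//; case: (n) => [|k]; rewrite ?mulr0// mulVf// pnatr_eq0.
Qed.

Lemma score_clt (A : 'M[R]_(d * d)) (f : 'rV[R]_(d * d) -> R) C :
  A *m A^T = Sigma rho Q -> continuous f -> (forall x, `|f x| <= C) ->
  (fun n => Ex (fun w => f (scaled_sum n w))) @ \oo --> normal_E A f.
Proof.
move=> AS cf HC; apply: (Ex_cvg_normal_E b_scaled_sum Ex_scaled_sum_sqr _ cf HC) => t c.
by rewrite AS; exact: Ex_cos_scaled_sum.
Qed.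

Lemma rhoQhatE n w i k :
  rhoQhat U V n w i k = d%:R / n%:R * \sum_(j < n) U j w ord0 i * V j w ord0 k.
Proof.
rewrite mxE summxE; congr (_ * _); apply: eq_bigr => j _.
by rewrite mxE big_ord1 mxE.
Qed.

Lemma measurable_rhoQhat n i k : measurable_fun setT (fun w => rhoQhat U V n w i k).
Proof.
under eq_fun do rewrite rhoQhatE.
apply: measurable_funM; first exact: measurable_cst.
apply: (@measurable_sum _ _ _ _ _ (index_enum 'I_n) (fun j w => U j w ord0 i * V j w ord0 k)) => j.
exact: measurable_funM.
Qed.

(** The bridge from the estimator to bounded variables: truncation is almost surely invisible, and n
    > 0 lets the centring terms average to rho Q. *)
Lemma ae_rhoQhat : {ae P, forall w, forall n m, (0 < n)%N ->
  rhoQhat U V n w (gidx m).1 (gidx m).2 =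
  rho * Q (gidx m).1 (gidx m).2 + n%:R^-1 * \sum_(j < n) X j w ord0 m}.
Proof.
apply: filterS ae_coord_le1 => w Hw n m n0.
rewrite rhoQhatE; under [in RHS]eq_bigr => j _.
  rewrite XE /clipUV (clip_id (Hw j (gidx m).1).1) (clip_id (Hw j (gidx m).2).2).
  over.
rewrite sumrB -mulr_sumr sumr_const card_ord -mulr_natl.
by field; rewrite pnatr_eq0 -lt0n.
Qed.

Let average n m w : R := rho * Q (gidx m).1 (gidx m).2 + n%:R^-1 * \sum_(j < n) X j w ord0 m.

Let b_sum n m : brv (fun w => \sum_(j < n) X j w ord0 m).
Proof. exact: (@brv_sum _ _ _ _ _ (fun (j : 'I_n) w => X j w ord0 m)). Qed.

Let b_average n m : brv (average n m).
Proof.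
apply: brvD; first exact: brv_cst.
by apply: brvM; [exact: brv_cst|exact: b_sum].
Qed.

Lemma Ex_average n m : Ex (average n m) = rho * Q (gidx m).1 (gidx m).2.
Proof.
rewrite ExD; [|exact: brv_cst|by apply: brvM; [exact: brv_cst|exact: b_sum]].
rewrite Ex_cst ExZ// (@Ex_sum _ _ _ _ _ _ (fun (j : 'I_n) w => X j w ord0 m))//.
by rewrite big1 ?mulr0 ?addr0// => j _; rewrite Ex_score.
Qed.

Lemma gidx_surj (i k : 'I_d) : exists m : 'I_(d * d), gidx m = (i, k).
Proof.
exists (mxvec_index k i); rewrite /gidx /mxvec_index /=.
by rewrite cast_ordK enum_rankK.
Qed.

Lemma rhoQhat_unbiased n i k : (0 < n)%N ->
  P.-integrable setT (fun w => (rhoQhat U V n w i k)%:E) /\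
  'E_P[fun w => rhoQhat U V n w i k]%E = (rho * Q i k)%:E.
Proof.
move=> n0; have [m mE] := gidx_surj i k.
have m1 : measurable_fun setT (fun w => (rhoQhat U V n w i k)%:E).
  by apply/measurable_EFinP; exact: measurable_rhoQhat.
have m2 : measurable_fun setT (fun w => (average n m w)%:E).
  by apply/measurable_EFinP; have [] := b_average n m.
have e12 : ae_eq P setT (fun w => (rhoQhat U V n w i k)%:E) (fun w => (average n m w)%:E).
  apply: filterS ae_rhoQhat => w /(_ n m n0) H _.
  by rewrite mE in H; rewrite H /average mE.
split; last first.
  rewrite unlock (ae_eq_integral _ _ _ _ _ e12)//.
  have := ExE P (b_average n m); rewrite unlock => ->.
  by rewrite Ex_average mE.
apply/integrableP; split => //.
rewrite (ae_eq_integral (fun w => `|(average n m w)%:E|)%E)//.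
- by have /integrableP[] := brv_integrable P (b_average n m).
- exact: measurableT_comp.
- exact: measurableT_comp.
- by apply: filterS e12 => w H /H ->.
Qed.

Lemma rhoQhat_errorE n w i k : (rhoQhat U V n w - rho *: Q) i k = rhoQhat U V n w i k - rho * Q i k.
Proof. by rewrite [LHS]mxE [X in _ + X]mxE [X in - X]mxE. Qed.

Let scaled_error n w : 'rV[R]_(d * d) :=
  Num.sqrt n%:R *: (gvec (rhoQhat U V n w) - gvec (rho *: Q)).

Lemma scaled_error_cvg (A : 'M[R]_(d * d)) (f : 'rV[R]_(d * d) -> R) C :
  A *m A^T = Sigma rho Q -> continuous f -> (forall x, `|f x| <= C) ->
  (fun n => 'E_P[fun w => f (scaled_error n w)]%E) @ \oo --> (normal_E A f)%:E.
Proof.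
move=> AS cf HC; have mf := row_measurable_continuous cf HC.
have qf : quad_growth f by exact: quad_growth_bounded HC.
have eqE n : (0 < n)%N -> 'E_P[fun w => f (scaled_error n w)]%E = (Ex (fun w => f (scaled_sum n w)))%:E.
  move=> n0; have bf := brv_quad_growth b_scaled_sum n qf.
  rewrite -ExE// unlock; apply: ae_eq_integral => //.
  - apply/measurable_EFinP; apply: row_measurable_fun => // m.
    rewrite /scaled_error; under eq_fun do rewrite !mxE.
    apply: measurable_funM; first exact: measurable_cst.
    apply: measurable_funB; last exact: measurable_cst.
    by under eq_fun do rewrite gvecE; exact: measurable_rhoQhat.
  - by apply/measurable_EFinP; have [] := bf.
  - apply: filterS ae_rhoQhat => w Hw _; congr (f _)%:E; apply/rowP => m.
    rewrite scaled_sumE /scaled_error mxE [X in _ * X]mxE [X in _ + X]mxE !gvecE Hw//.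
    rewrite [(rho *: Q) _ _]mxE addrC addKr mulrA; congr (_ * _).
    have s0 : Num.sqrt n%:R != 0 :> R by rewrite gt_eqF// sqrtr_gt0 ltr0n.
    apply: (mulfI s0); rewrite mulrA -expr2 sqr_sqrtr ?ler0n// !divff//.
    by rewrite pnatr_eq0 -lt0n.
have near0 : \forall n \near \oo, 'E_P[fun w => f (scaled_error n w)]%E = (Ex (fun w => f (scaled_sum n w)))%:E.
  by exists 1%N => // n /= n0; exact: eqE.
apply/fine_cvgP; split; first by apply: filterS near0 => n ->.
apply: cvg_trans (score_clt AS cf HC); apply: near_eq_cvg.
by apply: filterS near0 => n /= ->.
Qed.

Lemma rhoQhat_consistent eps : 0 < eps ->
  (fun n => P [set w | eps < `|rhoQhat U V n w - rho *: Q|]) @ \oo --> 0%E.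
Proof.
move=> e0; pose E n := [set w | eps < `|rhoQhat U V n w - rho *: Q|].
pose sq n w := \sum_m (n%:R^-1 * \sum_(j < n) X j w ord0 m) ^+ 2.
have b_sq n : brv (sq n).
  apply: (@brv_sum _ _ _ _ (index_enum 'I_(d * d)) (fun m w => (n%:R^-1 * \sum_(j < n) X j w ord0 m) ^+ 2)) => m.
  by apply: brvM; apply: brvM => //; exact: brv_cst.
pose F n := [set w | eps ^+ 2 <= sq n w].
have mE n : measurable (E n).
  (* The matrix norm is the maximum of the entries, so the event is a finite union over entries. *)
  have -> : E n = \bigcup_(p in [set: 'I_d * 'I_d])
      [set w | eps < `|rhoQhat U V n w p.1 p.2 - rho * Q p.1 p.2|].
    apply/seteqP; split=> w /=; rewrite /E /Num.norm/= mx_normrE.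
      move=> /bigmax_gtP[|[p _]]; first by move=> /(lt_trans e0); rewrite ltxx.
      by rewrite rhoQhat_errorE => ?; exists p.
    by move=> [p _ /= H]; apply/bigmax_gtP; right; exists p => //; rewrite rhoQhat_errorE.
  apply: fin_bigcup_measurable; first exact: finite_finset.
  move=> p _; have -> : [set w | eps < `|rhoQhat U V n w p.1 p.2 - rho * Q p.1 p.2|] =
      ~` [set w | `|rhoQhat U V n w p.1 p.2 - rho * Q p.1 p.2| <= eps].
    by apply/seteqP; split=> w /=; rewrite ltNge => /negP.
  apply: measurableC; rewrite -[X in measurable X]setTI.
  apply: measurable_fun_le => //.
  apply: measurableT_comp => //; apply: measurable_funB; last exact: measurable_cst.
  exact: measurable_rhoQhat.
have mF n : measurable (F n).
  rewrite -[X in measurable X]setTI.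
  by apply: measurable_fun_le => //; have [] := b_sq n.
have EF n : (0 < n)%N -> (P (E n) <= P (F n))%E.
  move=> n0.
  (* Where the truncation is invisible, a single entry exceeding eps already pushes the sum of
     squares above eps^2. *)
  have N0 : P (E n `\` F n) = 0%E.
    apply: measure_negligible; first exact: measurableD.
    apply: negligibleS ae_rhoQhat => w [/= Ew Fw] H; apply: Fw.
    move: Ew; rewrite /E/= /Num.norm/= mx_normrE => /bigmax_gtP[|[p _]].
      by move=> /(lt_trans e0); rewrite ltxx.
    have [m mE'] := gidx_surj p.1 p.2.
    rewrite rhoQhat_errorE; have He : rhoQhat U V n w (gidx m).1 (gidx m).2 = average n m w := H n m n0.
    move: He; rewrite /average mE'/= => ->; rewrite addrC addKr => ep.
    rewrite /F/= /sq (bigD1 m)//= -[leLHS]addr0 lerD ?sumr_ge0//; last by move=> k _; exact: sqr_ge0.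
    by rewrite -[leRHS]real_normK ?num_real// lerXn2r ?nnegrE// (ltW e0, ltW ep).
  rewrite -[leRHS]adde0 -N0.
  have mD : measurable (E n `\` F n) by exact: measurableD.
  apply: le_trans (measureU2 P (mF n) mD).
  apply: le_measure; rewrite ?inE//; first by apply: measurableU => //; exact: measurableD.
  by move=> w Ew; case: (pselect (F n w)) => Fw; [left|right].
pose V0 := \sum_m Sigma rho Q m m.
(* Markov's inequality for [sq n], whose mean is the trace of [Sigma] divided by n. *)
have FV n : (0 < n)%N -> (P (F n) <= (eps ^- 2 * V0 / n%:R)%:E)%E.
  move=> n0; rewrite -(@fineK _ (P (F n))) ?fin_num_measure// lee_fin -Ex_indic//.
  have -> : eps ^- 2 * V0 / n%:R = Ex (fun w => eps ^- 2 * sq n w).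
    rewrite ExZ// -mulrA; congr (_ * _).
    rewrite /sq (@Ex_sum _ _ _ _ _ (index_enum 'I_(d * d)) (fun m w => (n%:R^-1 * \sum_(j < n) X j w ord0 m) ^+ 2)); last first.
      by move=> m; apply: brvM; apply: brvM => //; exact: brv_cst.
    rewrite /V0 mulr_suml; apply: eq_bigr => m _.
    under [X in Ex X]eq_fun do rewrite exprMn.
    rewrite ExZ; last by apply: brvM.
    by rewrite Ex_sum_score_sqr; field; rewrite pnatr_eq0 -lt0n.
  apply: le_Ex => [||w]; first exact: brv_indic.
    by apply: brvM => //; exact: brv_cst.
  have sq0 : 0 <= sq n w by apply: sumr_ge0 => m _; exact: sqr_ge0.
  rewrite indicE; case: (boolP (w \in F n)) => [|_].
    by rewrite inE /F/= => H; rewrite mulrC ler_pdivlMr ?exprn_gt0// mul1r.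
  by apply: mulr_ge0 => //; rewrite invr_ge0 exprn_ge0// ltW.
apply: (@squeeze_cvge _ _ _ _ (fun=> 0%E) _ (fun n => (eps ^- 2 * V0 / n%:R)%:E)).
- exists 1%N => // n /= n0; rewrite measure_ge0/=.
  exact: le_trans (EF n n0) (FV n n0).
- exact: cvg_cst.
- apply/fine_cvgP; split; first by apply: nearW.
  rewrite -[X in _ --> X](mulr0 (eps ^- 2 * V0)); apply: cvgMl_tmp.
  by apply/gtr0_cvgV0; [exists 1%N => // n /= n0; rewrite ltr0n|exact: cvgr_idn].
Qed.

End Sample.

Theorem theorem4 (R : realType) (d : nat) (rho : R) (Q : 'M[R]_d)
    (d0 : measure_display) (T : measurableType d0) (P : probability T R)
    (U V : nat -> T -> 'rV[R]_d) :
  (2 <= d)%N -> 0 <= rho -> rho < 1 -> Q *m Q^T = 1%:M ->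
  (* U_j, V_j are random vectors (measurable coordinates) *)
  (forall j (i : 'I_d), measurable_fun setT (fun w => U j w ord0 i)) ->
  (forall j (i : 'I_d), measurable_fun setT (fun w => V j w ord0 i)) ->
  (* the pairs (U_j, V_j) are mutually independent *)
  mutually_independent P U V ->
  (* each (U_j, V_j) has density c w.r.t. sigma (x) sigma on S^{d-1} x S^{d-1} *)
  (forall (j : nat) (f : 'rV[R]_d -> 'rV[R]_d -> R),
      bounded_fun (fun p : 'rV[R]_d * 'rV[R]_d => f p.1 p.2) ->
      continuous (fun p : 'rV[R]_d * 'rV[R]_d => f p.1 p.2) ->
      ('E_P[fun w => f (U j w) (V j w)] =
       (sphere_int (fun u => sphere_int (fun v => f u v * cdens rho Q u v)))%:E)%E) ->
  (* (i) unbiased *)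
  (forall (n : nat) (i k : 'I_d), (0 < n)%N ->
      P.-integrable setT (fun w => (rhoQhat U V n w i k)%:E) /\
      ('E_P[fun w => rhoQhat U V n w i k] = (rho * Q i k)%:E)%E) /\
  (* (i) consistent: convergence in probability *)
  (forall eps : R, 0 < eps ->
      (fun n => P [set w | eps < `| rhoQhat U V n w - rho *: Q |]) @ \oo --> 0%E) /\
  (* (ii) asymptotic normality: sqrt n (g(rhoQhat) - g(rho Q)) -> N(0, Sigma) *)
  (exists A : 'M[R]_(d * d), A *m A^T = Sigma rho Q /\
     forall f : 'rV[R]_(d * d) -> R, bounded_fun f -> continuous f ->
       (fun n => 'E_P[fun w => f (Num.sqrt n%:R *:
                      (gvec (rhoQhat U V n w) - gvec (rho *: Q)))]%E)
         @ \oo --> (normal_E A f)%:E).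
Proof.
move=> d2 rho0 rho1 QQ mU mV indep density; split; [|split].
- by move=> n i k n0; exact: (rhoQhat_unbiased d2 rho0 rho1 QQ mU mV density).
- by move=> eps eps0; exact: (rhoQhat_consistent d2 rho0 rho1 QQ mU mV indep density).
have [A AS] := Sigma_factorization d2 rho0 rho1 QQ mU mV density.
exists A; split => // f [M [_ HM]] cf.
(* [bounded_fun] bounds f by every constant strictly above M, hence M + 1. *)
apply: (scaled_error_cvg d2 rho0 rho1 QQ mU mV indep density (C := M + 1) AS cf) => x.
by apply: HM => //; rewrite ltrDl.
Qed.
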